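(* Let $k\ge1$ be an integer. For every $i=0,\dots,k$ one has $$\operatorname{Ker}\pi_{\Lambda_{k,i}}=I_{\Lambda_{k,i}}\cdot v^N_{\Lambda_{k,i}}\quad(\subset N^1(\Lambda_{k,i})).$$ In particular, $$\operatorname{Ker}\pi'_{\Lambda_{k,k}}=I'_{\Lambda_{k,k}}\cdot v^N_{\Lambda_{k,k}}\quad(\subset N^1(\Lambda_{k,k})).$$
   Context: Let $\mathfrak g=\mathfrak{sl}(2)=\mathbb C x_{-\alpha}\oplus\mathbb C h\oplus\mathbb C x_\alpha$ over $\mathbb C$, with $[h,x_{\alpha}]=2x_{\alpha}$, $[h,x_{-\alpha}]=-2x_{-\alpha}$, $[x_\alpha,x_{-\alpha}]=h$, and $\langle a,b\rangle=\operatorname{tr}(ab)$. The affine Lie algebra is $\widehat{\mathfrak g}=\mathfrak g\otimes\mathbb C[t,t^{-1}]\oplus\mathbb C\mathbf k$ with $\mathbf k$ central and $[a\otimes t^m,b\otimes t^n]=[a,b]\otimes t^{m+n}+m\langle a,b\rangle\delta_{m+n,0}\mathbf k$. Write $x(m)$ for $x\otimes t^m$ (and for its action on a module). Put $\widehat{\mathfrak g}_{\ge0}=\mathfrak g\otimes\mathbb C[t]\oplus\mathbb C\mathbf k$. Fix an integer $k\ge1$. For $0\le i\le k$ set $\Lambda_{k,i}=(k-i)\Lambda_0+i\Lambda_1$, where $\Lambda_0,\Lambda_1\in(\mathbb C h\oplus\mathbb C\mathbf k)^*$ are the fundamental weights: $\Lambda_j(\mathbf k)=1$, $\Lambda_j(h)=\delta_{j,1}$.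 Let $L(\Lambda_{k,i})$ be the level $k$ standard (integrable irreducible highest weight) $\widehat{\mathfrak g}$-module with highest weight $\Lambda_{k,i}$, and $v_{\Lambda_{k,i}}$ a (nonzero) highest weight vector: it is annihilated by $x_\alpha(0)$ and by $\mathfrak g\otimes t\mathbb C[t]$, $h(0)$ acts on it by $i$, and $\mathbf k$ acts by $k$. The generalized Verma module is $N(\Lambda_{k,i})=U(\widehat{\mathfrak g})\otimes_{U(\widehat{\mathfrak g}_{\ge0})}U_i$, where $U_i$ is the $(i+1)$-dimensional irreducible $\mathfrak g$-module, on which $\mathfrak g\otimes t\mathbb C[t]$ acts trivially and $\mathbf k$ acts as the scalar $k$; $v^N_{\Lambda_{k,i}}$ denotes a highest weight vector of $U_i$. Let $\Pi_{\Lambda_{k,i}}:N(\Lambda_{k,i})\to L(\Lambda_{k,i})$ be the surjective $\widehat{\mathfrak g}$-module map $a\cdot v^N_{\Lambda_{k,i}}\mapsto a\cdot v_{\Lambda_{k,i}}$ ($a\in U(\widehat{\mathfrak g})$) and $N^1(\Lambda_{k,i})=\operatorname{Ker}\Pi_{\Lambda_{k,i}}$. Let $\bar{\mathfrak n}=\mathbb C x_\alpha\otimes\mathbb C[t,t^{-1}]$, $\bar{\mathfrak n}_-=\mathbb C x_\alpha\otimes t^{-1}\mathbb C[t^{-1}]$, $\bar{\mathfrak n}_{\le-2}=\mathbb C x_\alpha\otimes t^{-2}\mathbb C[t^{-1}]$. These are abelian, so $U(\bar{\mathfrak n}_-)=\mathbb C[x_\alpha(-1),x_\alpha(-2),\dots]$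 and $U(\bar{\mathfrak n}_{\le-2})=\mathbb C[x_\alpha(-2),x_\alpha(-3),\dots]$ are polynomial algebras. Principal subspaces: $W(\Lambda_{k,i})=U(\bar{\mathfrak n})\cdot v_{\Lambda_{k,i}}=U(\bar{\mathfrak n}_-)\cdot v_{\Lambda_{k,i}}\subset L(\Lambda_{k,i})$ and $W^N(\Lambda_{k,i})=U(\bar{\mathfrak n})\cdot v^N_{\Lambda_{k,i}}=U(\bar{\mathfrak n}_-)\cdot v^N_{\Lambda_{k,i}}\subset N(\Lambda_{k,i})$. Also $W^N(\Lambda_{k,k})'=U(\bar{\mathfrak n}_{\le-2})\cdot v^N_{\Lambda_{k,k}}$; note $U(\bar{\mathfrak n}_{\le-2})\cdot v_{\Lambda_{k,k}}=W(\Lambda_{k,k})$. The maps $\pi_{\Lambda_{k,i}}:W^N(\Lambda_{k,i})\to W(\Lambda_{k,i})$ and $\pi'_{\Lambda_{k,k}}:W^N(\Lambda_{k,k})'\to W(\Lambda_{k,k})$ are the (surjective) restrictions of $\Pi_{\Lambda_{k,i}}$ and $\Pi_{\Lambda_{k,k}}$ respectively. Define $$R^0_{k,t}=\sum_{\substack{m_1,\dots,m_{k+1}\le-1\\ m_1+\cdots+m_{k+1}=-t}}x_\alpha(m_1)\cdots x_\alpha(m_{k+1})\in U(\bar{\mathfrak n}_-)\quad(t\ge k+1),$$ $$R^1_{k,t}=\sum_{\substack{m_1,\dots,m_{k+1}\le-2\\ m_1+\cdots+m_{k+1}=-t}}x_\alpha(m_1)\cdots x_\alpha(m_{k+1})\in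 U(\bar{\mathfrak n}_{\le-2})\quad(t\ge 2(k+1)),$$ and the ideals $$I_{\Lambda_{k,i}}=\sum_{t\ge k+1}U(\bar{\mathfrak n}_-)R^0_{k,t}+U(\bar{\mathfrak n}_-)x_\alpha(-1)^{k-i+1}\subset U(\bar{\mathfrak n}_-)\quad(0\le i\le k),$$ $$I'_{\Lambda_{k,k}}=\sum_{t\ge 2(k+1)}U(\bar{\mathfrak n}_{\le-2})R^1_{k,t}\subset U(\bar{\mathfrak n}_{\le-2}).$$ *)

(* Defs.v *)
From HB Require Import structures.
From mathcomp Require Import all_boot all_order all_algebra.
From mathcomp Require Import mathcomp_extra boolp classical_sets functions.
From mathcomp Require Import cardinality fsbigop finmap ring.

Set Implicit Arguments.
Unset Strict Implicit.
Unset Printing Implicit Defensive.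

Import Order.TTheory GRing.Theory Num.Theory.

Local Open Scope classical_set_scope.
Local Open Scope quotient_scope.
Local Open Scope ring_scope.

HB.mixin Record isLieAlgebra (K : fieldType) L of GRing.Lmodule K L := {
  lie_br : L -> L -> L;
  lie_linearl : forall a x y z,
    lie_br (a *: x + y) z = a *: lie_br x z + lie_br y z;
  lie_linearr : forall a x y z,
    lie_br z (a *: x + y) = a *: lie_br z x + lie_br z y;
  lie_brxx : forall x, lie_br x x = 0;
  lie_jacobi : forall x y z,
    lie_br x (lie_br y z) + lie_br y (lie_br z x) + lie_br z (lie_br x y) = 0
}.

#[short(type="lieAlgType")]
HB.structure Definition LieAlgebra (K : fieldType) :=
  {L of GRing.Lmodule K L & isLieAlgebra K L}.

Section LieTheory.
Variables (K : fieldType) (L : lieAlgType K).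
Implicit Types x y z : L.

Lemma lie_brDl x y z : lie_br (x + y) z = lie_br x z + lie_br y z.
Proof. by rewrite -[x in LHS]scale1r lie_linearl scale1r. Qed.

Lemma lie_brDr x y z : lie_br z (x + y) = lie_br z x + lie_br z y.
Proof. by rewrite -[x in LHS]scale1r lie_linearr scale1r. Qed.

Lemma lie_brC x y : lie_br x y = - lie_br y x.
Proof.
apply/eqP; rewrite -addr_eq0; apply/eqP.
by move: (lie_brxx (x + y)); rewrite lie_brDl !lie_brDr !lie_brxx add0r addr0.
Qed.

Lemma lie_br0l z : lie_br 0 z = 0.
Proof. by apply: (addIr (lie_br 0 z)); rewrite -lie_brDl !add0r. Qed.

Lemma lie_br0r z : lie_br z 0 = 0.
Proof. by rewrite lie_brC lie_br0l oppr0. Qed.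

Lemma lie_brZl a x z : lie_br (a *: x) z = a *: lie_br x z.
Proof. by rewrite -[a *: x]addr0 lie_linearl lie_br0l addr0. Qed.

Lemma lie_brZr a x z : lie_br z (a *: x) = a *: lie_br z x.
Proof. by rewrite -[a *: x]addr0 lie_linearr lie_br0r addr0. Qed.
End LieTheory.

Section LieSubalgebra.
Variables (K : fieldType) (L : lieAlgType K).

Record lieSubalg := LieSubalg {
  in_subalg :> pred L;
  subalg_closed : GRing.subsemimod_closed in_subalg;
  subalg_br : forall x y, x \in in_subalg -> y \in in_subalg ->
    lie_br x y \in in_subalg
}.

Variable S : lieSubalg.

Record subLie := SubLie { subLie_val :> L; _ : in_subalg S subLie_val }.

HB.instance Definition _ := [isSub for subLie_val].
HB.instance Definition _ := [Choice of subLie by <:].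
HB.instance Definition _ :=
  GRing.SubChoice_isSubLmodule.Build K L (in_subalg S) subLie (subalg_closed S).

Lemma subLie_valP a (x y : subLie) :
  subLie_val (a *: x + y) = a *: subLie_val x + subLie_val y.
Proof. exact: (linearP (\val : subLie -> L)). Qed.

Definition subLie_br (x y : subLie) : subLie :=
  SubLie (subalg_br (valP x) (valP y)).

Fact subLie_linearl a x y z :
  subLie_br (a *: x + y) z = a *: subLie_br x z + subLie_br y z.
Proof. by apply: val_inj; rewrite /= lie_linearl. Qed.

Fact subLie_linearr a x y z :
  subLie_br z (a *: x + y) = a *: subLie_br z x + subLie_br z y.
Proof. by apply: val_inj; rewrite /= lie_linearr. Qed.

Fact subLie_brxx x : subLie_br x x = 0.
Proof. by apply: val_inj; rewrite /= lie_brxx. Qed.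

Fact subLie_jacobi x y z : subLie_br x (subLie_br y z) +
  subLie_br y (subLie_br z x) + subLie_br z (subLie_br x y) = 0.
Proof. by apply: val_inj; rewrite /= lie_jacobi. Qed.

HB.instance Definition _ := isLieAlgebra.Build K subLie
  subLie_linearl subLie_linearr subLie_brxx subLie_jacobi.

End LieSubalgebra.

Section Sl2.
Variable K : fieldType.

Record sl2 := Sl2 { sl2_val :> 'M[K]_2; _ : \tr sl2_val == 0 }.

HB.instance Definition _ := [isSub for sl2_val].
HB.instance Definition _ := [Choice of sl2 by <:].

Fact sl2_closed : GRing.subsemimod_closed (fun A : 'M[K]_2 => \tr A == 0).
Proof.
do ?split.
- by rewrite unfold_in mxtrace0.
- by move=> A B /eqP A0 /eqP B0; rewrite unfold_in mxtraceD A0 B0 addr0.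
- by move=> a A /eqP A0; rewrite unfold_in mxtraceZ A0 mulr0.
Qed.

HB.instance Definition _ :=
  GRing.SubChoice_isSubLmodule.Build K 'M[K]_2 _ sl2 sl2_closed.

Fact commutator_tr (A B : sl2) : \tr (A *m B - B *m A) == 0.
Proof. by rewrite mxtraceD raddfN /= [X in X - _]mxtrace_mulC subrr. Qed.

Definition sl2_br (A B : sl2) : sl2 := Sl2 (commutator_tr A B).

Fact sl2_linearl a (A B D : sl2) :
  sl2_br (a *: A + B) D = a *: sl2_br A D + sl2_br B D.
Proof.
apply: val_inj; rewrite /= mulmxDl mulmxDr -scalemxAl -scalemxAr.
by rewrite scalerBr opprD addrACA.
Qed.

Fact sl2_linearr a (A B D : sl2) :
  sl2_br D (a *: A + B) = a *: sl2_br D A + sl2_br D B.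
Proof.
apply: val_inj; rewrite /= mulmxDl mulmxDr -scalemxAl -scalemxAr.
by rewrite scalerBr opprD addrACA.
Qed.

Fact sl2_brxx A : sl2_br A A = 0.
Proof. by apply: val_inj; rewrite /= subrr. Qed.

Fact sl2_jacobi A B D :
  sl2_br A (sl2_br B D) + sl2_br B (sl2_br D A) + sl2_br D (sl2_br A B) = 0.
Proof.
apply: val_inj; rewrite /= !mulmxBr !mulmxBl !mulmxA.
set x1 := A *m B *m D; set x2 := A *m D *m B; set x3 := B *m A *m D.
set x4 := B *m D *m A; set x5 := D *m A *m B; set x6 := D *m B *m A.
by apply/matrixP => i j; rewrite !mxE; ring.
Qed.

HB.instance Definition _ := isLieAlgebra.Build K sl2
  sl2_linearl sl2_linearr sl2_brxx sl2_jacobi.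

End Sl2.

Section Affine.
Variable K : fieldType.

Fact xa_tr : \tr (delta_mx 0 1 : 'M[K]_2) == 0.
Proof. by rewrite /mxtrace big_ord_recl big_ord1 !mxE addr0. Qed.

Fact xma_tr : \tr (delta_mx 1 0 : 'M[K]_2) == 0.
Proof. by rewrite /mxtrace big_ord_recl big_ord1 !mxE addr0. Qed.

Fact hh_tr : \tr (delta_mx 0 0 - delta_mx 1 1 : 'M[K]_2) == 0.
Proof. by rewrite /mxtrace big_ord_recl big_ord1 !mxE /= subr0 sub0r subrr. Qed.

(* [xa], [xma] and [hh] are x_alpha, x_{-alpha} and h. *)
Definition xa : sl2 K := Sl2 xa_tr.
Definition xma : sl2 K := Sl2 xma_tr.
Definition hh : sl2 K := Sl2 hh_tr.

Local Ltac sl2_entries :=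
  apply: val_inj; apply/matrixP => -[[|[|//]] ?] [[|[|//]] ?];
  rewrite /= !mxE !big_ord_recl !big_ord0 !mxE /=; ring.

Lemma sl2_hh_xa : lie_br hh xa = 2%:R *: xa. Proof. sl2_entries. Qed.

Lemma sl2_hh_xma : lie_br hh xma = - (2%:R *: xma). Proof. sl2_entries. Qed.

Lemma sl2_xa_xma : lie_br xa xma = hh. Proof. sl2_entries. Qed.

Definition trform (a b : sl2 K) : K := \tr (sl2_val a *m sl2_val b).

(* g (x) C[t, t^-1] as finitely supported functions int -> g:
   f stands for the sum over m of f m (x) t^m. *)
Record loop := Loop {
  loop_coef :> int -> sl2 K;
  _ : `[< finite_set [set m | loop_coef m != 0] >]
}.

HB.instance Definition _ := [isSub for loop_coef].
HB.instance Definition _ := [Choice of loop by <:].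

Fact loop_closed : GRing.subsemimod_closed
  (fun f : int -> sl2 K => `[< finite_set [set m | f m != 0] >]).
Proof.
do ?split.
- rewrite unfold_in; apply/asboolP.
  rewrite (_ : [set _ | _] = set0)//; by apply/seteqP; split=> // m /= /eqP[].
- move=> f g /asboolP ff /asboolP gf; rewrite unfold_in; apply/asboolP.
  apply: (@sub_finite_set _ _ ([set m | f m != 0] `|` [set m | g m != 0])).
    move=> m /=; have [f0|] := eqVneq (f m) 0; last by left.
    have [g0|] := eqVneq (g m) 0; last by right.
    by rewrite fctE f0 g0 addr0 eqxx.
  by rewrite finite_setU.
- move=> a f /asboolP ff; rewrite unfold_in; apply/asboolP.
  apply: sub_finite_set ff => m /=; apply: contraNN => /eqP f0.
  by rewrite fctE f0 scaler0.
Qed.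

HB.instance Definition _ :=
  GRing.SubChoice_isSubLmodule.Build K (int -> sl2 K) _ loop loop_closed.

(* The second component is the coefficient of the central element k. *)
Definition affine := (loop * K^o)%type.
HB.instance Definition _ := GRing.Lmodule.on affine.

Fact tmono_finite (a : sl2 K) (m : int) :
  `[< finite_set [set n : int | (if n == m then a else 0) != 0] >].
Proof.
apply/asboolP; apply: (@sub_finite_set _ _ [set m]) => // n /=.
by have [//|_ /eqP[]] := eqVneq n m.
Qed.

(* [tmono a m] is a (x) t^m, and [kk] is the central element. *)
Definition tmono (a : sl2 K) (m : int) : affine := (Loop (tmono_finite a m), 0).
Definition kk : affine := (0, 1).

(* [a (x) t^m, b (x) t^n]; [affine_br] is its bilinear extension, a sum with
   finite support. *)
Definition mono_br (a : sl2 K) (m : int) (b : sl2 K) (n : int) : affine :=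
  tmono (lie_br a b) (m + n) +
  (m%:~R * trform a b * (m + n == 0)%:R) *: kk.

Definition affine_br (X Y : affine) : affine :=
  \sum_(m \in [set: int]) \sum_(n \in [set: int]) mono_br (X.1 m) m (Y.1 n) n.

Implicit Types X Y Z : affine.

Lemma tmono_linear a (x y : sl2 K) m :
  tmono (a *: x + y) m = a *: tmono x m + tmono y m.
Proof.
congr pair; last by rewrite /= scaler0 addr0.
apply: val_inj; apply/funext => n /=; rewrite !fctE.
by case: eqP => // _; rewrite scaler0 addr0.
Qed.

Lemma tmono0 m : tmono 0 m = 0.
Proof.
by have := tmono_linear (-1) 0 0 m; rewrite scaler0 addr0 scaleN1r addNr.
Qed.

Lemma tmonoD (x y : sl2 K) m : tmono (x + y) m = tmono x m + tmono y m.
Proof. by rewrite -[x]scale1r tmono_linear !scale1r. Qed.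


Lemma affine_sum1 (I : Type) (r : seq I) (F : I -> affine) n :
  (\sum_(i <- r) F i).1 n = \sum_(i <- r) (F i).1 n.
Proof. by elim: r => [|i r IH]; rewrite ?big_nil ?big_cons // -IH. Qed.

Lemma affine_sum2 (I : Type) (r : seq I) (F : I -> affine) :
  (\sum_(i <- r) F i).2 = \sum_(i <- r) (F i).2.
Proof. by elim: r => [|i r IH]; rewrite ?big_nil ?big_cons // -IH. Qed.

Lemma affineP (X Y : affine) : (forall m, X.1 m = Y.1 m) -> X.2 = Y.2 -> X = Y.
Proof.
case: X Y => [f c] [g d] /= fg ->; congr pair.
by apply: val_inj; apply/funext.
Qed.

Lemma affineD1 (X Y : affine) n : (X + Y).1 n = X.1 n + Y.1 n.
Proof. by []. Qed.

Lemma affineZ1 a (X : affine) n : (a *: X).1 n = a *: X.1 n.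
Proof. by []. Qed.

Lemma affine01 n : (0 : affine).1 n = 0.
Proof. by []. Qed.

Lemma tmonoE a m n : (tmono a m).1 n = if n == m then a else 0.
Proof. by []. Qed.

Lemma affineE (X : affine) :
  X = \sum_(m \in [set m | X.1 m != 0]) tmono (X.1 m) m + X.2 *: kk.
Proof.
have /asboolP Xf := valP X.1.
rewrite fsbig_finite //=; apply: affineP => [n|].
  rewrite affineD1 affineZ1 affine01 scaler0 addr0 affine_sum1.
  have [Xn0|Xn0] := eqVneq (X.1 n) 0.
    rewrite Xn0 big1 // => m _; rewrite tmonoE.
    by case: eqP => [<-|].
  rewrite (bigD1_seq n) ?fset_uniq //; last by rewrite in_fset_set // mem_set.
  rewrite tmonoE eqxx big1; first exact/esym/addr0.
  move=> m; rewrite tmonoE eq_sym.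
  by move=> /negbTE ->.
transitivity (0 + X.2 * 1); first by rewrite add0r mulr1.
by rewrite -[LHS]/(_ + _); congr (_ + _); rewrite affine_sum2 big1.
Qed.

Lemma affine_ind (P : affine -> Prop) :
  (forall X Y, P X -> P Y -> P (X + Y)) ->
  (forall a m, P (tmono a m)) -> (forall c, P (c *: kk)) ->
  forall X, P X.
Proof.
move=> PD Pm Pk X; have P0 : P 0 by rewrite -(scale0r kk).
have /asboolP Xf := valP X.1.
by rewrite (affineE X) fsbig_finite //; apply: (PD) => //; elim/big_ind : _.
Qed.

Lemma trform_linl a x y z : trform (a *: x + y) z = a * trform x z + trform y z.
Proof. by rewrite /trform mulmxDl -scalemxAl linearP. Qed.

Lemma trformC x y : trform x y = trform y x.
Proof. exact: mxtrace_mulC. Qed.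

Lemma trform_linr a x y z : trform z (a *: x + y) = a * trform z x + trform z y.
Proof. by rewrite !(trformC z) trform_linl. Qed.

Lemma trform_inv x y z : trform x (lie_br y z) = trform y (lie_br z x).
Proof.
rewrite /trform /= !mulmxBr !mulmxA !linearB /=; congr (_ - _).
  by rewrite -mulmxA mxtrace_mulC.
by rewrite mxtrace_mulC mulmxA.
Qed.

Lemma mono_br_linl m n b a x y :
  mono_br (a *: x + y) m b n = a *: mono_br x m b n + mono_br y m b n.
Proof.
rewrite /mono_br lie_linearl tmono_linear trform_linl scalerDr scalerA.
by rewrite addrACA -scalerDl mulrDr mulrDl; congr (_ + _ *: _); ring.
Qed.

Lemma mono_br_linr m n b a x y :
  mono_br b m (a *: x + y) n = a *: mono_br b m x n + mono_br b m y n.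
Proof.
rewrite /mono_br lie_linearr tmono_linear trform_linr scalerDr scalerA.
by rewrite addrACA -scalerDl mulrDr mulrDl; congr (_ + _ *: _); ring.
Qed.

Lemma mono_br0l m b n : mono_br 0 m b n = 0.
Proof.
by have := mono_br_linl m n b (-1) 0 0; rewrite scaler0 addr0 scaleN1r addNr.
Qed.

Lemma mono_br0r m b n : mono_br b m 0 n = 0.
Proof.
by have := mono_br_linr m n b (-1) 0 0; rewrite scaler0 addr0 scaleN1r addNr.
Qed.

Lemma affine_br_widen (A : set int) X Y : finite_set A ->
  (forall m, X.1 m != 0 -> A m) -> (forall m, Y.1 m != 0 -> A m) ->
  affine_br X Y =
  \sum_(m <- fset_set A) \sum_(n <- fset_set A) mono_br (X.1 m) m (Y.1 n) n.
Proof.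
move=> Af XA YA; rewrite /affine_br -(fsbig_widen A setT) //; last first.
  move=> m [_ /= nAm]; apply: fsbig1 => n _.
  have [->|/XA//] := eqVneq (X.1 m) 0; exact: mono_br0l.
rewrite fsbig_finite //=; apply: eq_bigr => m _.
rewrite -(fsbig_widen A setT) ?fsbig_finite // => n [_ /= nAn].
have [->|/YA//] := eqVneq (Y.1 n) 0; exact: mono_br0r.
Qed.

Lemma affine_supp (s : seq affine) : exists2 A : set int, finite_set A &
  forall X, X \in s -> forall m, X.1 m != 0 -> A m.
Proof.
elim: s => [|X s [A Af sA]]; first by exists set0.
exists ([set m | X.1 m != 0] `|` A).
  by rewrite finite_setU; split=> //; exact/asboolP/(valP X.1).
by move=> Y; rewrite in_cons => /orP[/eqP-> m|/sA YA m /YA]; [left|right].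
Qed.

Fact affine_linearl a X Y Z :
  affine_br (a *: X + Y) Z = a *: affine_br X Z + affine_br Y Z.
Proof.
have [A Af sA] := affine_supp [:: X; Y; Z; a *: X + Y].
rewrite !(@affine_br_widen A) //; try by apply: sA; rewrite !in_cons eqxx ?orbT.
rewrite scaler_sumr -big_split; apply: eq_bigr => m _.
rewrite -[RHS]/(_ + _) scaler_sumr -big_split; apply: eq_bigr => n _.
by rewrite -[RHS]/(_ + _) affineD1 affineZ1 mono_br_linl.
Qed.

Fact affine_linearr a X Y Z :
  affine_br Z (a *: X + Y) = a *: affine_br Z X + affine_br Z Y.
Proof.
have [A Af sA] := affine_supp [:: X; Y; Z; a *: X + Y].
rewrite !(@affine_br_widen A) //; try by apply: sA; rewrite !in_cons eqxx ?orbT.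
rewrite scaler_sumr -big_split; apply: eq_bigr => m _.
rewrite -[RHS]/(_ + _) scaler_sumr -big_split; apply: eq_bigr => n _.
by rewrite -[RHS]/(_ + _) affineD1 affineZ1 mono_br_linr.
Qed.

Lemma affine_brDl X Y Z : affine_br (X + Y) Z = affine_br X Z + affine_br Y Z.
Proof. by rewrite -[X]scale1r affine_linearl !scale1r. Qed.

Lemma affine_brDr X Y Z : affine_br Z (X + Y) = affine_br Z X + affine_br Z Y.
Proof. by rewrite -[X]scale1r affine_linearr !scale1r. Qed.

Lemma affine_brkl c X : affine_br (c *: kk) X = 0.
Proof.
rewrite /affine_br; apply: fsbig1 => m _; apply: fsbig1 => n _.
by rewrite affineZ1 affine01 scaler0 mono_br0l.
Qed.

Lemma affine_brkr c X : affine_br X (c *: kk) = 0.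
Proof.
rewrite /affine_br; apply: fsbig1 => m _; apply: fsbig1 => n _.
by rewrite affineZ1 affine01 scaler0 mono_br0r.
Qed.

Lemma affine_br_tmono a m b n :
  affine_br (tmono a m) (tmono b n) = tmono (lie_br a b) (m + n) +
    (m%:~R * trform a b * (m + n == 0)%:R) *: kk.
Proof.
rewrite /affine_br -(fsbig_widen [set m] setT) ?fsbig_set1 //; last first.
  move=> p [_ pm]; have {pm} /negbTE pm : p != m by apply/eqP.
  apply: fsbig1 => q _.
  by rewrite tmonoE pm mono_br0l.
rewrite -(fsbig_widen [set n] setT) ?fsbig_set1 //; last first.
  move=> q [_ qn]; have {qn} /negbTE qn : q != n by apply/eqP.
  have qE : (tmono b n).1 q = 0 by rewrite tmonoE qn.
  by apply: (etrans (congr1 (fun z => mono_br _ m z q) qE)); exact: mono_br0r.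
by rewrite !tmonoE !eqxx.
Qed.

Lemma affine_br_anti X Y : affine_br X Y + affine_br Y X = 0.
Proof.
elim/affine_ind: X => [X X' IH IH'|a m|c].
- by rewrite affine_brDl affine_brDr addrACA IH IH' addr0.
- elim/affine_ind: Y => [Y Y' IH IH'|b n|c].
  + by rewrite affine_brDl affine_brDr addrACA IH IH' addr0.
  + rewrite !affine_br_tmono addrACA (addrC n m) -tmonoD (lie_brC a) addNr tmono0.
    rewrite add0r -scalerDl (trformC b) -!mulrDl -rmorphD /=.
    by have [->|_] := eqVneq (m + n) 0; rewrite ?mulr0 ?mul0r scale0r.
  + by rewrite affine_brkl affine_brkr addr0.
- by rewrite affine_brkl affine_brkr addr0.
Qed.

Fact affine_brxx X : affine_br X X = 0.
Proof.
elim/affine_ind: X => [X Y IX IY|a m|c].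
- by rewrite affine_brDl !affine_brDr IX IY add0r addr0 affine_br_anti.
- rewrite affine_br_tmono lie_brxx tmono0 add0r.
  have [m0|_] := eqVneq (m + m) 0; last by rewrite mulr0 scale0r.
  suff -> : m = 0 by rewrite !mul0r scale0r.
  by move/eqP: m0; rewrite -mulr2n mulrn_eq0 /= => /eqP.
- by rewrite affine_brkl.
Qed.

Let J X Y Z := affine_br X (affine_br Y Z) + affine_br Y (affine_br Z X)
  + affine_br Z (affine_br X Y).

Let JC X Y Z : J X Y Z = J Y Z X.
Proof. by rewrite /J -addrA addrC. Qed.

Let addr6 (V : zmodType) (a a' b b' c c' : V) :
  (a + a') + (b + b') + (c + c') = (a + b + c) + (a' + b' + c').
Proof. by rewrite [RHS]addrACA [in RHS](addrACA a). Qed.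

Let JD X X' Y Z : J (X + X') Y Z = J X Y Z + J X' Y Z.
Proof.
rewrite /J affine_brDl (affine_brDr X X' Z) affine_brDr.
by rewrite (affine_brDl X X' Y) affine_brDr; exact: addr6.
Qed.

Let Jk c Y Z : J (c *: kk) Y Z = 0.
Proof.
have br0 W : affine_br W 0 = 0 by have := affine_brkr 0 W; rewrite scale0r.
by rewrite /J affine_brkl (affine_brkr c Z) (affine_brkl c Y) !br0 !addr0.
Qed.

Fact affine_jacobi X Y Z : affine_br X (affine_br Y Z) +
  affine_br Y (affine_br Z X) + affine_br Z (affine_br X Y) = 0.
Proof.
rewrite -/(J X Y Z).
elim/affine_ind: X => [X X' IH IH'|a m|c]; [by rewrite JD IH IH' addr0| |exact: Jk].
rewrite JC.
elim/affine_ind: Y => [Y Y' IH IH'|b n|c]; [by rewrite JD IH IH' addr0| |exact: Jk].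
rewrite JC.
elim/affine_ind: Z => [Z Z' IH IH'|c p|c]; [by rewrite JD IH IH' addr0| |exact: Jk].
rewrite JC /J !affine_br_tmono !affine_brDr !affine_brkr !addr0 !affine_br_tmono.
rewrite -(trform_inv a b c) -(trform_inv b c a) -(trform_inv a b c).
have -> : n + (p + m) = m + (n + p) by ring.
have -> : p + (m + n) = m + (n + p) by ring.
rewrite addr6 -!tmonoD -!scalerDl lie_jacobi tmono0.
rewrite add0r -!mulrDl -!rmorphD /= -addrA.
by have [->|_] := eqVneq (m + (n + p)) 0; rewrite ?mulr0 ?mul0r scale0r.
Qed.

HB.instance Definition _ := isLieAlgebra.Build K affine
  affine_linearl affine_linearr affine_brxx affine_jacobi.

End Affine.

Section AffineSubalgebras.
Variable K : fieldType.
Local Notation affine := (affine K).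
Implicit Types X Y : affine.

(* g (x) C[t] + C k *)
Definition ge0_pred : pred affine :=
  fun X => `[< forall m : int, m < 0 -> X.1 m = 0 >].

(* the span of the x_alpha (x) t^m with m in I *)
Definition nbar_pred (I : pred int) : pred affine := fun X =>
  `[< X.2 = 0 /\
      forall m, exists2 c : K, X.1 m = c *: xa K & (~~ I m -> c = 0) >].

Fact ge0_closed : GRing.subsemimod_closed ge0_pred.
Proof.
do ?split; rewrite ?unfold_in.
- exact/asboolP.
- move=> X Y /asboolP X0 /asboolP Y0; apply/asboolP => m m0.
  by rewrite affineD1 X0 // Y0 // addr0.
- move=> a X /asboolP X0; apply/asboolP => m m0.
  by rewrite affineZ1 X0 // scaler0.
Qed.

Lemma mono_br1E a m b n p :
  (mono_br a m b n : affine).1 p = if p == m + n then lie_br a b else 0.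
Proof. by rewrite /mono_br affineD1 affineZ1 affine01 scaler0 addr0 tmonoE. Qed.

Lemma mono_br2E a m b n :
  (mono_br a m b n : affine).2 = m%:~R * trform a b * (m + n == 0)%:R.
Proof. by rewrite -[LHS]/(0 + _ * 1) add0r mulr1. Qed.

Fact ge0_br X Y : X \in ge0_pred -> Y \in ge0_pred -> lie_br X Y \in ge0_pred.
Proof.
move=> /asboolP X0 /asboolP Y0; rewrite unfold_in; apply/asboolP => p p0.
have [A Af sA] := affine_supp [:: X; Y].
rewrite [lie_br _ _](affine_br_widen Af); try by apply: sA; rewrite !in_cons eqxx ?orbT.
rewrite affine_sum1 big1 // => m _; rewrite affine_sum1 big1 // => n _.
rewrite mono_br1E; case: eqP => // pE.
have [/X0 ->|m0] := ltP m 0; first exact: lie_br0l.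
have [/Y0 ->|n0] := ltP n 0; first exact: lie_br0r.
by move: p0; rewrite pE ltNge addr_ge0.
Qed.

Lemma ge0_brE X Y : X \in ge0_pred -> Y \in ge0_pred ->
  (lie_br X Y).1 0 = lie_br (X.1 0) (Y.1 0) /\ (lie_br X Y).2 = 0.
Proof.
move=> /asboolP X0 /asboolP Y0.
have [A Af sA] := affine_supp [:: X; Y; tmono (xa K) 0].
have A0 : A 0.
  apply: (sA (tmono (xa K) 0)); first by rewrite !in_cons eqxx ?orbT.
  rewrite tmonoE eqxx; apply/eqP => /(congr1 (fun B => sl2_val B 0 1)).
  by rewrite /= !mxE /=; apply/eqP/oner_neq0.
have mem0 : 0 \in fset_set A by rewrite in_fset_set // mem_set.
rewrite [lie_br _ _](affine_br_widen Af); try by apply: sA; rewrite !in_cons eqxx ?orbT.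
split.
  rewrite affine_sum1 (bigD1_seq 0) ?fset_uniq // affine_sum1 (bigD1_seq 0) ?fset_uniq //.
  rewrite mono_br1E addr0 eqxx big1 => [|n]; last first.
    by rewrite mono_br1E add0r eq_sym => /negbTE ->.
  rewrite big1 => [|m m0]; first by rewrite -[LHS]/(_ + 0 + 0) !addr0.
  rewrite affine_sum1 big1 // => n _; rewrite mono_br1E; case: eqP => // mn.
  have [/X0 ->|mge] := ltP m 0; first exact: lie_br0l.
  have [/Y0 ->|nge] := ltP n 0; first exact: lie_br0r.
  by move: m0; move/eqP: mn; rewrite eq_sym paddr_eq0 // => /andP[->].
rewrite affine_sum2 big1 // => m _; rewrite affine_sum2 big1 // => n _.
rewrite mono_br2E.
have [/X0 ->|mge] := ltP m 0.
  by rewrite /trform mul0mx mxtrace0 mulr0 mul0r.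
have [/Y0 ->|nge] := ltP n 0.
  by rewrite /trform mulmx0 mxtrace0 mulr0 mul0r.
rewrite paddr_eq0 //; case: (m =P 0) => [->|_]; last by rewrite mulr0.
by rewrite !mul0r.
Qed.

Fact nbar_closed I : GRing.subsemimod_closed (nbar_pred I).
Proof.
do ?split; rewrite ?unfold_in.
- by apply/asboolP; split=> // m; exists 0; rewrite ?scale0r.
- move=> X Y /asboolP[X2 Xa] /asboolP[Y2 Ya]; apply/asboolP; split.
    by rewrite -[LHS]/(X.2 + Y.2) X2 Y2 addr0.
  move=> m; have [c cE c0] := Xa m; have [d dE d0] := Ya m.
  exists (c + d); first by rewrite affineD1 cE dE scalerDl.
  by move=> nI; rewrite c0 // d0 // addr0.
- move=> a X /asboolP[X2 Xa]; apply/asboolP; split.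
    by rewrite -[LHS]/(a * X.2) X2 mulr0.
  move=> m; have [c cE c0] := Xa m.
  exists (a * c); first by rewrite affineZ1 cE scalerA.
  by move=> nI; rewrite c0 // mulr0.
Qed.

Lemma trform_xa : trform (xa K) (xa K) = 0.
Proof.
by rewrite /trform /= mul_delta_mx_0 ?mxtrace0.
Qed.

Lemma nbar_br0 I X Y :
  X \in nbar_pred I -> Y \in nbar_pred I -> lie_br X Y = 0.
Proof.
move=> /asboolP[_ Xa] /asboolP[_ Ya]; apply: fsbig1 => m _; apply: fsbig1 => n _.
have [c -> _] := Xa m; have [d -> _] := Ya n.
rewrite /mono_br lie_brZl lie_brZr lie_brxx !scaler0 tmono0 add0r.
rewrite -[c *: _]addr0 trform_linl -[d *: _]addr0 trform_linr trform_xa.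
rewrite /trform mul0mx mxtrace0 mulmx0 mxtrace0.
by rewrite !(mulr0, addr0, mul0r) scale0r.
Qed.

Fact nbar_br I X Y : X \in nbar_pred I -> Y \in nbar_pred I ->
  lie_br X Y \in nbar_pred I.
Proof. by move=> XI YI; rewrite (nbar_br0 XI YI); case: (nbar_closed I) => [[]]. Qed.

(* [nbar] is x_alpha (x) C[t, t^-1], and [nbar_le r] is the span of the
   x_alpha (x) t^m with m <= -r: [nbar_le 1] is nbar_- and [nbar_le 2] is
   nbar_{<= -2}. *)
Definition ge0 : lieSubalg affine := LieSubalg ge0_closed ge0_br.
Definition nbar_on I : lieSubalg affine := LieSubalg (nbar_closed I) (@nbar_br I).
Definition nbar : lieSubalg affine := nbar_on predT.
Definition nbar_le (r : nat) : lieSubalg affine :=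
  nbar_on (fun m : int => m <= - r%:Z).

Fact xa_le_in (r n : nat) :
  nbar_le r (tmono (xa K) (- (r + n)%N%:Z)).
Proof.
apply/asboolP; split=> // m; rewrite tmonoE.
have [->|_] := eqVneq m _; last by exists 0; rewrite ?scale0r.
exists 1; first by rewrite scale1r.
by rewrite lerN2 lez_nat leq_addr.
Qed.

(* [xneg r n] is x_alpha(-(r + n)); for n in nat these are exactly the basis
   vectors of [nbar_le r]. *)
Definition xneg (r n : nat) : subLie (nbar_le r) := SubLie (xa_le_in r n).

End AffineSubalgebras.

Section Enveloping.
Variables (K : fieldType) (L : lieAlgType K).

(* The universal enveloping algebra as the unital associative K-algebra
   presented by the generators x in L, K-linear in x, and the relations
   x y - y x = [x, y]: terms modulo the congruence [urel]. *)
Inductive uterm : Type :=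
  | UGen of L | UConst of K | UAdd of uterm & uterm | UMul of uterm & uterm.

Inductive urel : uterm -> uterm -> Prop :=
  | urel_refl s : urel s s
  | urel_sym s t : urel s t -> urel t s
  | urel_trans s t u : urel s t -> urel t u -> urel s u
  | urel_add s s' t t' : urel s s' -> urel t t' -> urel (UAdd s t) (UAdd s' t')
  | urel_mul s s' t t' : urel s s' -> urel t t' -> urel (UMul s t) (UMul s' t')
  | urel_addA s t u : urel (UAdd s (UAdd t u)) (UAdd (UAdd s t) u)
  | urel_addC s t : urel (UAdd s t) (UAdd t s)
  | urel_add0 s : urel (UAdd (UConst 0) s) s
  | urel_addN s : urel (UAdd (UMul (UConst (-1)) s) s) (UConst 0)
  | urel_mulA s t u : urel (UMul s (UMul t u)) (UMul (UMul s t) u)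
  | urel_mul1 s : urel (UMul (UConst 1) s) s
  | urel_mulDl s t u : urel (UMul (UAdd s t) u) (UAdd (UMul s u) (UMul t u))
  | urel_mulDr s t u : urel (UMul s (UAdd t u)) (UAdd (UMul s t) (UMul s u))
  | urel_constD a b : urel (UConst (a + b)) (UAdd (UConst a) (UConst b))
  | urel_constM a b : urel (UConst (a * b)) (UMul (UConst a) (UConst b))
  | urel_constC a s : urel (UMul (UConst a) s) (UMul s (UConst a))
  | urel_gen_linear a x y :
      urel (UGen (a *: x + y)) (UAdd (UMul (UConst a) (UGen x)) (UGen y))
  | urel_gen_br x y :
      urel (UAdd (UMul (UGen y) (UGen x)) (UGen (lie_br x y)))
           (UMul (UGen x) (UGen y)).

HB.instance Definition _ := gen_eqMixin uterm.
HB.instance Definition _ := gen_choiceMixin uterm.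

Definition urelb (s t : uterm) : bool := `[< urel s t >].

Fact urelb_refl : reflexive urelb.
Proof. by move=> s; apply/asboolP; exact: urel_refl. Qed.
Fact urelb_sym : symmetric urelb.
Proof. by move=> s t; apply/idP/idP => /asboolP/urel_sym/asboolP. Qed.
Fact urelb_trans : transitive urelb.
Proof.
by move=> t s u /asboolP st /asboolP tu; apply/asboolP; exact: urel_trans tu.
Qed.

Canonical urel_equiv := EquivRel urelb urelb_refl urelb_sym urelb_trans.

Definition Uenv := {eq_quot urelb}.
HB.instance Definition _ := Choice.on Uenv.

Definition upi (s : uterm) : Uenv := \pi_Uenv%qT s.

Lemma upiP s t : upi s = upi t <-> urel s t.
Proof.
by split=> [/eqquotP/asboolP//|st]; apply/eqquotP/asboolP.
Qed.

Definition urepr (u : Uenv) : uterm := repr u.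

Lemma ureprK u : upi (urepr u) = u. Proof. exact: reprK. Qed.

Lemma urepr_pi s : urel (urepr (upi s)) s.
Proof. by apply/upiP; rewrite ureprK. Qed.

Definition uconst (a : K) : Uenv := upi (UConst a).
Definition ugen (x : L) : Uenv := upi (UGen x).
Definition uadd (u v : Uenv) : Uenv := upi (UAdd (urepr u) (urepr v)).
Definition umul (u v : Uenv) : Uenv := upi (UMul (urepr u) (urepr v)).

Lemma uaddE s t : uadd (upi s) (upi t) = upi (UAdd s t).
Proof. by apply/upiP/urel_add; exact: urepr_pi. Qed.

Lemma umulE s t : umul (upi s) (upi t) = upi (UMul s t).
Proof. by apply/upiP/urel_mul; exact: urepr_pi. Qed.

Lemma upi_surj u : exists s, u = upi s.
Proof. by exists (urepr u); rewrite ureprK. Qed.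

Local Ltac uenv :=
  repeat (let u := fresh "u" in move=> u; case: (upi_surj u) => ? ->);
  rewrite /uconst ?(uaddE, umulE).

Fact uaddA : associative uadd.
Proof. by uenv; apply/upiP/urel_addA. Qed.
Fact uaddC : commutative uadd.
Proof. by uenv; apply/upiP/urel_addC. Qed.
Fact uadd0 : left_id (uconst 0) uadd.
Proof. by uenv; apply/upiP/urel_add0. Qed.
Fact uaddN : left_inverse (uconst 0) (umul (uconst (-1))) uadd.
Proof. by uenv; apply/upiP/urel_addN. Qed.

HB.instance Definition _ := GRing.isZmodule.Build Uenv uaddA uaddC uadd0 uaddN.

Fact umulA : associative umul.
Proof. by uenv; apply/upiP/urel_mulA. Qed.
Fact umul1 : left_id (uconst 1) umul.
Proof. by uenv; apply/upiP/urel_mul1. Qed.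
Fact umulr1 : right_id (uconst 1) umul.
Proof.
by uenv; apply/upiP/(urel_trans (urel_sym (urel_constC _ _)))/urel_mul1.
Qed.
Fact umulDl : left_distributive umul uadd.
Proof. by uenv; apply/upiP/urel_mulDl. Qed.
Fact umulDr : right_distributive umul uadd.
Proof. by uenv; apply/upiP/urel_mulDr. Qed.

(* the augmentation, used only to see that 1 != 0 *)
Fixpoint uaug (s : uterm) : K :=
  match s with
  | UGen _ => 0
  | UConst a => a
  | UAdd s t => uaug s + uaug t
  | UMul s t => uaug s * uaug t
  end.

Lemma uaug_rel s t : urel s t -> uaug s = uaug t.
Proof.
elim=> {s t} //=; try by move=> *; ring.
- by move=> s t u _ -> _ ->.
- by move=> s s' t t' _ -> _ ->.
- by move=> s s' t t' _ -> _ ->.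
Qed.

Fact uone_neq0 : uconst 1 != uconst 0.
Proof.
by apply/eqP => /upiP/uaug_rel /= /eqP; apply/negP/oner_neq0.
Qed.

HB.instance Definition _ := GRing.Zmodule_isNzRing.Build Uenv
  umulA umul1 umulr1 umulDl umulDr uone_neq0.

Definition uscale (a : K) (u : Uenv) : Uenv := umul (uconst a) u.

Fact uscaleA a b u : uscale a (uscale b u) = uscale (a * b) u.
Proof.
rewrite /uscale umulA; congr (umul _ _).
by rewrite /uconst umulE; apply/upiP/urel_sym/urel_constM.
Qed.

Fact uscaleDl u : {morph uscale^~ u : a b / a + b}.
Proof.
move=> a b; apply: etrans (umulDl _ _ _); congr (umul _ _).
by rewrite /uconst uaddE; apply/upiP/urel_constD.
Qed.

HB.instance Definition _ := GRing.Zmodule_isLmodule.Build K Uenv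
  uscaleA umul1 (fun a => umulDr (uconst a)) uscaleDl.

Fact uscaleAl a (u v : Uenv) : a *: (u * v) = (a *: u) * v.
Proof. exact: umulA. Qed.

HB.instance Definition _ := GRing.Lmodule_isLalgebra.Build K Uenv uscaleAl.

Fact uscaleAr a (u v : Uenv) : a *: (u * v) = u * (a *: v).
Proof.
have uaC w : umul (uconst a) w = umul w (uconst a).
  by case: (upi_surj w) => s ->; rewrite /uconst !umulE; apply/upiP/urel_constC.
change (umul (uconst a) (umul u v) = umul u (umul (uconst a) v)).
by rewrite !umulA uaC.
Qed.

HB.instance Definition _ := GRing.Lalgebra_isAlgebra.Build K Uenv uscaleAr.

Lemma upiD s t : upi (UAdd s t) = upi s + upi t.
Proof. by rewrite -uaddE. Qed.

Lemma upiM s t : upi (UMul s t) = upi s * upi t.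
Proof. by rewrite -umulE. Qed.

Lemma upiC a : upi (UConst a) = a%:A.
Proof. by rewrite -[LHS]mulr1. Qed.

Lemma ugen_linear a x y : ugen (a *: x + y) = a *: ugen x + ugen y.
Proof.
rewrite /ugen (iffRL (upiP _ _) (urel_gen_linear a x y)) upiD upiM.
by rewrite upiC -scalerAl mul1r.
Qed.

Lemma ugen_br x y : ugen (lie_br x y) = ugen x * ugen y - ugen y * ugen x.
Proof.
apply/eqP; rewrite eq_sym subr_eq addrC; apply/eqP.
by rewrite /ugen -!upiM -upiD; apply/upiP/urel_sym/urel_gen_br.
Qed.

Lemma Uenv_ind (P : Uenv -> Prop) :
  (forall x, P (ugen x)) -> (forall a, P a%:A) ->
  (forall u v, P u -> P v -> P (u + v)) ->
  (forall u v, P u -> P v -> P (u * v)) -> forall u, P u.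
Proof.
move=> Pg Pc Pa Pm u; case: (upi_surj u) => s ->.
elim: s => [x|a|s Ps t Pt|s Ps t Pt].
- exact: Pg.
- by rewrite upiC; exact: Pc.
- by rewrite upiD; exact: Pa.
- by rewrite upiM; exact: Pm.
Qed.

End Enveloping.

Section EnvelopingLift.
Variables (K : fieldType) (L : lieAlgType K) (A : algType K) (f : L -> A).

Record lie_to_alg : Prop := LieToAlg {
  lta_linear : forall a x y, f (a *: x + y) = a *: f x + f y;
  lta_br : forall x y, f (lie_br x y) = f x * f y - f y * f x
}.

Fixpoint ueval (s : uterm L) : A :=
  match s with
  | UGen x => f x
  | UConst a => a%:A
  | UAdd s t => ueval s + ueval t
  | UMul s t => ueval s * ueval t
  end.

Definition ulift (u : Uenv L) : A := ueval (urepr u).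

Hypothesis fP : lie_to_alg.

Lemma ueval_rel s t : urel s t -> ueval s = ueval t.
Proof.
case: fP => f_lin f_br; elim => //= {s t}.
- by move=> s t u _ -> _ ->.
- by move=> s s' t t' _ -> _ ->.
- by move=> s s' t t' _ -> _ ->.
- by move=> *; rewrite addrA.
- by move=> *; rewrite addrC.
- by move=> *; rewrite scale0r add0r.
- by move=> *; rewrite scaleN1r mulN1r addNr scale0r.
- by move=> *; rewrite mulrA.
- by move=> *; rewrite scale1r mul1r.
- by move=> *; rewrite mulrDl.
- by move=> *; rewrite mulrDr.
- by move=> *; rewrite scalerDl.
- by move=> a b; rewrite -scalerAl mul1r scalerA.
- by move=> a s; rewrite -scalerAl -scalerAr mul1r mulr1.
- by move=> a x y; rewrite f_lin -scalerAl mul1r.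
- by move=> x y; rewrite f_br addrC subrK.
Qed.

Lemma ulift_pi s : ulift (upi s) = ueval s.
Proof. exact/ueval_rel/urepr_pi. Qed.

Lemma ulift_gen x : ulift (ugen x) = f x.
Proof. exact: ulift_pi. Qed.

Lemma uliftD u v : ulift (u + v) = ulift u + ulift v.
Proof.
by case: (upi_surj u) (upi_surj v) => s -> [t ->]; rewrite -upiD !ulift_pi.
Qed.

Lemma uliftM u v : ulift (u * v) = ulift u * ulift v.
Proof.
by case: (upi_surj u) (upi_surj v) => s -> [t ->]; rewrite -upiM !ulift_pi.
Qed.

Lemma uliftA a : ulift a%:A = a%:A.
Proof. by rewrite -upiC ulift_pi. Qed.

End EnvelopingLift.

Section Inclusion.
Variables (K : fieldType) (L : lieAlgType K) (S : lieSubalg L).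

(* the algebra map U(S) -> U(L) induced by the inclusion of S in L *)
Definition uincl : Uenv (subLie S) -> Uenv L :=
  ulift (fun x : subLie S => ugen (subLie_val x)).

Lemma incl_lie_to_alg : lie_to_alg (fun x : subLie S => ugen (subLie_val x)).
Proof.
by split=> [a x y|x y]; [rewrite -ugen_linear | rewrite -ugen_br].
Qed.

End Inclusion.

Section Representations.
Variables (K : fieldType) (L : lieAlgType K) (V : lmodType K).

Record lieRep := LieRep {
  rep_act :> L -> V -> V;
  rep_linearl : forall a x y v,
    rep_act (a *: x + y) v = a *: rep_act x v + rep_act y v;
  rep_linearr : forall x a v w,
    rep_act x (a *: v + w) = a *: rep_act x v + rep_act x w;
  rep_br : forall x y v,
    rep_act (lie_br x y) v = rep_act x (rep_act y v) - rep_act y (rep_act x v)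
}.

Variable rho : lieRep.

Fixpoint tact (s : uterm L) (v : V) : V :=
  match s with
  | UGen x => rho x v
  | UConst a => a *: v
  | UAdd s t => tact s v + tact t v
  | UMul s t => tact s (tact t v)
  end.

Definition uact (u : Uenv L) (v : V) : V := tact (urepr u) v.

Lemma tact_linear s a v w : tact s (a *: v + w) = a *: tact s v + tact s w.
Proof.
elim: s v w => [x|b|s IHs t IHt|s IHs t IHt] v w /=.
- exact: rep_linearr.
- by rewrite scalerDr !scalerA mulrC.
- by rewrite IHs IHt scalerDr addrACA.
- by rewrite IHt IHs.
Qed.

Lemma tactD s v w : tact s (v + w) = tact s v + tact s w.
Proof. by rewrite -[v]scale1r tact_linear !scale1r. Qed.

Lemma tactZ s a v : tact s (a *: v) = a *: tact s v.
Proof.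
have t0 : tact s 0 = 0.
  by have := tact_linear s (-1) 0 0; rewrite scaler0 addr0 scaleN1r addNr.
by rewrite -[a *: v]addr0 tact_linear t0 addr0.
Qed.

Lemma tact_rel s t : urel s t -> forall v, tact s v = tact t v.
Proof.
elim=> {s t} //=.
- by move=> s t u _ IH _ IH' v; rewrite IH.
- by move=> s s' t t' _ IH _ IH' v; rewrite IH IH'.
- by move=> s s' t t' _ IH _ IH' v; rewrite IH IH'.
- by move=> *; rewrite addrA.
- by move=> *; rewrite addrC.
- by move=> *; rewrite scale0r add0r.
- by move=> *; rewrite scaleN1r addNr scale0r.
- by move=> *; rewrite scale1r.
- by move=> *; rewrite tactD.
- by move=> *; rewrite scalerDl.
- by move=> *; rewrite scalerA.
- by move=> *; rewrite tactZ.
- by move=> *; rewrite rep_linearl.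
- by move=> *; rewrite rep_br addrC subrK.
Qed.

Lemma uact_pi s v : uact (upi s) v = tact s v.
Proof. exact/tact_rel/urepr_pi. Qed.

Lemma uact_gen x v : uact (ugen x) v = rho x v.
Proof. exact: uact_pi. Qed.

Lemma uactD u u' v : uact (u + u') v = uact u v + uact u' v.
Proof.
by case: (upi_surj u) (upi_surj u') => s -> [t ->]; rewrite -upiD !uact_pi.
Qed.

Lemma uactM u u' v : uact (u * u') v = uact u (uact u' v).
Proof.
by case: (upi_surj u) (upi_surj u') => s -> [t ->]; rewrite -upiM !uact_pi.
Qed.

Lemma uactA a v : uact a%:A v = a *: v.
Proof. by rewrite -upiC uact_pi. Qed.

Lemma uact_linear u a v w : uact u (a *: v + w) = a *: uact u v + uact u w.
Proof. exact: tact_linear. Qed.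

End Representations.

Section Induction.
Variables (K : fieldType) (L : lieAlgType K) (S : lieSubalg L).
Variables (V : lmodType K) (rho : lieRep (subLie S) V).

(* [Ind] is the tensor product U(L) (x)_{U(S)} V, presented by the pure tensors
   u (x) v: terms modulo the congruence [trel].  K-homogeneity in v follows from
   [trel_balanced] applied to scalars of U(S). *)
Inductive tterm : Type :=
  | TPure of Uenv L & V | TZero | TAdd of tterm & tterm | TScale of K & tterm.

Inductive trel : tterm -> tterm -> Prop :=
  | trel_refl s : trel s s
  | trel_sym s t : trel s t -> trel t s
  | trel_trans s t r : trel s t -> trel t r -> trel s r
  | trel_add s s' t t' : trel s s' -> trel t t' -> trel (TAdd s t) (TAdd s' t')
  | trel_scale a s s' : trel s s' -> trel (TScale a s) (TScale a s')
  | trel_addA s t r : trel (TAdd s (TAdd t r)) (TAdd (TAdd s t) r)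
  | trel_addC s t : trel (TAdd s t) (TAdd t s)
  | trel_add0 s : trel (TAdd TZero s) s
  | trel_addN s : trel (TAdd (TScale (-1) s) s) TZero
  | trel_scaleA a b s : trel (TScale a (TScale b s)) (TScale (a * b) s)
  | trel_scale1 s : trel (TScale 1 s) s
  | trel_scaleDr a s t : trel (TScale a (TAdd s t)) (TAdd (TScale a s) (TScale a t))
  | trel_scaleDl a b s : trel (TScale (a + b) s) (TAdd (TScale a s) (TScale b s))
  | trel_pureDl u u' v : trel (TPure (u + u') v) (TAdd (TPure u v) (TPure u' v))
  | trel_pureDr u v v' : trel (TPure u (v + v')) (TAdd (TPure u v) (TPure u v'))
  | trel_pureZ a u v : trel (TPure (a *: u) v) (TScale a (TPure u v))
  | trel_balanced u (b : Uenv (subLie S)) v :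
      trel (TPure (u * uincl b) v) (TPure u (uact rho b v)).

HB.instance Definition _ := gen_eqMixin tterm.
HB.instance Definition _ := gen_choiceMixin tterm.

Definition trelb (s t : tterm) : bool := `[< trel s t >].

Fact trelb_refl : reflexive trelb.
Proof. by move=> s; apply/asboolP; exact: trel_refl. Qed.
Fact trelb_sym : symmetric trelb.
Proof. by move=> s t; apply/idP/idP => /asboolP/trel_sym/asboolP. Qed.
Fact trelb_trans : transitive trelb.
Proof.
by move=> t s u /asboolP st /asboolP tu; apply/asboolP; exact: trel_trans tu.
Qed.

Canonical trel_equiv := EquivRel trelb trelb_refl trelb_sym trelb_trans.

Definition Ind := {eq_quot trelb}.
HB.instance Definition _ := Choice.on Ind.

Definition tpi (s : tterm) : Ind := \pi_Ind%qT s.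

Lemma tpiP s t : tpi s = tpi t <-> trel s t.
Proof. by split=> [/eqquotP/asboolP//|st]; apply/eqquotP/asboolP. Qed.

Definition trepr (w : Ind) : tterm := repr w.

Lemma treprK w : tpi (trepr w) = w. Proof. exact: reprK. Qed.

Lemma trepr_pi s : trel (trepr (tpi s)) s.
Proof. by apply/tpiP; rewrite treprK. Qed.

Lemma tpi_surj w : exists s, w = tpi s.
Proof. by exists (trepr w); rewrite treprK. Qed.

Definition tadd (w w' : Ind) : Ind := tpi (TAdd (trepr w) (trepr w')).
Definition tscale (a : K) (w : Ind) : Ind := tpi (TScale a (trepr w)).

Lemma taddE s t : tadd (tpi s) (tpi t) = tpi (TAdd s t).
Proof. by apply/tpiP/trel_add; exact: trepr_pi. Qed.

Lemma tscaleE a s : tscale a (tpi s) = tpi (TScale a s).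
Proof. by apply/tpiP/trel_scale; exact: trepr_pi. Qed.

Local Ltac tens :=
  repeat (let u := fresh "u" in move=> u; case: (tpi_surj u) => ? ->);
  rewrite ?(taddE, tscaleE).

Fact taddA : associative tadd.
Proof. by tens; apply/tpiP/trel_addA. Qed.
Fact taddC : commutative tadd.
Proof. by tens; apply/tpiP/trel_addC. Qed.
Fact tadd0 : left_id (tpi TZero) tadd.
Proof. by tens; apply/tpiP/trel_add0. Qed.
Fact taddN : left_inverse (tpi TZero) (tscale (-1)) tadd.
Proof. by tens; apply/tpiP/trel_addN. Qed.

HB.instance Definition _ := GRing.isZmodule.Build Ind taddA taddC tadd0 taddN.

Fact tscaleA a b w : tscale a (tscale b w) = tscale (a * b) w.
Proof. by move: w; tens; apply/tpiP/trel_scaleA. Qed.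
Fact tscale1 : left_id 1 tscale.
Proof. by tens; apply/tpiP/trel_scale1. Qed.
Fact tscaleDr : right_distributive tscale tadd.
Proof. by move=> a; tens; apply/tpiP/trel_scaleDr. Qed.
Fact tscaleDl w : {morph tscale^~ w : a b / a + b >-> tadd a b}.
Proof. by move: w; tens => a b; rewrite !tscaleE taddE; apply/tpiP/trel_scaleDl. Qed.

HB.instance Definition _ := GRing.Zmodule_isLmodule.Build K Ind
  tscaleA tscale1 tscaleDr tscaleDl.

Definition tpure (u : Uenv L) (v : V) : Ind := tpi (TPure u v).

Lemma tpiD s t : tpi (TAdd s t) = tpi s + tpi t.
Proof. by rewrite -taddE. Qed.

Lemma tpiZ a s : tpi (TScale a s) = a *: tpi s.
Proof. by rewrite -tscaleE. Qed.

Lemma tpureDl u u' v : tpure (u + u') v = tpure u v + tpure u' v.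
Proof. by rewrite -tpiD; apply/tpiP/trel_pureDl. Qed.

Lemma tpureDr u v v' : tpure u (v + v') = tpure u v + tpure u v'.
Proof. by rewrite -tpiD; apply/tpiP/trel_pureDr. Qed.

Lemma tpureZl a u v : tpure (a *: u) v = a *: tpure u v.
Proof. by rewrite -tpiZ; apply/tpiP/trel_pureZ. Qed.

Lemma tpure_balanced u b v : tpure (u * uincl b) v = tpure u (uact rho b v).
Proof. exact/tpiP/trel_balanced. Qed.

Lemma Ind_ind (P : Ind -> Prop) : (forall u v, P (tpure u v)) -> P 0 ->
  (forall w w', P w -> P w' -> P (w + w')) -> (forall a w, P w -> P (a *: w)) ->
  forall w, P w.
Proof.
move=> Pp P0 PD PZ w; case: (tpi_surj w) => s ->.
elim: s => [u v||s Ps t Pt|a s Ps]; [exact: Pp|exact: P0| |].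
- by rewrite tpiD; exact: PD.
- by rewrite tpiZ; exact: PZ.
Qed.

Fixpoint tlmul (a : Uenv L) (s : tterm) : tterm :=
  match s with
  | TPure u v => TPure (a * u) v
  | TZero => TZero
  | TAdd s t => TAdd (tlmul a s) (tlmul a t)
  | TScale c s => TScale c (tlmul a s)
  end.

Lemma tlmul_rel a s t : trel s t -> trel (tlmul a s) (tlmul a t).
Proof.
elim=> {s t} /=.
- by move=> s; exact: trel_refl.
- by move=> s t _; exact: trel_sym.
- by move=> s t r _ st _; exact: trel_trans.
- by move=> s s' t t' _ ? _ ?; exact: trel_add.
- by move=> c s s' _ ?; exact: trel_scale.
- by move=> *; exact: trel_addA.
- by move=> *; exact: trel_addC.
- by move=> *; exact: trel_add0.
- by move=> *; exact: trel_addN.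
- by move=> *; exact: trel_scaleA.
- by move=> *; exact: trel_scale1.
- by move=> *; exact: trel_scaleDr.
- by move=> *; exact: trel_scaleDl.
- by move=> *; rewrite mulrDr; exact: trel_pureDl.
- by move=> *; exact: trel_pureDr.
- by move=> *; rewrite -scalerAr; exact: trel_pureZ.
- by move=> *; rewrite mulrA; exact: trel_balanced.
Qed.

Definition ilmul (a : Uenv L) (w : Ind) : Ind := tpi (tlmul a (trepr w)).

Lemma ilmul_pi a s : ilmul a (tpi s) = tpi (tlmul a s).
Proof. by apply/tpiP/tlmul_rel/trepr_pi. Qed.

Lemma ilmul_pure a u v : ilmul a (tpure u v) = tpure (a * u) v.
Proof. exact: ilmul_pi. Qed.

Lemma ilmulD a w w' : ilmul a (w + w') = ilmul a w + ilmul a w'.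
Proof.
case: (tpi_surj w) (tpi_surj w') => s -> [t ->].
by rewrite -tpiD !ilmul_pi -tpiD.
Qed.

Lemma ilmulZ a c w : ilmul a (c *: w) = c *: ilmul a w.
Proof. by case: (tpi_surj w) => s ->; rewrite -tpiZ !ilmul_pi -tpiZ. Qed.

Lemma ilmul0 a : ilmul a 0 = 0.
Proof. exact: ilmul_pi. Qed.

Fact ind_linearl c x y w :
  ilmul (ugen (c *: x + y)) w = c *: ilmul (ugen x) w + ilmul (ugen y) w.
Proof.
elim/Ind_ind: w => [u v||w w' IH IH'|b w IH].
- by rewrite !ilmul_pure ugen_linear mulrDl -scalerAl tpureDl tpureZl.
- by rewrite !ilmul0 scaler0 addr0.
- by rewrite !ilmulD IH IH' scalerDr addrACA.
- by rewrite !ilmulZ IH scalerDr !scalerA mulrC.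
Qed.

Fact ind_linearr x c w w' :
  ilmul (ugen x) (c *: w + w') = c *: ilmul (ugen x) w + ilmul (ugen x) w'.
Proof. by rewrite ilmulD ilmulZ. Qed.

Fact ind_br x y w : ilmul (ugen (lie_br x y)) w =
  ilmul (ugen x) (ilmul (ugen y) w) - ilmul (ugen y) (ilmul (ugen x) w).
Proof.
elim/Ind_ind: w => [u v||w w' IH IH'|b w IH].
- rewrite !ilmul_pure ugen_br mulrBl tpureDl -!mulrA -scaleN1r tpureZl.
  by rewrite scaleN1r.
- by rewrite !ilmul0 subr0.
- by rewrite !ilmulD IH IH' opprD addrACA.
- by rewrite !ilmulZ IH scalerBr.
Qed.

(* L acts by left multiplication on the factor U(L). *)
Definition indRep : lieRep L Ind := LieRep ind_linearl ind_linearr ind_br.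

Lemma uact_indRep a u v : uact indRep a (tpure u v) = tpure (a * u) v.
Proof.
elim/Uenv_ind: a u v => [x|c|a b IHa IHb|a b IHa IHb] u v.
- by rewrite uact_gen /= ilmul_pure.
- by rewrite uactA -scalerAl mul1r tpureZl.
- by rewrite uactD IHa IHb mulrDl tpureDl.
- by rewrite uactM IHb IHa mulrA.
Qed.

End Induction.

Lemma addrKACA (V : zmodType) (p q s t w : V) :
  p - q = p + s + (t + w) - (q + t + (s + w)).
Proof. by rewrite -(addrA p) (addrCA s) -(addrA q) opprD addrACA subrr addr0. Qed.

Section GeneralizedVerma.
Variables (K : fieldType) (k : nat) (U : lmodType K) (rho : lieRep (sl2 K) U).
Local Notation affine := (affine K).

(* g (x) C[t] + C k acts on U through evaluation at t = 0, k acting as the scalar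
   k. *)
Definition eval_act (X : subLie (ge0 K)) (u : U) : U :=
  rho ((subLie_val X).1 0) u + (k%:R * (subLie_val X).2) *: u.

Fact eval_linearl a X Y u :
  eval_act (a *: X + Y) u = a *: eval_act X u + eval_act Y u.
Proof.
rewrite /eval_act subLie_valP affineD1 affineZ1 rep_linearl.
rewrite -[(_ + subLie_val Y).2]/(a * (subLie_val X).2 + (subLie_val Y).2).
move: (subLie_val X).2 (subLie_val Y).2 (rho _ u) (rho _ u) => c d v w.
rewrite scalerDr scalerA addrACA -scalerDl; congr (_ + _ *: _).
by rewrite mulrDr; congr (_ + _); exact: mulrCA.
Qed.

Fact eval_linearr X a u v :
  eval_act X (a *: u + v) = a *: eval_act X u + eval_act X v.
Proof.
by rewrite /eval_act rep_linearr !scalerDr !scalerA [_ * a]mulrC addrACA.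
Qed.

Fact eval_br X Y u :
  eval_act (lie_br X Y) u =
  eval_act X (eval_act Y u) - eval_act Y (eval_act X u).
Proof.
have [br0 br2] := ge0_brE (valP X) (valP Y).
have rhoD x v w : rho x (v + w) = rho x v + rho x w.
  by rewrite -[v in LHS]scale1r rep_linearr scale1r.
have rhoZ x c v : rho x (c *: v) = c *: rho x v.
  have rho0 : rho x 0 = 0.
    by have := rep_linearr rho x (-1) 0 0; rewrite scaler0 addr0 scaleN1r addNr.
  by rewrite -[c *: v in LHS]addr0 rep_linearr rho0 addr0.
rewrite [LHS]/eval_act -[subLie_val _]/(lie_br (\val X) (\val Y)) br0 br2.
rewrite mulr0 scale0r.
rewrite addr0 rep_br /eval_act !rhoD !rhoZ !scalerDr !scalerA.
rewrite [_ * (k%:R * (subLie_val Y).2)]mulrC; exact: addrKACA.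
Qed.

Definition evalRep : lieRep (subLie (ge0 K)) U :=
  LieRep eval_linearl eval_linearr eval_br.

Definition gverma := Ind evalRep.
Definition gvermaRep : lieRep affine gverma := indRep evalRep.

End GeneralizedVerma.

Section Modules.
Variables (K : fieldType).
Local Notation affine := (affine K).

Definition irreducible_rep (L : lieAlgType K) (V : lmodType K)
    (rho : lieRep L V) : Prop :=
  (exists v : V, v != 0) /\
  forall W : set V, W 0 ->
    (forall a v w, W v -> W w -> W (a *: v + w)) ->
    (forall x v, W v -> W (rho x v)) ->
    W = [set 0] \/ W = setT.

Definition locally_nilpotent (L : lieAlgType K) (V : lmodType K)
    (rho : lieRep L V) (x : L) : Prop :=
  forall v, exists n, iter n (rho x) v = 0.

Definition weight_vector (V : lmodType K) (rho : lieRep affine V) (v : V) : Prop :=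
  exists c d : K, rho (tmono (hh K) 0) v = c *: v /\ rho (kk K) v = d *: v.

(* h(0) and k act diagonalizably, and the Chevalley generators
   e_1 = x_alpha(0), f_1 = x_{-alpha}(0), e_0 = x_{-alpha}(1),
   f_0 = x_alpha(-1) act locally nilpotently. *)
Definition integrable_rep (V : lmodType K) (rho : lieRep affine V) : Prop :=
  [/\ forall v, exists2 s : seq V,
        forall w, w \in s -> weight_vector rho w & v = \sum_(w <- s) w,
      locally_nilpotent rho (tmono (xa K) 0),
      locally_nilpotent rho (tmono (xma K) 0),
      locally_nilpotent rho (tmono (xma K) 1) &
      locally_nilpotent rho (tmono (xa K) (-1))].

(* the weight is Lambda_{k,i} = (k - i) Lambda_0 + i Lambda_1 *)
Definition highest_weight_vector (k i : nat) (V : lmodType K)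
    (rho : lieRep affine V) (v : V) : Prop :=
  [/\ v != 0,
      rho (tmono (xa K) 0) v = 0,
      forall (a : sl2 K) (m : int), 0 < m -> rho (tmono a m) v = 0,
      rho (tmono (hh K) 0) v = i%:R *: v &
      rho (kk K) v = k%:R *: v].

(* (V, rho) is L(Lambda_{k,i}), with highest weight vector v. *)
Definition standard_module (k i : nat) (V : lmodType K)
    (rho : lieRep affine V) (v : V) : Prop :=
  [/\ irreducible_rep rho, integrable_rep rho & highest_weight_vector k i rho v].

(* (U, rho) is the (i+1)-dimensional irreducible sl2-module U_i, with highest
   weight vector u. *)
Definition irreducible_sl2 (i : nat) (U : vectType K)
    (rho : lieRep (sl2 K) U) (u : U) : Prop :=
  [/\ \dim {:U} = i.+1, irreducible_rep rho, u != 0,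
      rho (xa K) u = 0 & rho (hh K) u = i%:R *: u].

Definition gverma_vector (k : nat) (U : lmodType K) (rho : lieRep (sl2 K) U)
    (u : U) : gverma k rho := tpure (evalRep k rho) 1 u.

(* I . v, for a subset I of U(S) *)
Definition act_set (S : lieSubalg affine) (V : lmodType K)
    (rho : lieRep affine V) (I : set (Uenv (subLie S))) (v : V) : set V :=
  [set uact rho (uincl a) v | a in I].

(* U(nbar) . v *)
Definition principal_subspace (V : lmodType K) (rho : lieRep affine V) (v : V) :
  set V := act_set (S := nbar K) rho setT v.

(* U(nbar_{<= -2}) . v *)
Definition principal_subspace' (V : lmodType K) (rho : lieRep affine V) (v : V) :
  set V := act_set (S := nbar_le K 2) rho setT v.

(* the module map a . v |-> a . w; it is unique when v generates V *)
Definition canonical_projection (V W : lmodType K) (rhoV : lieRep affine V)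
    (rhoW : lieRep affine W) (v : V) (w : W) (Pi : {linear V -> W}) : Prop :=
  (forall x y, Pi (rhoV x y) = rhoW x (Pi y)) /\
  (forall a : Uenv affine, Pi (uact rhoV a v) = uact rhoW a w).

(* the kernel of the restriction of Pi to D *)
Definition lker_on (V W : lmodType K) (Pi : {linear V -> W}) (D : set V) : set V :=
  [set x | D x /\ Pi x = 0].

(* the left ideal generated by G *)
Definition left_ideal (A : algType K) (G : set A) : set A :=
  [set a | exists2 s : seq (A * A),
     forall p, p \in s -> G p.2 & a = \sum_(p <- s) p.1 * p.2].

(* With m_j = -(r + n_j), the tuples (m_1, ..., m_{k+1}) of integers <= -r with
   sum -t are the families (n_j) of naturals such that the r + n_j sum up to t;
   the bound n_j <= t is then automatic.  R^0_{k,t} is [Rrel 1 k t] and R^1_{k,t}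
   is [Rrel 2 k t]. *)
Definition Rrel (r k t : nat) : Uenv (subLie (nbar_le K r)) :=
  \sum_(n : {ffun 'I_k.+1 -> 'I_t.+1} | (\sum_j (r + n j) == t)%N)
    \prod_j ugen (xneg K r (n j)).

Definition I_ideal (k i : nat) : set (Uenv (subLie (nbar_le K 1))) :=
  left_ideal ([set Rrel 1 k t | t in [set t | (k.+1 <= t)%N]]
              `|` [set ugen (xneg K 1 0) ^+ (k - i + 1)]).

Definition I'_ideal (k : nat) : set (Uenv (subLie (nbar_le K 2))) :=
  left_ideal [set Rrel 2 k t | t in [set t | (2 * k.+1 <= t)%N]].

End Modules.

(* Main.v *)
Require Import Defs.
From HB Require Import structures.
From mathcomp Require Import all_boot all_order all_algebra.
From mathcomp Require Import boolp classical_sets functions cardinality fsbigop finmap.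
From mathcomp Require Import reals complex ring zify.

Set Implicit Arguments.
Unset Strict Implicit.
Unset Printing Implicit Defensive.

(** The inclusion of the ideal in the kernel is a computation in L(Lambda_{k,i});
    the difficulty is that nothing else in U(nbar_-) kills its highest weight
    vector.  The proof compares L(Lambda_{k,i}) with an explicit module, in which
    all the weights Lambda_{k,0}, ..., Lambda_{k,k} occur side by side, and
    determines the annihilators there by a simultaneous recursion.

    The explicit module is the Fock space of k pairs of charged fermions, on
    which the affine algebra acts at level k by quadratic expressions
    ([rho_comm], [fock_fam]).  The vacuum has weight Lambda_{k,0}, and applying i
    of the k fermions theta_c = psi_{+,c,0} to it gives a highest weight vector
    of weight Lambda_{k,i} ([hwv_top]).

    Highest weight vectors of the same weight, in two modules, are compared
    through words in the Chevalley generators: a word of degree 0 acts on both by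
    the same scalar ([tandem_degree0]).  Two facts turn this into an equality of
    annihilators.  The Fock space carries a positive Hermitian form for which
    x_{-alpha}(-m) is adjoint to x_alpha(m), so that its highest weight vectors
    have the smallest possible annihilators ([fock_transfer]).  An irreducible
    module has the largest possible ones, once one knows that it is graded, and
    the grading is provided by the Casimir operator ([tandem_split],
    [irreducible_transfer]).  It also reduces the question to homogeneous
    elements ([annih_components]).

    Let a kill the top vector of weight Lambda_{k,i} of the Fock space.  As
    theta_c commutes with all x_alpha(m), a kills that of weight Lambda_{k,i+1}
    too ([annih_succ]), so by descending induction on i it lies in the ideal of
    Lambda_{k,i+1}: it is b x_alpha(-1)^(k-i) modulo the ideal of Lambda_{k,i}.
    Now x_alpha(-1)^(k-i) v is an extremal vector, which is again a highest
    weight vector, of weight Lambda_{k,k-i}, once the action is twisted by the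
    spectral shift x_alpha(m) |-> x_alpha(m - 1) ([hwv_shift]).  Up to multiples
    of x_alpha(-1), which kill it, b is the shift of an element of lower degree
    in the annihilator for Lambda_{k,k-i}; by induction on the degree that
    element is in the ideal of Lambda_{k,k-i}, and the shift carries this ideal,
    times x_alpha(-1)^(k-i), into that of Lambda_{k,i} ([hideal_shift],
    [annih_ideal]).  Conversely x_alpha(-1)^(k+1) kills the vacuum, and the
    translation operator propagates this to all coefficients of
    x_alpha(z)^(k+1) ([Tmode_Rcomp], [annih_R]).

    For i = k the extremal vector is the highest weight vector itself, and the
    same shift, now an isomorphism of U(nbar_-) with U(nbar_{<= -2}), carries the
    ideal of Lambda_{k,0} to I'_{Lambda_{k,k}} ([hideal0_ideal']). *)

Import Order.TTheory GRing.Theory Num.Theory.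

Local Open Scope classical_set_scope.
Local Open Scope ring_scope.

(** * Families of operators satisfying the sl(2)^ relations *)

(** The action of the affine algebra at level [k] in terms of the modes of
    x_alpha, x_{-alpha} and h.  Working with the modes rather than with
    representations makes it immediate to twist by the spectral shift below. *)
Record family (K : fieldType) (k : nat) (V : lmodType K) := Family {
  fE : int -> {linear V -> V};
  fF : int -> {linear V -> V};
  fH : int -> {linear V -> V};
  fEE : forall m n v, fE m (fE n v) = fE n (fE m v);
  fFF : forall m n v, fF m (fF n v) = fF n (fF m v);
  fHE : forall m n v, fH m (fE n v) = fE n (fH m v) + 2%:R *: fE (m + n) v;
  fHF : forall m n v, fH m (fF n v) = fF n (fH m v) - 2%:R *: fF (m + n) v;
  fEF : forall m n v, fE m (fF n v) =
    fF n (fE m v) + fH (m + n) v + (m%:~R * k%:R * (m + n == 0)%:R) *: v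
}.

Definition hwv (K : fieldType) (k i : nat) (V : lmodType K) (f : family k V)
    (v : V) : Prop :=
  [/\ v != 0, fE f 0 v = 0, fF f 1 v = 0 & fH f 0 v = i%:R *: v].

Section SpectralShift.
Variables (K : fieldType) (k : nat) (V : lmodType K) (f : family k V).

Definition shiftH (m : int) (v : V) : V := fH f m v - (k%:R * (m == 0)%:R) *: v.

Fact shiftH_linear m : linear (shiftH m).
Proof.
move=> a v w; rewrite /shiftH linearP scalerDr scalerBr opprD addrACA.
by rewrite !scalerA mulrC.
Qed.

HB.instance Definition _ m :=
  GRing.isLinear.Build K V V *:%R (shiftH m) (shiftH_linear m).

Definition shift_fam : family k V.
Proof.
refine (@Family K k V (fun m => fE f (m - 1)) (fun m => fF f (m + 1))
  (fun m => shiftH m : {linear V -> V}) _ _ _ _ _).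
- by move=> *; rewrite fEE.
- by move=> *; rewrite fFF.
- move=> m n v; rewrite /= /shiftH fHE linearB [fE f _ (_ *: _)]linearZ /= -[m + n - 1]addrA.
  by rewrite [LHS]addrAC.
- move=> m n v; rewrite /= /shiftH fHF linearB [fF f _ (_ *: _)]linearZ /= -[m + n + 1]addrA.
  by rewrite [LHS]addrAC.
- move=> m n v; rewrite /= /shiftH fEF.
  have -> : m - 1 + (n + 1) = m + n by ring.
  rewrite -!addrA; congr (_ + (_ + _)).
  rewrite -scaleNr -scalerDl; congr (_ *: _).
  by rewrite rmorphB /= mulrBl mulrBl mul1r addrC.
Defined.

End SpectralShift.

(** * Two highest weight vectors of the same weight *)

Section Pair.
Variables (K : fieldType) (k i : nat) (V V' : lmodType K).
Variables (f : family k V) (f' : family k V') (v : V) (v' : V').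
Hypotheses (hv : hwv i f v) (hv' : hwv i f' v').

(** [tandem n w w']: w and w' are obtained from v and v' by one and the same
    combination of words in the Chevalley generators, of principal degree n,
    where x_{-alpha}(0) and x_alpha(-1) have degree 1.  Two modules are compared
    through this relation, without ever forming their direct sum. *)
Inductive tandem : int -> V -> V' -> Prop :=
  | tandem_hw : tandem 0 v v'
  | tandem_zero n : tandem n 0 0
  | tandem_lin n a w1 w1' w2 w2' : tandem n w1 w1' -> tandem n w2 w2' ->
      tandem n (a *: w1 + w2) (a *: w1' + w2')
  | tandem_F0 n w w' : tandem n w w' -> tandem (n + 1) (fF f 0 w) (fF f' 0 w')
  | tandem_E1 n w w' : tandem n w w' -> tandem (n + 1) (fE f (-1) w) (fE f' (-1) w')
  | tandem_E0 n w w' : tandem n w w' -> tandem (n - 1) (fE f 0 w) (fE f' 0 w')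
  | tandem_F1 n w w' : tandem n w w' -> tandem (n - 1) (fF f 1 w) (fF f' 1 w').

Lemma tandemD n w1 w1' w2 w2' :
  tandem n w1 w1' -> tandem n w2 w2' -> tandem n (w1 + w2) (w1' + w2').
Proof. by move=> /(tandem_lin 1)/[apply]; rewrite !scale1r. Qed.

Lemma tandemZ n a w w' : tandem n w w' -> tandem n (a *: w) (a *: w').
Proof. by move=> /(tandem_lin a)/(_ (tandem_zero n)); rewrite !addr0. Qed.

Lemma tandemB n w1 w1' w2 w2' :
  tandem n w1 w1' -> tandem n w2 w2' -> tandem n (w1 - w2) (w1' - w2').
Proof. by move=> h1 /(tandemZ (-1)) h2; rewrite -!scaleN1r; exact: tandemD. Qed.

Lemma tandem_sum n (I : Type) (r : seq I) (P : pred I) (F : I -> V) (F' : I -> V') :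
  (forall x, P x -> tandem n (F x) (F' x)) ->
  tandem n (\sum_(x <- r | P x) F x) (\sum_(x <- r | P x) F' x).
Proof.
move=> h; elim: r => [|x r IH]; first by rewrite !big_nil; exact: tandem_zero.
rewrite !big_cons; case: ifP => // Px; apply: tandemD => //; exact: h.
Qed.

Definition lword (W : lmodType K) (g : family k W) (w : W) (s : seq bool) : W :=
  foldr (fun b x => if b then fF g 0 x else fE g (-1) x) w s.

Inductive lspan (n : nat) : V -> V' -> Prop :=
  | lspan0 : lspan n 0 0
  | lspan_lin a w1 w1' w2 w2' : lspan n w1 w1' -> lspan n w2 w2' ->
      lspan n (a *: w1 + w2) (a *: w1' + w2')
  | lspan_word s : size s = n -> lspan n (lword f v s) (lword f' v' s).

Lemma lspanD n w1 w1' w2 w2' :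
  lspan n w1 w1' -> lspan n w2 w2' -> lspan n (w1 + w2) (w1' + w2').
Proof. by move=> /(lspan_lin 1)/[apply]; rewrite !scale1r. Qed.

Lemma lspanZ n a w w' : lspan n w w' -> lspan n (a *: w) (a *: w').
Proof. by move=> /(lspan_lin a)/(_ (lspan0 n)); rewrite !addr0. Qed.

Lemma lspan_lower (b : bool) n w w' : lspan n w w' ->
  lspan n.+1 (lword f w [:: b]) (lword f' w' [:: b]).
Proof.
elim=> [|a w1 w1' w2 w2' _ IH1 _ IH2|s sn] /=.
- by case: b; rewrite !linear0; exact: lspan0.
- by case: b IH1 IH2 => /= h1 h2; rewrite !linearP; exact: lspan_lin.
- by apply: (@lspan_word _ (b :: s)); rewrite /= sn.
Qed.

Definition lweight (s : seq bool) : K :=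
  i%:R + \sum_(b <- s) (if b then - 2%:R else 2%:R).

Lemma lword_weight (W : lmodType K) (g : family k W) w s : hwv i g w ->
  fH g 0 (lword g w s) = lweight s *: lword g w s.
Proof.
move=> [_ _ _ hw]; rewrite /lweight; elim: s => [|b s IH] /=.
  by rewrite big_nil addr0.
rewrite big_cons addrCA [X in X *: _]addrC scalerDl.
by case: b; rewrite ?(fHF, fHE) add0r IH linearZ ?scaleNr.
Qed.

(** A raising generator commutes past a lowering generator up to h(0) - which acts
    on words by scalars depending on the word only - and the level.  Hence it
    acts on the spans of words in both modules by the same formulas. *)
Lemma lspan_raise (b : bool) n w w' : lspan n w w' ->
  let r (W : lmodType K) (g : family k W) x := if b then fE g 0 x else fF g 1 x in
  if n is m.+1 then lspan m (r _ f w) (r _ f' w')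
  else r _ f w = 0 /\ r _ f' w' = 0.
Proof.
move=> + r; have rP (W : lmodType K) (g : family k W) a x y :
    r _ g (a *: x + y) = a *: r _ g x + r _ g y.
  by rewrite /r; case: (b); rewrite linearP.
have r0 (W : lmodType K) (g : family k W) : r _ g 0 = 0.
  by rewrite /r; case: (b); rewrite linear0.
elim=> [|a w1 w1' w2 w2' _ IH1 _ IH2|s].
- by case: n => [|n]; rewrite !r0 //; exact: lspan0.
- case: n IH1 IH2 => [|n]; last by rewrite !rP => *; exact: lspan_lin.
  by rewrite !rP => -[-> ->] [-> ->]; rewrite !scaler0 !addr0.
elim: s n => [|c s IH] n <- /=.
  by rewrite /r; case: (b); [case: hv hv' => _ -> _ _ []|case: hv hv' => _ _ -> _ []].
have rlow (W : lmodType K) (g : family k W) w0 : hwv i g w0 ->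
    r _ g (lword g w0 (c :: s)) =
    (if b == c then (if b then lweight s else k%:R - lweight s)
     else 0) *: lword g w0 s
    + lword g (r _ g (lword g w0 s)) [:: c].
  move=> hg; rewrite /r /= addrC; case: (b); case: (c) => /=.
  - by rewrite fEF addr0 eqxx !mul0r scale0r addr0 (lword_weight _ hg).
  - by rewrite fEE scale0r addr0.
  - by rewrite fFF scale0r addr0.
  - apply/eqP; rewrite eq_sym; have /eqP := fEF g (-1) 1 (lword g w0 s).
    rewrite addNr eqxx mulr1 (lword_weight _ hg) -addrA -scalerDl -subr_eq.
    move/eqP=> <-; rewrite -scaleNr -[X in X == _]addrC; apply/eqP.
    by rewrite [LHS]addrC; congr (_ + _ *: _); ring.
rewrite !rlow //; apply: lspanD; first by apply: lspanZ; exact: lspan_word.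
case: s IH {rlow} => [|d s] IH.
  have /= [-> ->] := IH 0 erefl.
  by case: (c); rewrite /= !linear0; exact: lspan0.
by apply: lspan_lower; exact: (IH _ erefl).
Qed.

Lemma tandem_lspan n w w' : tandem n w w' ->
  (w = 0 /\ w' = 0) \/ exists2 m : nat, n = m & lspan m w w'.
Proof.
elim=> {n w w'} [|n|n a w1 w1' w2 w2' _ IH1 _ IH2|||
  n w w' _ IH|n w w' _ IH].
- by right; exists 0%N => //; exact: (@lspan_word _ [::]).
- by left.
- case: IH1 => [[-> ->]|[m nm s1]]; first by rewrite !scaler0 !add0r.
  right; exists m => //; apply: lspan_lin => //.
  case: IH2 => [[-> ->]|[m' nm' s2]]; first exact: lspan0.
  by move: nm'; rewrite nm => -[->].
- move=> n w w' _ [[-> ->]|[m -> /(lspan_lower true) s]].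
    by left; rewrite !linear0.
  by right; exists m.+1 => //; rewrite -addn1 PoszD.
- move=> n w w' _ [[-> ->]|[m -> /(lspan_lower false) s]].
    by left; rewrite !linear0.
  by right; exists m.+1 => //; rewrite -addn1 PoszD.
- case: IH => [[-> ->]|[[|m] nm /(lspan_raise true)/= s]].
  + by left; rewrite !linear0.
  + by left.
  + by right; exists m => //; rewrite nm -addn1 PoszD addrK.
- case: IH => [[-> ->]|[[|m] nm /(lspan_raise false)/= s]].
  + by left; rewrite !linear0.
  + by left.
  + by right; exists m => //; rewrite nm -addn1 PoszD addrK.
Qed.

(** The Verma-type uniqueness on which every comparison rests: in degree 0 a
    word acts on a highest weight vector by a scalar which only depends on the
    word, the level and the weight. *)
Lemma tandem_degree0 w w' : tandem 0 w w' -> exists c, w = c *: v /\ w' = c *: v'.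
Proof.
case/tandem_lspan => [[-> ->]|[m [<-]]]; first by exists 0; rewrite !scale0r.
elim=> [|a w1 w1' w2 w2' _ [c [-> ->]] _ [d [-> ->]]|[]// _].
- by exists 0; rewrite !scale0r.
- by exists (a * c + d); rewrite !scalerDl !scalerA.
- by exists 1; rewrite !scale1r.
Qed.

End Pair.

(** The Chevalley generators generate everything, so the relation is closed under
    all modes. *)
Section PairModes.
Variables (K : numFieldType) (k i : nat) (V V' : lmodType K).
Variables (f : family k V) (f' : family k V') (v : V) (v' : V').
Local Notation tandem := (tandem f f' v v').

Let two_neq0 : (2%:R : K) != 0. Proof. by rewrite pnatr_eq0. Qed.

Let GH1 n w w' : tandem n w w' -> tandem (n - 2) (fH f 1 w) (fH f' 1 w').
Proof.
move=> g; have HE W (g0 : family k W) x :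
    fH g0 1 x = fE g0 0 (fF g0 1 x) - fF g0 1 (fE g0 0 x).
  by rewrite fEF mul0r mul0r scale0r addr0 [_ + fH _ _ _]addrC addrK.
rewrite !HE; have -> : n - 2 = n - 1 - 1 by ring.
by apply: tandemB; [apply/tandem_E0/tandem_F1|apply/tandem_F1/tandem_E0].
Qed.

Let GHN1 n w w' : tandem n w w' -> tandem (n + 2) (fH f (-1) w) (fH f' (-1) w').
Proof.
move=> g; have HE W (g0 : family k W) x :
    fH g0 (-1) x = fE g0 (-1) (fF g0 0 x) - fF g0 0 (fE g0 (-1) x).
  by rewrite fEF addr0 oppr_eq0 oner_eq0 mulr0 scale0r addr0
    [_ + fH _ _ _]addrC addrK.
rewrite !HE; have -> : n + 2 = n + 1 + 1 by ring.
by apply: tandemB; [apply/tandem_E1/tandem_F0|apply/tandem_F0/tandem_E1].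
Qed.

Let HE (W : lmodType K) (g : family k W) (h m : int) x :
  fE g (h + m) x = 2%:R^-1 *: (fH g h (fE g m x) - fE g m (fH g h x)).
Proof.
by rewrite fHE [_ + 2%:R *: _]addrC addrK scalerA mulVf ?scale1r.
Qed.

Let HF (W : lmodType K) (g : family k W) (h m : int) x :
  fF g (h + m) x = 2%:R^-1 *: (fF g m (fH g h x) - fH g h (fF g m x)).
Proof.
by rewrite fHF subKr scalerA mulVf ?scale1r.
Qed.

Lemma tandem_E m n w w' : tandem n w w' -> tandem (n - 2 * m - 1) (fE f m w) (fE f' m w').
Proof.
elim/int_ind: m n w w' => [|m IH|m IH] n w w' g.
- by rewrite mulr0 subr0; exact: tandem_E0.
- have -> : m.+1%:Z = 1 + m%:Z by rewrite -PoszD add1n.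
  rewrite !HE; apply: tandemZ.
  have -> : n - 2 * (1 + m%:Z) - 1 = n - 2 * m%:Z - 1 - 2 by ring.
  apply: tandemB; first exact/GH1/IH.
  have -> : n - 2 * m%:Z - 1 - 2 = n - 2 - 2 * m%:Z - 1 by ring.
  exact/IH/GH1.
- have -> : - m.+1%:Z = -1 + - m%:Z by rewrite -opprD -PoszD add1n.
  rewrite !HE; apply: tandemZ.
  have -> : n - 2 * (-1 - m%:Z) - 1 = n - 2 * - m%:Z - 1 + 2 by ring.
  apply: tandemB; first exact/GHN1/IH.
  have -> : n - 2 * - m%:Z - 1 + 2 = n + 2 - 2 * - m%:Z - 1 by ring.
  exact/IH/GHN1.
Qed.

Lemma tandem_F m n w w' : tandem n w w' -> tandem (n - 2 * m + 1) (fF f m w) (fF f' m w').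
Proof.
elim/int_ind: m n w w' => [|m IH|m IH] n w w' g.
- by rewrite mulr0 subr0; exact: tandem_F0.
- have -> : m.+1%:Z = 1 + m%:Z by rewrite -PoszD add1n.
  rewrite !HF; apply: tandemZ.
  have -> : n - 2 * (1 + m%:Z) + 1 = n - 2 * m%:Z + 1 - 2 by ring.
  apply: tandemB; last exact/GH1/IH.
  have -> : n - 2 * m%:Z + 1 - 2 = n - 2 - 2 * m%:Z + 1 by ring.
  exact/IH/GH1.
- have -> : - m.+1%:Z = -1 + - m%:Z by rewrite -opprD -PoszD add1n.
  rewrite !HF; apply: tandemZ.
  have -> : n - 2 * (-1 - m%:Z) + 1 = n - 2 * - m%:Z + 1 + 2 by ring.
  apply: tandemB; last exact/GHN1/IH.
  have -> : n - 2 * - m%:Z + 1 + 2 = n + 2 - 2 * - m%:Z + 1 by ring.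
  exact/IH/GHN1.
Qed.

Lemma tandem_H m n w w' : tandem n w w' -> tandem (n - 2 * m) (fH f m w) (fH f' m w').
Proof.
move=> g; have HEF W (g0 : family k W) x :
    fH g0 m x = fE g0 m (fF g0 0 x) - fF g0 0 (fE g0 m x).
  rewrite fEF addr0; have [->|_] := eqVneq m 0.
    by rewrite !mul0r scale0r addr0 [_ + fH _ _ _]addrC addrK.
  by rewrite mulr0 scale0r addr0 [_ + fH _ _ _]addrC addrK.
rewrite !HEF; apply: tandemB.
  have -> : n - 2 * m = n + 1 - 2 * m - 1 by ring.
  exact/tandem_E/tandem_F0.
have -> : n - 2 * m = n - 2 * m - 1 + 1 by ring.
exact/tandem_F0/tandem_E.
Qed.

End PairModes.

(** * The enveloping algebra of the span of the negative modes of x_alpha *)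

Section NbarCoordinates.
Variables (K : fieldType) (r : nat).
Local Notation nb := (subLie (nbar_le K r)).

Definition xcoef (X : nb) (j : nat) : K :=
  sl2_val ((subLie_val X).1 (- (r + j)%N%:Z)) 0 1.

Lemma xcoef_linear a X Y j : xcoef (a *: X + Y) j = a * xcoef X j + xcoef Y j.
Proof. by rewrite /xcoef subLie_valP affineD1 affineZ1 /= !mxE. Qed.

Lemma xcoef_bounded X : exists B, forall j, (B <= j)%N -> xcoef X j = 0.
Proof.
have /asboolP Xf := valP (subLie_val X).1.
set A := [set m | _] in Xf.
exists (\sum_(m <- fset_set A) `|m|.+1)%N => j Bj; rewrite /xcoef.
have [->|nz] := eqVneq ((subLie_val X).1 (- (r + j)%N%:Z)) 0; first by rewrite mxE.
have mA : - (r + j)%N%:Z \in fset_set A by rewrite in_fset_set // mem_set.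
move: Bj; rewrite (bigD1_seq _ mA) ?fset_uniq //= abszN absz_nat.
by move=> /(leq_trans (leq_addr _ _)); rewrite ltnNge leq_addl.
Qed.

Definition xbound X : nat := projT1 (cid (xcoef_bounded X)).

Lemma xboundP X j : (xbound X <= j)%N -> xcoef X j = 0.
Proof. by rewrite /xbound; case: cid => B /= /[apply]. Qed.

(** Linear extension from the basis of the x_alpha(-(r + j)), the finiteness of
    the support of X being hidden in [xbound]. *)
Definition xlin (V : lmodType K) (g : nat -> V) (X : nb) : V :=
  \sum_(0 <= j < xbound X) xcoef X j *: g j.

Lemma xlin_widen (V : lmodType K) (g : nat -> V) X B :
  (forall j, (B <= j)%N -> xcoef X j = 0) ->
  xlin g X = \sum_(0 <= j < B) xcoef X j *: g j.
Proof.
move=> hB; have widen B1 B2 : (forall j, (B1 <= j)%N -> xcoef X j = 0) ->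
    (B1 <= B2)%N ->
    \sum_(0 <= j < B1) xcoef X j *: g j = \sum_(0 <= j < B2) xcoef X j *: g j.
  move=> h le12; rewrite [RHS](big_cat_nat (n := B1)) //=.
  rewrite [X in _ + X](_ : _ = 0) ?addr0 // big_nat_cond big1 // => j.
  by rewrite andbT => /andP[/h-> _]; rewrite scale0r.
have [le|/ltnW le] := leqP (xbound X) B; first by apply: widen => // j /xboundP.
by rewrite (widen _ _ hB le).
Qed.

Lemma xlin_linear (V : lmodType K) (g : nat -> V) a X Y :
  xlin g (a *: X + Y) = a *: xlin g X + xlin g Y.
Proof.
pose B := maxn (xbound X) (xbound Y).
have hX j : (B <= j)%N -> xcoef X j = 0.
  by move=> Bj; apply: xboundP; rewrite (leq_trans _ Bj) ?leq_maxl.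
have hY j : (B <= j)%N -> xcoef Y j = 0.
  by move=> Bj; apply: xboundP; rewrite (leq_trans _ Bj) ?leq_maxr.
rewrite (xlin_widen _ hX) (xlin_widen _ hY) (@xlin_widen _ _ _ B) => [|j Bj].
  rewrite scaler_sumr -big_split; apply: eq_bigr => j _ /=.
  by rewrite xcoef_linear scalerDl scalerA.
by rewrite xcoef_linear hX // hY // mulr0 addr0.
Qed.

Lemma xcoef_xneg j l : xcoef (xneg K r j) l = (l == j)%:R.
Proof.
rewrite /xcoef /= eqr_opp eqz_nat eqn_add2l.
by case: eqP => _; rewrite !mxE ?eqxx.
Qed.

Lemma xlin_gen (V : lmodType K) (g : nat -> V) j : xlin g (xneg K r j) = g j.
Proof.
rewrite (@xlin_widen _ _ _ j.+1) => [|l jl]; last first.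
  by rewrite xcoef_xneg gtn_eqF.
rewrite big_nat_recr //= xcoef_xneg eqxx scale1r big_nat_cond big1 ?add0r // => l.
by rewrite andbT => /andP[_ lj]; rewrite xcoef_xneg ltn_eqF // scale0r.
Qed.

Lemma xlin_xneg X : xlin (xneg K r) X = X.
Proof.
have /asboolP[X2 Xa] := valP X; apply: val_inj.
have valD (s : seq nat) (F : nat -> nb) :
    \val (\sum_(j <- s) F j) = \sum_(j <- s) \val (F j).
  by elim: s => [|j s IH]; rewrite ?big_nil // !big_cons -IH.
rewrite valD; apply: affineP => [m|]; last first.
  by rewrite affine_sum2 X2 big1 // => j _; exact: mulr0.
rewrite affine_sum1; have [c cE c0] := Xa m.
transitivity (\sum_(0 <= j < xbound X)
    if m == - (r + j)%N%:Z then xcoef X j *: xa K else 0).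
  apply: eq_bigr => j _; rewrite affineZ1 tmonoE; case: ifP => // _.
  by rewrite scaler0.
have [mr|/c0 c00] := boolP (m <= - r%:Z); last first.
  rewrite cE c00 scale0r big1_seq // => j _; case: eqP => // mE.
  have : m <= - r%:Z by rewrite mE lerN2 lez_nat leq_addr.
  by move=> mr; move: cE; rewrite c00 ?mr // scale0r /xcoef -mE => ->;
    rewrite mxE scale0r.
pose j0 := absz (m + r%:Z); have mE : m = - (r + j0)%N%:Z by rewrite /j0; lia.
have cX : xcoef X j0 = c.
  by rewrite /xcoef -mE cE /= !mxE /= mulr1.
have eqm j : (m == - (r + j)%N%:Z) = (j == j0).
  by rewrite [in LHS]mE eqr_opp eqz_nat eqn_add2l eq_sym.
under eq_bigr do rewrite eqm.
rewrite -big_mkcond /= cE.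
have [lt|ge] := ltnP j0 (xbound X).
  by rewrite big_nat1_eq lt /= cX.
by rewrite big_nat1_eq ltnNge ge /= -cX xboundP // scale0r.
Qed.

Lemma xgen_ind (V : lmodType K) (g : nb -> V) :
  (forall a X Y, g (a *: X + Y) = a *: g X + g Y) ->
  forall X, g X = xlin (fun j => g (xneg K r j)) X.
Proof.
move=> glin X; have g0 : g 0 = 0.
  by have := glin (-1) 0 0; rewrite scaler0 addr0 scaleN1r addNr.
rewrite -{1}(xlin_xneg X) /xlin.
elim: (index_iota _ _) => [|j s IH]; first by rewrite !big_nil.
by rewrite !big_cons glin IH.
Qed.

Lemma nb_br0 (X Y : nb) : lie_br X Y = 0.
Proof. by apply: val_inj; exact: nbar_br0 (valP X) (valP Y). Qed.

Section AbelianRep.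
Variables (V : lmodType K) (g : nat -> {linear V -> V}).
Hypothesis gC : forall m n v, g m (g n v) = g n (g m v).

Let act X v := xlin (fun j => g j v) X.

Fact act_linearl a X Y v : act (a *: X + Y) v = a *: act X v + act Y v.
Proof. exact: xlin_linear. Qed.

Fact act_linearr X a v w : act X (a *: v + w) = a *: act X v + act X w.
Proof.
rewrite /act /xlin scaler_sumr -big_split; apply: eq_bigr => j _ /=.
by rewrite linearP scalerDr !scalerA mulrC.
Qed.

Fact act_br X Y v :
  act (lie_br X Y) v = act X (act Y v) - act Y (act X v).
Proof.
rewrite nb_br0; have -> : act 0 v = 0.
  by have := act_linearl (-1) 0 0 v; rewrite scaler0 addr0 scaleN1r addNr.
suff -> : act X (act Y v) = act Y (act X v) by rewrite subrr.
rewrite /act /xlin.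
under eq_bigr do rewrite linear_sum scaler_sumr.
under [RHS]eq_bigr do rewrite linear_sum scaler_sumr.
rewrite exchange_big; apply: eq_bigr => j _; apply: eq_bigr => l _.
by rewrite !linearZ /= !scalerA mulrC gC.
Qed.

Definition xrep : lieRep nb V := LieRep act_linearl act_linearr act_br.

Lemma xrep_xneg j v : xrep (xneg K r j) v = g j v.
Proof. exact: xlin_gen. Qed.

End AbelianRep.

Local Notation A := (Uenv nb).
Local Notation y j := (ugen (xneg K r j)).

Lemma umulC (a b : A) : a * b = b * a.
Proof.
elim/Uenv_ind: a => [X|c|a a' IH IH'|a a' IH IH'].
- elim/Uenv_ind: b => [Y|c|b b' IH IH'|b b' IH IH'].
  + apply/eqP; rewrite -subr_eq0 -ugen_br nb_br0; apply/eqP.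
    by have := ugen_linear (-1) (0 : nb) 0; rewrite scaler0 addr0 scaleN1r addNr.
  + by rewrite -scalerAl -scalerAr mul1r mulr1.
  + by rewrite mulrDl mulrDr IH IH'.
  + by rewrite mulrA IH -mulrA IH' mulrA.
- by rewrite -scalerAl -scalerAr mul1r mulr1.
- by rewrite mulrDl mulrDr IH IH'.
- by rewrite -mulrA IH' mulrA IH mulrA.
Qed.

Lemma umulCA (a b c : A) : a * (b * c) = b * (a * c).
Proof. by rewrite mulrA (umulC a) -mulrA. Qed.

Definition umon (s : seq nat) : A := \prod_(j <- s) y j.

Lemma umon_cons j s : umon (j :: s) = y j * umon s.
Proof. by rewrite /umon big_cons. Qed.

Lemma umon_cat s t : umon (s ++ t) = umon s * umon t.
Proof. by rewrite /umon big_cat. Qed.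

Lemma umon_perm s t : perm_eq s t -> umon s = umon t.
Proof.
elim: s t => [|j s IH] t st.
  by have := perm_size st; case: t st.
have jt : j \in t by rewrite -(perm_mem st) mem_head.
have [t1 [t2 tE]] : exists t1 t2, t = t1 ++ j :: t2.
  by case/splitPr: jt => t1 t2; exists t1, t2.
rewrite tE umon_cons umon_cat umon_cons umulCA -umon_cat (IH (t1 ++ t2)) //.
rewrite -(perm_cons j) (permPl st) tE.
have h : perm_eq (t1 ++ [:: j] ++ t2) ([:: j] ++ t1 ++ t2) by rewrite perm_catCA.
exact: h.
Qed.

Lemma umon_nseq n j : umon (nseq n j) = y j ^+ n.
Proof. by elim: n => [|n IH]; rewrite /umon ?big_nil // big_cons exprS -IH. Qed.

Definition ulc (l : seq (K * seq nat)) : A := \sum_(p <- l) p.1 *: umon p.2.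

Lemma ulc_surj a : exists l, a = ulc l.
Proof.
elim/Uenv_ind: a => [X|c|a b [l ->] [l' ->]|a b [l ->] [l' ->]].
- exists [seq (xcoef X j, [:: j]) | j <- index_iota 0 (xbound X)].
  rewrite /ulc big_map (xgen_ind (@ugen_linear K nb)) /xlin.
  by apply: eq_bigr => j _; rewrite /umon big_seq1.
- by exists [:: (c, [::])]; rewrite /ulc big_seq1 /umon big_nil.
- by exists (l ++ l'); rewrite /ulc big_cat.
- exists [seq (p.1 * q.1, p.2 ++ q.2) | p <- l, q <- l'].
  rewrite /ulc big_allpairs_dep mulr_suml; apply: eq_bigr => p _.
  rewrite mulr_sumr; apply: eq_bigr => q _.
  by rewrite umon_cat -scalerAl -scalerAr scalerA.
Qed.

(** Homogeneity for the excess e and the charge d of products of the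
    x_alpha(-(r + j)).  Counting j instead of r + j makes the excess drop by the
    charge when the spectral shift is undone, which is what the recursion on the
    degree lives on. *)
Definition Hom (e d : nat) (a : A) : Prop :=
  exists2 l : seq (K * seq nat),
    (forall p, p \in l -> size p.2 = d /\ sumn p.2 = e) & a = ulc l.

Lemma Hom0 e d : Hom e d 0.
Proof. by exists [::] => //; rewrite /ulc big_nil. Qed.

Lemma HomD e d a b : Hom e d a -> Hom e d b -> Hom e d (a + b).
Proof.
move=> [l hl ->] [l' hl' ->]; exists (l ++ l'); last by rewrite /ulc big_cat.
by move=> p; rewrite mem_cat => /orP[/hl|/hl'].
Qed.

Lemma HomZ e d c a : Hom e d a -> Hom e d (c *: a).
Proof.
move=> [l hl ->]; exists [seq (c * p.1, p.2) | p <- l].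
  by move=> p /mapP[q /hl qE ->].
by rewrite /ulc big_map scaler_sumr; apply: eq_bigr => p _; rewrite scalerA.
Qed.

Lemma Hom_umon s : Hom (sumn s) (size s) (umon s).
Proof.
exists [:: (1, s)]; last by rewrite /ulc big_seq1 scale1r.
by move=> p; rewrite inE => /eqP->.
Qed.

Lemma HomM e d e' d' a b : Hom e d a -> Hom e' d' b -> Hom (e + e') (d + d') (a * b).
Proof.
move=> [l hl ->] [l' hl' ->].
exists [seq (p.1 * q.1, p.2 ++ q.2) | p <- l, q <- l'].
  move=> _ /allpairsP[[p q] [/= /hl[p1 p2] /hl'[q1 q2] ->]] /=.
  by rewrite size_cat sumn_cat p1 p2 q1 q2.
rewrite /ulc big_allpairs_dep mulr_suml; apply: eq_bigr => p _.
rewrite mulr_sumr; apply: eq_bigr => q _.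
by rewrite umon_cat -scalerAl -scalerAr scalerA.
Qed.

Lemma Hom_sum e d (I : eqType) (s : seq I) (P : pred I) (F : I -> A) :
  (forall x, x \in s -> P x -> Hom e d (F x)) -> Hom e d (\sum_(x <- s | P x) F x).
Proof.
elim: s => [|x s IH] h; first by rewrite big_nil; exact: Hom0.
rewrite big_cons; have hs : Hom e d (\sum_(z <- s | P z) F z).
  by apply: IH => z zs; apply: h; rewrite inE zs orbT.
by case: ifP => // Px; apply: HomD => //; apply: h; rewrite ?mem_head.
Qed.

Lemma Hom_expn j n : Hom (n * j) n (y j ^+ n).
Proof. by rewrite -umon_nseq; have := Hom_umon (nseq n j); rewrite size_nseq sumn_nseq mulnC. Qed.

End NbarCoordinates.

(** ** The relations as sums over compositions *)

(** The weak compositions of s into q parts.  They are listed as sequences, and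
    not as tuples in a finite type, so that splitting off the first part is a
    computation. *)
Fixpoint comps (q s : nat) : seq (seq nat) :=
  if q is q'.+1 then flatten [seq map (cons n) (comps q' (s - n)) | n <- iota 0 s.+1]
  else if s == 0%N then [:: [::]] else [::].

Lemma compsS q s : comps q.+1 s =
  flatten [seq map (cons n) (comps q (s - n)) | n <- iota 0 s.+1].
Proof. by []. Qed.

Lemma mem_comps q s c : (c \in comps q s) = (size c == q) && (sumn c == s).
Proof.
elim: q s c => [|q IH] s c.
  rewrite /=; case: eqP => [->|/eqP/negbTE s0]; first by case: c.
  by rewrite in_nil; case: c => //=; rewrite eq_sym s0.
rewrite compsS; apply/flatten_mapP/andP => [[n]|[]].
  rewrite mem_iota /= ltnS => ns /mapP[c' + ->] /=.
  by rewrite IH => /andP[/eqP-> /eqP->]; rewrite eqxx subnKC.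
case: c => [//|n c].
rewrite -[size _]/(size c).+1 eqSS -[sumn _]/(n + sumn c)%N => /eqP cq /eqP cs.
exists n; first by rewrite mem_iota add0n ltnS -cs leq_addr.
by apply: map_f; rewrite IH cq -cs addKn !eqxx.
Qed.

Lemma comps_uniq q s : uniq (comps q s).
Proof.
elim: q s => [|q IH] s; [by rewrite /=; case: eqP|rewrite compsS].
have h t : uniq t -> uniq (flatten [seq [seq n :: c | c <- comps q (s - n)] | n <- t]).
  elim: t => // n t IHt /= /andP[nt ut].
  rewrite cat_uniq map_inj_uniq ?IH ?IHt ?andbT //=; last by move=> c c' [].
  apply/hasPn => c /flatten_mapP[m mt /mapP[c1 _ ->]]; apply/negP => /mapP[c2 _ [mn _]].
  by rewrite -mn mt in nt.
exact: (h (iota 0 s.+1)) (iota_uniq _ _).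
Qed.

Section Relations.
Variables (K : fieldType) (r : nat).
Local Notation A := (Uenv (subLie (nbar_le K r))).
Local Notation y j := (ugen (xneg K r j)).

Definition Rcomp (q s : nat) : A := \sum_(c <- comps q s) umon K r c.

Lemma Rcomp_recl q s : Rcomp q.+1 s = \sum_(0 <= n < s.+1) y n * Rcomp q (s - n).
Proof.
rewrite /Rcomp compsS big_flatten big_map /index_iota subn0; apply: eq_bigr => n _.
by rewrite big_map mulr_sumr; apply: eq_bigr => c _; rewrite umon_cons.
Qed.

Lemma Hom_Rcomp q s : Hom s q (Rcomp q s).
Proof.
apply: Hom_sum => c; rewrite mem_comps => /andP[/eqP <- /eqP <-] _.
exact: Hom_umon.
Qed.

Lemma RrelE k t : (r * k.+1 <= t)%N -> Rrel K r k t = Rcomp k.+1 (t - r * k.+1).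
Proof.
move=> rt; rewrite /Rrel /Rcomp.
pose F (n : {ffun 'I_k.+1 -> 'I_t.+1}) := [seq nat_of_ord (n j) | j <- enum 'I_k.+1].
have sumF (n : {ffun 'I_k.+1 -> 'I_t.+1}) : (\sum_j (r + n j) = r * k.+1 + sumn (F n))%N.
  rewrite big_split /= sum_nat_const card_ord mulnC sumnE big_map.
  by rewrite enumT.
transitivity (\sum_(c <- [seq F n | n <- enum [set n : {ffun 'I_k.+1 -> 'I_t.+1} |
    (\sum_j (r + n j) == t)%N]%SET]) umon K r c).
  rewrite big_map big_enum /=; apply: eq_big => [n|n _]; first by rewrite inE.
  by rewrite /umon big_map enumT; apply: eq_bigr.
apply: perm_big; apply: uniq_perm; last 1 first.
- move=> c; rewrite mem_comps; apply/mapP/andP => [[n]|[/eqP cs /eqP ct]].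
    rewrite mem_enum inE sumF => /eqP nt ->.
    by rewrite size_map -cardE card_ord eqxx -nt addKn.
  have ltc j : (nth 0 c j < t.+1)%N.
    rewrite ltnS (leq_trans _ (leq_subr (r * k.+1) t)) // -ct.
    elim: (c) j => [|x c' IH] [|j] //=; first exact: leq_addr.
    exact: leq_trans (IH j) (leq_addl _ _).
  exists [ffun j : 'I_k.+1 => Ordinal (ltc j)]; last first.
    apply: (@eq_from_nth _ 0%N); first by rewrite size_map -cardE card_ord.
    move=> j; rewrite cs => jk.
    rewrite (nth_map ord0) ?size_enum_ord // ffunE /=.
    by rewrite nth_enum_ord.
  rewrite mem_enum inE big_split /= sum_nat_const card_ord mulnC.
  under eq_bigr do rewrite ffunE /=.
  rewrite -(big_mkord xpredT (fun j => nth 0%N c j)) -cs -(big_nth 0%N xpredT id).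
  by rewrite -sumnE ct cs subnKC.
- rewrite map_inj_uniq ?enum_uniq // => n n' /eq_in_map nn'.
  by apply/ffunP => j; apply: val_inj; apply: nn'; rewrite mem_enum.
- exact: comps_uniq.
Qed.

End Relations.

Section AbelianHom.
Variables (K : fieldType) (r : nat) (B : algType K) (z : nat -> B).
Hypothesis zC : forall m n, z m * z n = z n * z m.

(** As nbar_{<= -r} is abelian, any commuting family in an algebra is the image of
    its basis under an algebra morphism. *)
Definition xhom : Uenv (subLie (nbar_le K r)) -> B := ulift (@xlin K r B z).

Fact xlin_lie_to_alg : lie_to_alg (@xlin K r B z).
Proof.
split=> [a X Y|X Y]; first exact: xlin_linear.
rewrite nb_br0; have -> : xlin z (0 : subLie (nbar_le K r)) = 0 :> B.
  by have := @xlin_linear K r B z (-1) 0 0; rewrite scaler0 addr0 scaleN1r addNr.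
apply/esym/eqP; rewrite subr_eq0; apply/eqP.
rewrite /xlin mulr_suml; under eq_bigr do rewrite mulr_sumr.
rewrite mulr_suml; under [RHS]eq_bigr do rewrite mulr_sumr.
rewrite exchange_big; apply: eq_bigr => j _; apply: eq_bigr => l _.
by rewrite -!scalerAl -!scalerAr zC !scalerA mulrC.
Qed.

Lemma xhomD a b : xhom (a + b) = xhom a + xhom b.
Proof. exact: (uliftD xlin_lie_to_alg). Qed.

Lemma xhomM a b : xhom (a * b) = xhom a * xhom b.
Proof. exact: (uliftM xlin_lie_to_alg). Qed.

Lemma xhomZ c a : xhom (c *: a) = c *: xhom a.
Proof.
rewrite -[a in LHS]mul1r scalerAl xhomM; set b := xhom a.
by rewrite /xhom (uliftA xlin_lie_to_alg) -scalerAl mul1r.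
Qed.

Lemma xhom0 : xhom 0 = 0.
Proof. by rewrite -(scale0r 0) xhomZ scale0r. Qed.

Lemma xhom_umon s : xhom (umon K r s) = \prod_(j <- s) z j.
Proof.
elim: s => [|j s IH].
  rewrite /umon !big_nil -[1 in LHS]scale1r /xhom (uliftA xlin_lie_to_alg).
  exact: scale1r.
rewrite umon_cons big_cons xhomM IH; congr (_ * _).
by rewrite /xhom (ulift_gen xlin_lie_to_alg) xlin_gen.
Qed.

Lemma xhom_sum (I : Type) (t : seq I) (F : I -> Uenv (subLie (nbar_le K r))) :
  xhom (\sum_(x <- t) F x) = \sum_(x <- t) xhom (F x).
Proof.
elim: t => [|x t IH]; first by rewrite !big_nil xhom0.
by rewrite !big_cons xhomD IH.
Qed.

End AbelianHom.

Section AlgebraShift.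
Variables (K : fieldType) (r r' c : nat).

(** For r' = r and c = 1 this is the spectral shift; for r' = r + 1 and c = 0 it
    is the same map, seen as an isomorphism onto U(nbar_{<= -r'}). *)
Definition xshift : Uenv (subLie (nbar_le K r)) -> Uenv (subLie (nbar_le K r')) :=
  xhom (fun j => ugen (xneg K r' (j + c))).

Let zC m n : ugen (xneg K r' (m + c)) * ugen (xneg K r' (n + c)) =
  ugen (xneg K r' (n + c)) * ugen (xneg K r' (m + c)).
Proof. exact: umulC. Qed.

Lemma xshiftD a b : xshift (a + b) = xshift a + xshift b.
Proof. exact: xhomD. Qed.

Lemma xshiftM a b : xshift (a * b) = xshift a * xshift b.
Proof. exact: xhomM. Qed.

Lemma xshiftZ e a : xshift (e *: a) = e *: xshift a.
Proof. exact: xhomZ. Qed.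

Lemma xshift0 : xshift 0 = 0.
Proof. exact: xhom0. Qed.


Lemma xshift_umon s : xshift (umon K r s) = umon K r' [seq (j + c)%N | j <- s].
Proof. by rewrite /xshift xhom_umon // /umon big_map. Qed.

Lemma xshift_ulc l :
  xshift (ulc r l) = ulc r' [seq (p.1, [seq (j + c)%N | j <- p.2]) | p <- l].
Proof.
rewrite /ulc big_map; elim: l => [|p l IH]; first by rewrite !big_nil xshift0.
by rewrite !big_cons xshiftD IH xshiftZ xshift_umon.
Qed.

Lemma Hom_xshift e d a : Hom e d a -> Hom (e + d * c) d (xshift a).
Proof.
move=> [l hl ->]; rewrite xshift_ulc; eexists; last reflexivity.
move=> p /mapP[q /hl[q1 q2] ->] /=; rewrite size_map q1; split=> //.
rewrite -q1 -q2; elim: (q.2) => //= j s ->; rewrite mulSn; lia.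
Qed.

Lemma xshift_exp j n : xshift (ugen (xneg K r j) ^+ n) = ugen (xneg K r' (j + c)) ^+ n.
Proof. by rewrite -!umon_nseq xshift_umon map_nseq. Qed.

End AlgebraShift.

Lemma sumn_predn s : 0%N \notin s -> (sumn (map predn s) + size s)%N = sumn s.
Proof.
elim: s => //= -[//|j] s IH; rewrite inE negb_or => /andP[_ /IH <-] /=.
by rewrite addSn addnS addnA.
Qed.

Section Ideal.
Variables (K : numFieldType) (k : nat).
Local Notation A := (Uenv (subLie (nbar_le K 1))).
Local Notation y j := (ugen (xneg K 1 j)).
Local Notation sh := (@xshift K 1 1 1).
Local Notation R := (Rcomp K 1).

(** The part of I_{Lambda_{k,i}} of excess e and charge d, presented by
    homogeneous multiples of the generators: what the recursion needs from
    membership is a presentation whose cofactors have known degrees. *)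
Inductive hideal (i e d : nat) : A -> Prop :=
  | hideal0 : hideal i e d 0
  | hidealD a b : hideal i e d a -> hideal i e d b -> hideal i e d (a + b)
  | hidealR e1 d1 s g : Hom e1 d1 g -> e = (e1 + s)%N -> d = (d1 + k.+1)%N ->
      hideal i e d (g * R k.+1 s)
  | hidealX d1 g : Hom e d1 g -> d = (d1 + (k - i + 1))%N ->
      hideal i e d (g * y 0 ^+ (k - i + 1)).

Lemma hideal_mull i e1 d1 h e d a :
  Hom e1 d1 h -> hideal i e d a -> hideal i (e1 + e) (d1 + d) (h * a).
Proof.
move=> hh; elim=> [|b c _ IHb _ IHc|e2 d2 s g hg -> ->|d2 g hg ->].
- by rewrite mulr0; exact: hideal0.
- by rewrite mulrDr; exact: hidealD.
- by rewrite mulrA; apply: hidealR (HomM hh hg) _ _; rewrite addnA.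
- by rewrite mulrA; apply: hidealX (HomM hh hg) _; rewrite addnA.
Qed.

Lemma hidealZ i e d c a : hideal i e d a -> hideal i e d (c *: a).
Proof.
move=> ha; have h1 : Hom 0 0 (c *: 1 : A).
  by apply: HomZ; have := Hom_umon K 1 [::]; rewrite /umon big_nil.
by have := hideal_mull h1 ha; rewrite -scalerAl mul1r.
Qed.

Lemma hideal_ideal i e d a : hideal i e d a -> I_ideal k i a.
Proof.
elim=> [|b c _ [s hs ->] _ [t ht ->]|e1 d1 s g _ _ _|d1 g _ _].
- by exists [::] => //; rewrite big_nil.
- exists (s ++ t); last by rewrite big_cat.
  by move=> p; rewrite mem_cat => /orP[/hs|/ht].
- exists [:: (g, R k.+1 s)]; last by rewrite big_seq1.
  move=> p; rewrite inE => /eqP -> /=; left.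
  exists (s + k.+1)%N; first by rewrite /= leq_addl.
  by rewrite RrelE mul1n ?leq_addl // addnK.
- exists [:: (g, y 0 ^+ (k - i + 1))]; last by rewrite big_seq1.
  by move=> p; rewrite inE => /eqP -> /=; right.
Qed.

Lemma Hom_split e d a : Hom e d a ->
  exists b c, [/\ a = y 0 * b + sh c, Hom e d.-1 b, Hom (e - d) d c,
    d = 0%N -> b = 0 & (e < d)%N -> c = 0].
Proof.
move=> [l hl ->]; rewrite /ulc; elim: l hl => [|p l IH] hl.
  by exists 0, 0; split; rewrite ?big_nil ?mulr0 ?xshift0 ?addr0 //; exact: Hom0.
have [|b [c [aE hb hc b0 c0]]] := IH.
  by move=> q ql; apply: hl; rewrite inE ql orbT.
have [pd pe] := hl p (mem_head _ _).
rewrite big_cons aE; have [p0|p0] := boolP (0%N \in p.2).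
  exists (p.1 *: umon K 1 (rem 0%N p.2) + b), c; split=> //.
  - rewrite mulrDr addrA -scalerAr -umon_cons; congr (_ *: _ + _ + _).
    by apply: umon_perm; exact: perm_to_rem.
  - apply: HomD => //; apply: HomZ; have := Hom_umon K 1 (rem 0%N p.2).
    rewrite size_rem // pd; have /perm_sumn := perm_to_rem p0.
    by rewrite pe /= add0n => ->.
  - by move=> d0; move: p0; case: (p.2) pd => //; rewrite d0.
have pS : p.2 = [seq (j + 1)%N | j <- map predn p.2].
  rewrite -map_comp -[LHS]map_id; apply/eq_in_map => j jp /=.
  by rewrite addn1 prednK // lt0n; apply: contraNN p0 => /eqP <-.
have sE := sumn_predn p0; rewrite pd pe in sE.
exists b, (p.1 *: umon K 1 (map predn p.2) + c); split=> //.
- by rewrite xshiftD xshiftZ xshift_umon -pS addrCA.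
- apply: HomD => //; apply: HomZ; have := Hom_umon K 1 (map predn p.2).
  by rewrite size_map pd -sE addnK.
- by rewrite -sE ltnNge leq_addl.
Qed.

(** The compositions with a part equal to 0 contribute multiples of x_alpha(-1);
    subtracting 1 from every part turns the others into all the compositions of
    s. *)
Lemma Rcomp_shift q s : exists2 g, Hom (s + q) q.-1 g &
  R q (s + q) = sh (R q s) + y 0 * g.
Proof.
pose C := comps q (s + q).
exists (\sum_(c <- C | 0%N \in c) umon K 1 (rem 0%N c)).
  apply: Hom_sum => c; rewrite mem_comps => /andP[/eqP cq /eqP cs] c0.
  have := Hom_umon K 1 (rem 0%N c); rewrite size_rem // cq.
  by have /perm_sumn := perm_to_rem c0; rewrite cs /= add0n => ->.
rewrite /Rcomp (bigID (fun c => 0%N \in c)) /= addrC; congr (_ + _); last first.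
  rewrite mulr_sumr; apply: eq_bigr => c c0; rewrite -umon_cons.
  by apply: umon_perm; exact: perm_to_rem.
rewrite /xshift xhom_sum; last by move=> *; exact: umulC.
rewrite -/(sh) -big_filter.
under [RHS]eq_bigr do rewrite -/(sh _) xshift_umon.
rewrite -[RHS](big_map (map (addn^~ 1%N)) xpredT (umon K 1)).
apply: perm_big; apply: uniq_perm.
- by rewrite filter_uniq ?comps_uniq.
- rewrite map_inj_uniq ?comps_uniq //; apply: inj_map => a b /eqP.
  by rewrite eqn_add2r => /eqP.
move=> c; rewrite mem_filter mem_comps; apply/andP/mapP => [[c0 /andP[/eqP cq /eqP cs]]|].
  exists (map predn c).
    rewrite mem_comps size_map cq eqxx /= -(eqn_add2r q) -cs -cq.
    by rewrite sumn_predn.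
  rewrite -map_comp -[LHS]map_id; apply/eq_in_map => j jc /=.
  by rewrite addn1 prednK // lt0n; apply: contraNN c0 => /eqP <-.
move=> [c']; rewrite mem_comps => /andP[/eqP cq /eqP cs] ->.
have c0 : 0%N \notin [seq (j + 1)%N | j <- c'].
  by apply/negP => /mapP[j _ /eqP]; rewrite addn1.
split=> //; rewrite size_map cq eqxx /= -(sumn_predn c0) size_map cq -map_comp.
by rewrite eqn_add2r -cs; apply/eqP; congr sumn; rewrite -[RHS]map_id;
  apply: eq_map => j /=; rewrite addn1.
Qed.

Lemma umon_zeros c m : (m <= count_mem 0%N c)%N -> exists c',
  [/\ umon K 1 c = y 0 ^+ m * umon K 1 c', (size c = m + size c')%N & sumn c = sumn c'].
Proof.
elim: m c => [|m IH] c mc; first by exists c; rewrite expr0 mul1r.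
have c0 : 0%N \in c by rewrite -has_pred1 has_count (leq_trans _ mc).
have pc := perm_to_rem c0.
have [|c' [h1 h2 h3]] := IH (rem 0%N c).
  by move: mc; rewrite (permP pc (pred1 0%N)).
exists c'; rewrite (umon_perm _ _ pc) umon_cons h1 mulrA exprS.
by rewrite (perm_size pc) (perm_sumn pc) /= h2 h3 add0n.
Qed.

Lemma size_le_zeros c : (size c <= sumn c + count_mem 0%N c)%N.
Proof. by elim: c => //= -[|j] c IH /=; lia. Qed.

(** The positive parts are then all equal to 1, as there are at least as many of
    them as their sum. *)
Lemma few_zeros c : (sumn c + count_mem 0%N c <= size c)%N ->
  perm_eq c (nseq (count_mem 0%N c) 0%N ++ nseq (sumn c) 1%N).
Proof.
elim: c => //= j c IH.
have ge := size_le_zeros c.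
case: j => [|j] /= le.
  by rewrite perm_cons; apply: IH; move: le; rewrite !add0n add1n addnS ltnS.
have j0 : j = 0%N.
  by move: le ge; rewrite add0n; move: (count _ _) (sumn c) (size c); lia.
move: le; rewrite j0 /= !add0n add1n addSn ltnS => le.
have h (s t : seq nat) : perm_eq (s ++ [:: 1%N] ++ t) ([:: 1%N] ++ s ++ t).
  by rewrite perm_catCA.
by rewrite perm_sym (permPl (h _ _)) perm_cons perm_sym; exact: IH.
Qed.

(** A composition of i + 1 into k + 1 parts has at least k - i parts equal to 0.
    It has exactly k - i if its positive parts are all 1; every other one yields a
    multiple of x_alpha(-1)^(k-i+1).  So x_alpha(-2)^(i+1) x_alpha(-1)^(k-i) lies
    in the ideal of Lambda_{k,i}. *)
Lemma Rcomp_small i : (i <= k)%N -> exists n g, [/\ (0 < n)%N, Hom i.+1 i g &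
  R k.+1 i.+1 = n%:R *: (y 1 ^+ i.+1 * y 0 ^+ (k - i)) + g * y 0 ^+ (k - i + 1)].
Proof.
move=> ik; pose P c := (k - i < count_mem 0%N c)%N.
have split s : (forall c, c \in s -> size c = k.+1 /\ sumn c = i.+1) ->
    exists2 g, Hom i.+1 i g & \sum_(c <- s) umon K 1 c =
      (count (predC P) s)%:R *: (y 1 ^+ i.+1 * y 0 ^+ (k - i))
      + g * y 0 ^+ (k - i + 1).
  elim: s => [|c s IH] hs.
    by exists 0; rewrite ?big_nil ?scale0r ?mul0r ?addr0 //; exact: Hom0.
  have [|g hg gE] := IH; first by move=> c' c's; apply: hs; rewrite inE c's orbT.
  have [cq cs] := hs c (mem_head _ _).
  rewrite big_cons gE /=; have [Pc|nPc] := boolP (P c); last first.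
    exists g => //; rewrite /= natrD scalerDl scale1r -addrA; congr (_ + _).
    have cE : count_mem 0%N c = (k - i)%N.
      apply/eqP; rewrite eqn_leq leqNgt nPc /= leqNgt; apply/negP => lt.
      by move: (size_le_zeros c) lt; rewrite cq cs; move: (count _ _); lia.
    rewrite (umon_perm _ _ (@few_zeros c _)) /=; last by rewrite cE cs cq; lia.
    by rewrite cE cs umon_cat !umon_nseq umulC.
  have [|c' [h1 h2 h3]] := @umon_zeros c (k - i + 1); first by rewrite addn1.
  exists (umon K 1 c' + g).
    apply: HomD => //; have := Hom_umon K 1 c'; rewrite -h3 cs.
    have -> // : size c' = i by move: h2; rewrite cq; lia.
  by rewrite add0n mulrDl h1 [y 0 ^+ _ * _]umulC addrCA.
have [|g hg gE] := split (comps k.+1 i.+1).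
  by move=> c; rewrite mem_comps => /andP[/eqP-> /eqP->].
exists (count (predC P) (comps k.+1 i.+1)), g; split=> //.
rewrite -has_count; apply/hasP.
exists (nseq (k - i) 0%N ++ nseq i.+1 1%N).
  rewrite mem_comps size_cat !size_nseq sumn_cat !sumn_nseq; apply/andP; split; lia.
apply/negP; rewrite [P _]/P count_cat !count_nseq.
by rewrite mul1n mul0n addn0 ltnn.
Qed.

(** Generator by generator: the shift of a relation is a relation modulo
    x_alpha(-1) ([Rcomp_shift]), and the shift x_alpha(-2)^(i+1) of the remaining
    generator is dealt with by [Rcomp_small]. *)
Lemma hideal_shift i e d c : (i <= k)%N -> hideal (k - i) e d c ->
  hideal i (e + d) (d + (k - i)) (sh c * y 0 ^+ (k - i)).
Proof.
move=> ik; elim=> [|a b _ IHa _ IHb|e1 d1 s g hg -> ->|d1 g hg ->].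
- by rewrite xshift0 mul0r; exact: hideal0.
- by rewrite xshiftD mulrDl; exact: hidealD.
- rewrite xshiftM -mulrA; have := Hom_xshift 1 1 hg; rewrite muln1 => hsg.
  rewrite addnACA -(addnA d1); apply: hideal_mull hsg _.
  have [g0 hg0 RE] := Rcomp_shift k.+1 s.
  have -> : sh (R k.+1 s) = R k.+1 (s + k.+1) - y 0 * g0 by rewrite RE addrK.
  rewrite mulrBl; apply: hidealD.
    rewrite umulC; apply: hidealR (Hom_expn _ _ _ _) _ _; first by rewrite muln0.
    by rewrite addnC.
  rewrite -scaleN1r; apply: hidealZ; rewrite (umulC (y 0)) -mulrA -exprS -(addn1 (k - i)).
  by apply: hidealX hg0 _; rewrite /=; lia.
- rewrite xshiftM xshift_exp -mulrA subKn // !addn1.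
  have := Hom_xshift 1 1 hg; rewrite muln1 => hsg.
  rewrite addnA -(addnA d1); apply: hideal_mull hsg _.
  have [n [g0 [n0 hg0 RE]]] := Rcomp_small ik.
  have -> : y (0 + 1) ^+ i.+1 * y 0 ^+ (k - i) =
      n%:R^-1 *: (1 * R k.+1 i.+1 - g0 * y 0 ^+ (k - i + 1)).
    by rewrite mul1r RE addrK scalerA mulVf ?scale1r // pnatr_eq0 -lt0n.
  apply/hidealZ/hidealD.
    have h1 : Hom 0 0 (1 : A) by have := Hom_umon K 1 [::]; rewrite /umon big_nil.
    by apply: hidealR h1 _ _; lia.
  by rewrite -scaleN1r; apply/hidealZ/(hidealX hg0); lia.
Qed.

(** The two ideals only differ by the power of x_alpha(-1) among the
    generators. *)
Lemma hideal_succ i e d a : (i < k)%N -> hideal i.+1 e d a -> exists a' b,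
  [/\ a = a' + b * y 0 ^+ (k - i), hideal i e d a', Hom e (d - (k - i)) b &
      (k - i <= d)%N \/ b = 0].
Proof.
move=> ik; elim=> [|a1 a2 _ [a1' [b1 [-> h1 h2 h3]]] _ [a2' [b2 [-> g1 g2 g3]]]|
  e1 d1 s g hg -> ->|d1 g hg ->].
- exists 0, 0; split; [by rewrite mul0r addr0|exact: hideal0|exact: Hom0|by right].
- exists (a1' + a2'), (b1 + b2); split.
  + by rewrite mulrDl addrACA.
  + exact: hidealD.
  + exact: HomD.
  + case: h3 => [|->]; first by left.
    by case: g3 => [|->]; [left|right; rewrite addr0].
- exists (g * R k.+1 s), 0; split.
  + by rewrite mul0r addr0.
  + exact: hidealR hg _ _.
  + exact: Hom0.
  + by right.
- have -> : (k - i.+1 + 1 = k - i)%N by lia.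
  exists 0, g; split.
  + by rewrite add0r.
  + exact: hideal0.
  + by rewrite addnK.
  + by left; rewrite leq_addl.
Qed.

Lemma xshift_Rcomp q s : @xshift K 1 2 0 (R q s) = Rcomp K 2 q s.
Proof.
rewrite /xshift xhom_sum; last by move=> *; exact: umulC.
apply: eq_bigr => c _; rewrite -/(xshift 2 0 _) xshift_umon.
by rewrite (eq_map (addn0)) map_id.
Qed.

(** The shift takes relations to relations; the other generator x_alpha(-1)^(k+1)
    of the ideal of Lambda_{k,0} is itself the relation R^0_{k,k+1}. *)
Lemma hideal0_ideal' e d a : hideal 0 e d a -> I'_ideal k (@xshift K 1 2 0 a).
Proof.
have inI g s : I'_ideal k (g * Rcomp K 2 k.+1 s).
  exists [:: (g, Rcomp K 2 k.+1 s)]; last by rewrite big_seq1.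
  move=> p; rewrite inE => /eqP -> /=.
  exists (s + 2 * k.+1)%N; first by rewrite /= leq_addl.
  by rewrite RrelE ?leq_addl // addnK.
elim=> [|b c _ [s hs sE] _ [t ht tE]|e1 d1 s g _ _ _|d1 g _ _].
- by exists [::] => //; rewrite big_nil xshift0.
- exists (s ++ t); last by rewrite xshiftD big_cat sE tE.
  by move=> p; rewrite mem_cat => /orP[/hs|/ht].
- by rewrite xshiftM xshift_Rcomp; exact: inI.
- rewrite xshiftM xshift_exp; suff -> : ugen (xneg K 2 (0 + 0)) ^+ (k - 0 + 1) =
    Rcomp K 2 k.+1 0 by exact: inI.
  rewrite /Rcomp (_ : comps k.+1 0 = [:: nseq k.+1 0%N]).
    by rewrite big_seq1 umon_nseq subn0 addn1.
  by elim: (k) => //= m ->.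
Qed.

End Ideal.

(** * The fermionic Fock module *)

Lemma big_support (V : nmodType) (I : eqType) (s t : seq I) (F : I -> V) :
  uniq s -> uniq t -> (forall x, x \in s -> x \notin t -> F x = 0) ->
  (forall x, x \in t -> x \notin s -> F x = 0) ->
  \sum_(x <- s) F x = \sum_(x <- t) F x.
Proof.
move=> us ut hs ht.
have restrict (a b : seq I) : (forall x, x \in a -> x \notin b -> F x = 0) ->
    \sum_(x <- a) F x = \sum_(x <- [seq x <- a | x \in b]) F x.
  move=> h; rewrite big_filter (bigID (fun x => x \in b)) /=.
  by rewrite [X in _ + X]big1_seq ?addr0 // => x /andP[xb xa]; exact: h.
rewrite (restrict s t) // (restrict t s) //; apply: perm_big; apply: uniq_perm.
- exact: filter_uniq.
- exact: filter_uniq.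
- by move=> x; rewrite !mem_filter andbC.
Qed.

Section Clifford.
Local Open Scope fset_scope.
Local Open Scope ring_scope.
Variable K : numClosedFieldType.

(** The basis vectors are the finite sets of excited modes, a mode being encoded
    by a natural number; all functions on the basis are allowed, so that no
    operator below needs a finiteness proof to be defined. *)
Definition fock := {fset nat} -> K^o.
HB.instance Definition _ := GRing.Lmodule.on fock.

Implicit Types (phi chi : fock) (S T : {fset nat}).

Definition csgn (b a : nat) : K := if (b < a)%N then -1 else 1.
Definition fsgn (S : {fset nat}) (a : nat) : K := \prod_(b <- S) csgn b a.

Lemma csgn_sq a b : csgn a b * csgn a b = 1.
Proof. by rewrite /csgn; case: ifP; rewrite ?mulrNN mul1r. Qed.

Lemma fsgn_rem S a b : b \in S -> fsgn S a = csgn b a * fsgn (S `\ b) a.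
Proof. by move=> bS; rewrite /fsgn (big_fsetD1 b). Qed.

Lemma fsgn_add S a b : b \notin S -> fsgn (b |` S) a = csgn b a * fsgn S a.
Proof. by move=> bS; rewrite (fsgn_rem _ (fset1U1 b S)) fsetU1K. Qed.

Lemma csgnxx a : csgn a a = 1. Proof. by rewrite /csgn ltnn. Qed.

Lemma fsgn_sq S a : fsgn S a * fsgn S a = 1.
Proof.
by rewrite /fsgn -big_split /=; apply: big1 => b _; exact: csgn_sq.
Qed.

(** Exterior multiplication ([b = true]) and contraction ([b = false]) by the
    a-th generator, treated together because the occupied sea exchanges their
    roles for half of the modes. *)
Definition op (b : bool) (a : nat) (phi : fock) : fock := fun S =>
  if b then (if a \in S then fsgn S a * phi (S `\ a) else 0)
  else (if a \in S then 0 else fsgn S a * phi (a |` S)).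

Fact op_linear b a : linear (op b a).
Proof.
move=> c phi chi; apply/funext => S; rewrite /op !fctE.
by case: b; case: ifP => _; rewrite ?scaler0 ?addr0 // mulrDr mulrCA.
Qed.

HB.instance Definition _ b a :=
  GRing.isLinear.Build K fock fock *:%R (op b a) (op_linear b a).

Lemma fsetD1C S a b : S `\ a `\ b = S `\ b `\ a.
Proof. by rewrite !fsetDDl fsetUC. Qed.

Lemma fsetU1C S a b : a |` (b |` S) = b |` (a |` S).
Proof. by rewrite !fsetUA (fsetUC [fset a]). Qed.

Lemma fsetU1D1 S a b : a != b -> (a |` S) `\ b = a |` (S `\ b).
Proof.
move=> ab; apply/fsetP => x; rewrite !inE.
by have [->|] := eqVneq x a; rewrite ?ab ?orbT //= andbT.
Qed.

Lemma op_same b a phi : op b a (op b a phi) = 0.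
Proof.
apply/funext => S; rewrite /op; case: b.
  by case: ifP => // aS; rewrite !inE eqxx mulr0.
by case: ifP => // aS; rewrite !inE eqxx mulr0.
Qed.

Lemma op_diff b b' a a' phi : a != a' ->
  op b a (op b' a' phi) + op b' a' (op b a phi) = 0.
Proof.
move=> aa'; have a'a : a' != a by rewrite eq_sym.
apply/funext => S; rewrite -[LHS]/(_ + _) -[RHS]/(0 : K) /op.
have cc : (csgn a a' = 1 /\ csgn a' a = -1) \/ (csgn a a' = -1 /\ csgn a' a = 1).
  by move: aa'; rewrite /csgn; case: ltngtP => // _ _; [right|left].
case: b; case: b'; have [aS|aS] := boolP (a \in S);
  have [a'S|a'S] := boolP (a' \in S);
  rewrite ?inE ?(negbTE aa') ?(negbTE a'a) ?aS ?a'S ?(negbTE aS) ?(negbTE a'S)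
    /= ?mulr0 ?addr0 //.
- rewrite fsetD1C (fsgn_rem _ a'S) (fsgn_rem a' aS).
  by case: cc => -[-> ->]; ring.
- rewrite fsetU1D1 // (fsgn_add a a'S) (fsgn_rem a' aS).
  by case: cc => -[-> ->]; ring.
- rewrite fsetU1D1 // (fsgn_add a' aS) (fsgn_rem a a'S).
  by case: cc => -[-> ->]; ring.
- rewrite fsetU1C (fsgn_add a a'S) (fsgn_add a' aS).
  by case: cc => -[-> ->]; ring.
Qed.

Lemma op_compl b a phi : op b a (op (~~ b) a phi) + op (~~ b) a (op b a phi) = phi.
Proof.
apply/funext => S; rewrite -[LHS]/(_ + _) /op.
case: b => /=; have [aS|aS] := boolP (a \in S);
  rewrite ?inE ?eqxx ?aS ?(negbTE aS) /= ?mulr0 ?addr0 ?add0r.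
- by rewrite fsetD1K // mulrA (fsgn_rem a aS) csgnxx mul1r fsgn_sq mul1r.
- by rewrite fsetU1K // mulrA (fsgn_add a aS) csgnxx mul1r fsgn_sq mul1r.
- by rewrite fsetD1K // mulrA (fsgn_rem a aS) csgnxx mul1r fsgn_sq mul1r.
- by rewrite fsetU1K // mulrA (fsgn_add a aS) csgnxx mul1r fsgn_sq mul1r.
Qed.

Lemma op_car b b' a a' phi : op b a (op b' a' phi) =
  ((a == a') && (b != b'))%:R *: phi - op b' a' (op b a phi).
Proof.
have [<-|aa'] := eqVneq a a'; last first.
  by rewrite scale0r sub0r; apply/eqP; rewrite -addr_eq0 op_diff.
have [<-|bb'] := eqVneq b b'; first by rewrite op_same scale0r subr0.
have -> : b' = ~~ b by case: b b' bb' => -[].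
by rewrite scale1r -[phi in phi - _](op_compl b a) addrK.
Qed.

(** ** The Hermitian form *)

Definition dlt S : fock := fun T => (T == S)%:R.

(** [dual phi l]: phi is a finite combination of basis vectors and l is the
    linear form (phi, -), for the Hermitian form making the basis
    orthonormal. *)
Definition dual (phi : fock) (l : fock -> K) : Prop :=
  exists2 s : seq (K * {fset nat}), phi = \sum_(p <- s) p.1 *: dlt p.2 &
    forall chi, l chi = \sum_(p <- s) (p.1)^* * chi p.2.

Lemma dual_ext phi l l' : l =1 l' -> dual phi l -> dual phi l'.
Proof. by move=> ll' [s -> hl]; exists s => // chi; rewrite -ll'. Qed.

Lemma dual0 : dual 0 (fun=> 0).
Proof. by exists [::]; rewrite ?big_nil // => chi; rewrite big_nil. Qed.

Lemma dual_lin a phi l phi' l' : dual phi l -> dual phi' l' ->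
  dual (a *: phi + phi') (fun chi => a^* * l chi + l' chi).
Proof.
move=> [s -> hl] [s' -> hl']; exists ([seq (a * p.1, p.2) | p <- s] ++ s').
  rewrite big_cat big_map scaler_sumr; congr (_ + _); apply: eq_bigr => p _.
  by rewrite scalerA.
move=> chi; rewrite hl hl' big_cat big_map mulr_sumr; congr (_ + _).
by apply: eq_bigr => p _; rewrite rmorphM mulrA.
Qed.

Lemma dual_sum (I : Type) (r : seq I) (c : I -> K) (F : I -> fock) L :
  (forall x, dual (F x) (L x)) ->
  dual (\sum_(x <- r) c x *: F x) (fun chi => \sum_(x <- r) (c x)^* * L x chi).
Proof.
move=> h; elim: r => [|x r IH].
  by rewrite big_nil; apply: dual_ext dual0 => chi; rewrite big_nil.
rewrite big_cons; apply: dual_ext (dual_lin (c x) (h x) IH) => chi.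
by rewrite big_cons.
Qed.

Lemma dual_linear phi l : dual phi l ->
  forall a chi chi', l (a *: chi + chi') = a * l chi + l chi'.
Proof.
move=> [s _ hl] a chi chi'; rewrite !hl mulr_sumr -big_split.
by apply: eq_bigr => p _; rewrite fctE /= mulrDr mulrCA.
Qed.

Lemma op_dlt b a S : exists c S', [/\ c^* = c, op b a (dlt S) = c *: dlt S' &
  forall chi, op (~~ b) a chi S = c * chi S'].
Proof.
have sR T : (fsgn T a)^* = fsgn T a.
  rewrite /fsgn rmorph_prod; apply: eq_bigr => x _; rewrite /csgn.
  by case: ifP => _; rewrite ?rmorphN rmorph1.
case: b; have [aS|aS] := boolP (a \in S).
- exists 0, S; split; first exact: rmorph0.
    rewrite scale0r; apply/funext => T; rewrite /op; case: ifP => // aT.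
    rewrite /dlt; case: eqP => [TS|_]; last exact: mulr0.
    by move: aS; rewrite -TS !inE eqxx.
  by move=> chi; rewrite /= /op aS mul0r.
- exists (fsgn S a), (a |` S); split; rewrite ?sR //; last first.
    by move=> chi; rewrite /= /op (negbTE aS).
  apply/funext => T; rewrite fctE /op /dlt -[RHS]/(_ * _).
  have [aT|aT] := boolP (a \in T); last first.
    by case: eqP => [TS|_]; rewrite ?mulr0 //; move: aT; rewrite TS !inE eqxx.
  have -> : (T == a |` S) = (T `\ a == S).
    by apply/eqP/eqP => [->|<-]; rewrite ?fsetU1K ?fsetD1K.
  by case: eqP => [<-|_]; rewrite ?mulr0 // (fsgn_rem _ aT) csgnxx mul1r.
- exists (fsgn S a), (S `\ a); split; rewrite ?sR //; last first.
    by move=> chi; rewrite /= /op aS.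
  apply/funext => T; rewrite fctE /op /dlt -[RHS]/(_ * _).
  have [aT|aT] := boolP (a \in T).
    by case: eqP => [TS|_]; rewrite ?mulr0 //; move: aT; rewrite TS !inE eqxx.
  have -> : (T == S `\ a) = (a |` T == S).
    by apply/eqP/eqP => [->|<-]; rewrite ?fsetU1K ?fsetD1K.
  by case: eqP => [<-|_]; rewrite ?mulr0 // (fsgn_add _ aT) csgnxx mul1r.
- exists 0, S; split; first exact: rmorph0.
    rewrite scale0r; apply/funext => T; rewrite /op; case: ifP => // aT.
    rewrite /dlt; case: eqP => [TS|_]; last exact: mulr0.
    by move: aS; rewrite -TS !inE eqxx.
  by move=> chi; rewrite /= /op (negbTE aS) mul0r.
Qed.

Lemma dual_op b a phi l : dual phi l ->
  dual (op b a phi) (fun chi => l (op (~~ b) a chi)).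
Proof.
move=> [s -> hl]; rewrite linear_sum.
pose c S := projT1 (cid (op_dlt b a S)).
pose S' S := projT1 (cid (projT2 (cid (op_dlt b a S)))).
have cP S : [/\ (c S)^* = c S, op b a (dlt S) = c S *: dlt (S' S) &
    forall chi, op (~~ b) a chi S = c S * chi (S' S)].
  exact: (projT2 (cid (projT2 (cid (op_dlt b a S))))).
exists [seq (p.1 * c p.2, S' p.2) | p <- s].
  rewrite big_map; apply: eq_bigr => p _.
  by have [_ h _] := cP p.2; rewrite linearZ /= h scalerA.
move=> chi; rewrite hl big_map; apply: eq_bigr => p _.
by have [h1 _ h2] := cP p.2; rewrite h2 rmorphM /= h1 mulrA.
Qed.

(** Positivity: l phi is the sum of the squared moduli of the coordinates. *)
Lemma dual_pos phi l : dual phi l -> l phi = 0 -> phi = 0.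
Proof.
move=> [s phiE lE] l0.
have phiS T : phi T = \sum_(p <- s | p.2 == T) p.1.
  rewrite phiE; elim: (s) => [|p s' IH]; first by rewrite !big_nil.
  rewrite !big_cons fctE IH /dlt fctE -[_ *: _]/(_ * _) eq_sym.
  by case: eqP; rewrite ?mulr1 ?mulr0 ?add0r.
pose U := undup (map snd s).
have norm : \sum_(T <- U) `|phi T| ^+ 2 = 0.
  rewrite -[RHS]l0 lE.
  transitivity (\sum_(T <- U) \sum_(p <- s | p.2 == T) (p.1)^* * phi p.2).
    apply: eq_bigr => T _; rewrite normCKC {1}phiS rmorph_sum mulr_suml.
    by apply: eq_bigr => p /eqP ->.
  rewrite (exchange_big_dep xpredT) //=; apply: eq_big_seq => p ps.
  rewrite big_mkcond (bigD1_seq p.2) ?undup_uniq ?mem_undup ?map_f //= eqxx.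
  by rewrite big1 ?addr0 // => T; rewrite eq_sym => /negbTE ->.
apply/funext => T; have [TU|TU] := boolP (T \in U).
  have := norm; rewrite (bigD1_seq T) ?undup_uniq //= => /eqP.
  rewrite paddr_eq0 ?exprn_ge0 // ?sumr_ge0 // => [/andP[+ _]|T' _]; last first.
    by rewrite exprn_ge0.
  by rewrite expf_eq0 normr_eq0 => /= /eqP.
rewrite phiS big1_seq // => p /andP[/eqP pT ps].
by move: TU; rewrite mem_undup -pT map_f.
Qed.

End Clifford.

(** ** Currents *)

Section Currents.
Local Open Scope fset_scope.
Local Open Scope ring_scope.
Variables (K : numClosedFieldType) (k : nat).
Local Notation fock := (fock K).
Implicit Types (phi chi : fock) (S T : {fset nat}).

(** The fermion modes: a sign (true for the first basis vector of C^2), one of k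
    colours, and an energy.  The Dirac sea of the negative energies is occupied
    in the vacuum. *)
Definition mode : Type := (bool * 'I_k * int)%type.
HB.instance Definition _ := Countable.on mode.
Implicit Types x y : mode.

Definition energy (a : nat) : nat :=
  if (choice.unpickle a : option mode) is Some x then `|x.2|%N else 0%N.

Definition bd (S : {fset nat}) : nat := \max_(a <- S) (energy a).+1.

Definition psi x : fock -> fock := op (0 <= x.2) (choice.pickle x).
Definition psid x : fock -> fock := op (~~ (0 <= x.2)) (choice.pickle x).

HB.instance Definition _ x := GRing.Linear.on (psi x).
HB.instance Definition _ x := GRing.Linear.on (psid x).

Lemma energy_pickle x : energy (choice.pickle x) = `|x.2|%N.
Proof. by rewrite /energy choice.pickleK. Qed.

Lemma bdP S x : (bd S <= `|x.2|)%N -> choice.pickle x \notin S.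
Proof.
move=> le; apply/negP => xS; move: le; rewrite /bd (big_fsetD1 _ xS) /=.
by rewrite energy_pickle geq_max ltnn.
Qed.

Lemma bd_rem S a : (bd (S `\ a)%fset <= bd S)%N.
Proof.
have [aS|/mem_fsetD1 ->//] := boolP (a \in S).
by rewrite [leqRHS]/bd (big_fsetD1 _ aS) leq_maxr.
Qed.

Lemma bd_add S a : (bd (a |` S)%fset <= maxn (energy a).+1 (bd S))%N.
Proof.
have [aS|aS] := boolP (a \in S).
  by rewrite (fsetUidPr _ _ _) ?leq_maxr // fsub1set.
by rewrite [leqLHS]/bd big_fsetU1.
Qed.

(** Inside another operator, an infinite sum of modes may therefore be replaced by
    a finite one. *)
Lemma op_local B b a phi chi : (energy a < B)%N ->
  (forall T, (bd T <= B)%N -> phi T = chi T) ->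
  forall T, (bd T <= B)%N -> op b a phi T = op b a chi T.
Proof.
move=> aB h T TB; rewrite /op; case: b; case: ifP => // _; rewrite h //.
  exact: leq_trans (bd_rem _ _) TB.
by apply: leq_trans (bd_add _ _) _; rewrite geq_max aB TB.
Qed.

Lemma psi_car x y phi : psi x (psi y phi) = - psi y (psi x phi).
Proof.
rewrite /psi op_car [_ == _]inj_eq; last exact: pcan_inj choice.pickleK.
by have [->|_] := eqVneq x y; rewrite ?eqxx /= scale0r sub0r.
Qed.

Lemma psid_car x y phi : psid x (psid y phi) = - psid y (psid x phi).
Proof.
rewrite /psid op_car [_ == _]inj_eq; last exact: pcan_inj choice.pickleK.
by have [->|_] := eqVneq x y; rewrite ?eqxx /= scale0r sub0r.
Qed.

Lemma psi_psid x y phi : psi x (psid y phi) = (x == y)%:R *: phi - psid y (psi x phi).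
Proof.
rewrite /psi /psid op_car [_ == _]inj_eq; last exact: pcan_inj choice.pickleK.
have [->|_] := eqVneq x y; last by [].
by case: (0 <= y.2).
Qed.

Lemma psid_psi x y phi : psid x (psi y phi) = (x == y)%:R *: phi - psi y (psid x phi).
Proof. by rewrite psi_psid eq_sym opprB addrC subrK. Qed.

Definition win (N : nat) : seq mode :=
  [seq (sc, j%:Z - N%:Z) | sc <- enum {: bool * 'I_k}, j <- iota 0 (N + N)].

Lemma win_uniq N : uniq (win N).
Proof.
apply: allpairs_uniq; [exact: enum_uniq|exact: iota_uniq|].
by move=> [a i] [b j] _ _ [-> /(addIr _) [->]].
Qed.

Lemma mem_win N x : (x \in win N) = (- N%:Z <= x.2 < N%:Z).
Proof.
apply/allpairsP/idP => [[[sc j] /= [_ + ->]]|h]; first by rewrite mem_iota /=; lia.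
exists (x.1, absz (x.2 + N%:Z)); split; first exact: mem_enum.
  by rewrite mem_iota /=; lia.
by case: x h => a p /= h; congr pair; lia.
Qed.

Definition tau (g : bool) (m : int) x : mode := (x.1.1 (+) g, x.1.2, x.2 + m).

Lemma tauA g m g' m' x : tau g' m' (tau g m x) = tau (g (+) g') (m + m') x.
Proof. by rewrite /tau /= addbA addrA. Qed.

Lemma tauC g m g' m' x : tau g' m' (tau g m x) = tau g m (tau g' m' x).
Proof. by rewrite !tauA addbC addrC. Qed.

Lemma tau0 x : tau false 0 x = x.
Proof. by case: x => -[s c] p; rewrite /tau /= addbF addr0. Qed.

Lemma tauK g m : cancel (tau g m) (tau g (- m)).
Proof. by move=> x; rewrite tauA addbb subrr tau0. Qed.

Lemma tau_inj g m : injective (tau g m).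
Proof. exact: can_inj (tauK g m). Qed.

Lemma tau_id g m x : (tau g m x == x) = ~~ g && (m == 0).
Proof.
case: x => -[s c] p; rewrite /tau /= !xpair_eqE eqxx andbT.
have -> : (p + m == p) = (m == 0) by rewrite -subr_eq0 (addrC p) addrK.
by case: s; case: g.
Qed.

(** The normal-ordering constant: the vacuum expectation of
    psi_x psi^*_{tau x}. *)
Definition cst (g : bool) (m : int) x : K := (~~ g && (m == 0) && (x.2 < 0))%:R.

(** The normally ordered product of psi_x and psi^*_{tau x}. *)
Definition nop (g : bool) (m : int) x phi : fock := psi x (psid (tau g m x) phi) - cst g m x *: phi.

Fact nop_linear g m x : linear (nop g m x).
Proof.
move=> a phi chi; by rewrite /nop !linearP /= [in RHS]scalerDr addrACA.
Qed.

HB.instance Definition _ g m x :=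
  GRing.isLinear.Build K fock fock *:%R (nop g m x) (nop_linear g m x).

Lemma nop_vanish g m x phi S : x \notin win (bd S + `|m|) -> nop g m x phi S = 0.
Proof.
rewrite mem_win => xw; rewrite /nop -[LHS]/(_ - cst _ _ _ * _).
have [x0|x0] := leP 0 x.2.
  rewrite /cst ltNge x0 andbF mul0r subr0 /psi x0 /op (negbTE (bdP _)) //.
  by move: xw; lia.
have xS : choice.pickle x \notin S by apply: bdP; lia.
rewrite /psi leNgt x0 /= (negbTE xS) /psid.
have -> : (0 <= (tau g m x).2) = false by rewrite /=; lia.
rewrite /=.
have yS : choice.pickle (tau g m x) \notin S by apply: bdP; rewrite /=; lia.
rewrite in_fset1U (negbTE yS) orbF inj_eq; last exact: pcan_inj choice.pickleK.
rewrite tau_id /cst x0 andbT; case: ifP => [e|_]; last by rewrite mulr0 mul0r subr0.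
have -> : tau g m x = x by apply/eqP; rewrite tau_id.
rewrite fsetU1K // mulrA (fsgn_add _ _ xS) csgnxx mul1r fsgn_sq.
by rewrite subrr.
Qed.

(** The sum over all modes x of alpha(x) :psi_x psi^*_{tau x}:, of which only
    finitely many terms contribute to the value at a given S. *)
Definition rho g m (alpha : mode -> K) phi : fock := fun S =>
  \sum_(x <- win (bd S + `|m|)) alpha x * nop g m x phi S.

Lemma rho_win N g m alpha phi S : (bd S + `|m| <= N)%N ->
  rho g m alpha phi S = \sum_(x <- win N) alpha x * nop g m x phi S.
Proof.
move=> le; apply: big_support; rewrite ?win_uniq //.
  by move=> x; rewrite !mem_win; lia.
by move=> x _ xw; rewrite nop_vanish ?mulr0.
Qed.

Fact rho_linear g m alpha : linear (rho g m alpha).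
Proof.
move=> a phi chi; apply/funext => S; rewrite !fctE /rho -[_ *: _]/(_ * _).
rewrite mulr_sumr -big_split; apply: eq_bigr => x _ /=.
rewrite linearP -[X in alpha x * X]/(a * nop g m x phi S + nop g m x chi S).
by rewrite mulrDr mulrCA.
Qed.

HB.instance Definition _ g m alpha :=
  GRing.isLinear.Build K fock fock *:%R (rho g m alpha) (rho_linear g m alpha).

Lemma rhoZ c g m alpha phi : rho g m (fun x => c * alpha x) phi = c *: rho g m alpha phi.
Proof.
apply/funext => S; rewrite fctE /rho -[RHS]/(_ * _) mulr_sumr.
by apply: eq_bigr => x _; rewrite mulrA.
Qed.

Lemma rho_eq g m alpha beta phi : alpha =1 beta -> rho g m alpha phi = rho g m beta phi.
Proof.
by move=> ab; apply/funext => S; apply: eq_bigr => x _; rewrite ab.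
Qed.

Lemma nop_local B g m x phi chi : (`|x.2| + `|m| < B)%N ->
  (forall T, (bd T <= B)%N -> phi T = chi T) ->
  forall T, (bd T <= B)%N -> nop g m x phi T = nop g m x chi T.
Proof.
move=> xB h T TB; rewrite /nop.
transitivity (psi x (psid (tau g m x) chi) T - cst g m x * phi T); last by rewrite h.
congr (_ - _); apply: (@op_local B) => //; first by rewrite energy_pickle; lia.
by apply: op_local => //; rewrite energy_pickle /=; lia.
Qed.

Lemma sum_fct (I : Type) (r : seq I) (F : I -> fock) S :
  (\sum_(x <- r) F x) S = \sum_(x <- r) F x S.
Proof. by elim: r => [|x r IH]; rewrite ?big_nil // !big_cons -IH. Qed.

Lemma rho_rho g m alpha g' m' alpha' phi S : exists N0, forall N, (N0 <= N)%N ->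
  rho g m alpha (rho g' m' alpha' phi) S =
  \sum_(x <- win N) \sum_(y <- win N)
    alpha x * alpha' y * nop g m x (nop g' m' y phi) S.
Proof.
pose N1 := (bd S + `|m|)%N; pose B := (N1 + `|m|).+1.
exists (B + `|m'|)%N => N BN.
pose chi : fock := \sum_(y <- win N) alpha' y *: nop g' m' y phi.
have agree T : (bd T <= B)%N -> rho g' m' alpha' phi T = chi T.
  move=> TB; rewrite (@rho_win N); last by lia.
  by rewrite /chi sum_fct.
transitivity (rho g m alpha chi S).
  rewrite -[LHS]/(\sum_(x <- win N1)
    alpha x * nop g m x (rho g' m' alpha' phi) S).
  apply: eq_big_seq => x; rewrite mem_win => xw; congr (_ * _).
  have xB : (`|x.2| + `|m| < B)%N by rewrite /B; lia.
  by apply: (@nop_local B g m x _ chi xB agree S); rewrite /B /N1; lia.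
rewrite (@rho_win N); last by rewrite /B /N1 in BN; lia.
apply: eq_bigr => x _; rewrite /chi linear_sum sum_fct mulr_sumr.
by apply: eq_bigr => y _; rewrite linearZ /= fctE -[_ *: _]/(_ * _) mulrA.
Qed.

Lemma nop_comm g m x g' m' y phi :
  nop g m x (nop g' m' y phi) - nop g' m' y (nop g m x phi) =
  (tau g m x == y)%:R *: psi x (psid (tau g' m' y) phi)
  - (x == tau g' m' y)%:R *: psi y (psid (tau g m x) phi).
Proof.
have lin z w c p q : psi z (psid w (p - c *: q)) =
    psi z (psid w p) - c *: psi z (psid w q) :> fock.
  by rewrite linearB linearZ linearB linearZ.
rewrite /nop !lin.
set x' := tau g m x; set y' := tau g' m' y; set a := cst _ _ _; set b := cst _ _ _.
have -> : psi x (psid x' (psi y (psid y' phi))) =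
    (x' == y)%:R *: psi x (psid y' phi) - (x == y')%:R *: psi y (psid x' phi)
    + psi y (psid y' (psi x (psid x' phi))).
  rewrite psid_psi linearB linearZ /= -addrA; congr (_ + _).
  rewrite psi_car opprK psid_car linearN /= psi_psid linearN linearB linearZ /=.
  by rewrite opprB addrC.
move: (psi y (psid y' (psi x _))) (psi x (psid y' phi)) (psi y (psid x' phi)).
move: (psi x (psid x' phi)) (psi y (psid y' phi)) => p q r s t.
apply/funext => S; rewrite !fctE.
rewrite -![_ *: _]/(_ * _).
ring.
Qed.


Lemma sum_pick (s : seq mode) z (F : mode -> K) : uniq s ->
  \sum_(y <- s) (z == y)%:R * F y = (z \in s)%:R * F z.
Proof.
move=> us; have [zs|zs] := boolP (z \in s).
  rewrite (bigD1_seq z) //= eqxx big1 ?addr0 // => y.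
  by rewrite eq_sym => /negbTE ->; rewrite mul0r.
rewrite mul0r big1_seq // => y /= ys; case: eqP => [zy|_]; last exact: mul0r.
by move: zs; rewrite zy ys.
Qed.

Section Commutator.
Variables (g : bool) (m : int) (alpha : mode -> K).
Variables (g' : bool) (m' : int) (alpha' : mode -> K).

(** The normal-ordering constants left over by the commutator of two currents.
    The two halves have to be cut off at energy N separately: each grows with N,
    and their difference stabilizes at the central term. *)
Definition anomaly N : K := \sum_(x <- win N) cst (g (+) g') (m + m') x *
  ((tau g m x \in win N)%:R * (alpha x * alpha' (tau g m x))
   - (tau g' m' x \in win N)%:R * (alpha' x * alpha (tau g' m' x))).

(** Each current is a normally ordered bilinear expression, so the commutator is
    again one, up to a scalar; for N large the modes beyond N do not contribute at
    S. *)
Lemma rho_comm phi S : exists N0, forall N, (N0 <= N)%N ->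
  rho g m alpha (rho g' m' alpha' phi) S - rho g' m' alpha' (rho g m alpha phi) S =
  rho (g (+) g') (m + m')
    (fun x => alpha x * alpha' (tau g m x) - alpha' x * alpha (tau g' m' x)) phi S
  + anomaly N * phi S.
Proof.
have [N1 h1] := rho_rho g m alpha g' m' alpha' phi S.
have [N2 h2] := rho_rho g' m' alpha' g m alpha phi S.
exists (maxn (maxn N1 N2) (bd S + `|m| + `|m'| + `|m| + `|m'|)%N) => N.
rewrite !geq_max -andbA => /and3P[le1 le2 le3].
rewrite (h1 N le1) (h2 N le2) [X in _ - X]exchange_big -sumrB.
pose P x := psi x (psid (tau (g (+) g') (m + m') x) phi) S.
have P1 x : psi x (psid (tau g' m' (tau g m x)) phi) S = P x by rewrite tauA.
have P2 x : psi x (psid (tau g m (tau g' m' x)) phi) S = P x.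
  by rewrite tauC tauA.
transitivity (\sum_(x <- win N) \sum_(y <- win N)
    ((tau g m x == y)%:R * (alpha x * alpha' y *
        psi x (psid (tau g' m' y) phi) S)
     - (tau g' m' y == x)%:R * (alpha x * alpha' y *
        psi y (psid (tau g m x) phi) S))).
  apply: eq_bigr => x _; rewrite -sumrB; apply: eq_bigr => y _.
  rewrite (mulrC (alpha' y)) -mulrBr.
  rewrite -[X in _ * X]/((nop g m x (nop g' m' y phi) -
    nop g' m' y (nop g m x phi)) S) nop_comm.
  rewrite -[X in _ * X]/((tau g m x == y)%:R * _ - (x == tau g' m' y)%:R * _).
  by rewrite (eq_sym x) mulrBr !(mulrCA (alpha x * _)).
under eq_bigr do rewrite sumrB sum_pick ?win_uniq // P1.
rewrite sumrB [X in _ - X]exchange_big /=.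
under [X in _ - X]eq_bigr do rewrite sum_pick ?win_uniq // P2.
rewrite -sumrB (@rho_win N); last by lia.
rewrite /anomaly mulr_suml -big_split; apply: eq_big_seq => x xw /=.
have PE : P x = nop (g (+) g') (m + m') x phi S
    + cst (g (+) g') (m + m') x * phi S.
  by rewrite /nop -[X in X + _]/(P x - cst _ _ _ * phi S) subrK.
rewrite PE; have [xb|/nop_vanish ->] := boolP (x \in win (bd S + `|(m + m')%R|)).
  have -> : tau g m x \in win N by move: xb; rewrite !mem_win /=; lia.
  have -> : tau g' m' x \in win N by move: xb; rewrite !mem_win /=; lia.
  by rewrite (mulrC (alpha _) (alpha' x)) /=; ring.
by rewrite mulr0 !add0r (mulrC (alpha _) (alpha' x)); ring.
Qed.

End Commutator.

(** The anomaly comes from the contraction of a mode with itself only. *)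
Lemma rho_comm0 g m alpha g' m' alpha' phi : (g (+) g') || (m + m' != 0) ->
  rho g m alpha (rho g' m' alpha' phi) = rho g' m' alpha' (rho g m alpha phi)
  + rho (g (+) g') (m + m')
    (fun x => alpha x * alpha' (tau g m x) - alpha' x * alpha (tau g' m' x)) phi.
Proof.
move=> h; apply/funext => S; apply/eqP.
have [N0 /(_ _ (leqnn _))/eqP] := rho_comm g m alpha g' m' alpha' phi S.
rewrite subr_eq /anomaly big1 => [|x _]; last first.
  rewrite /cst (_ : _ && _ = false) ?mul0r //.
  by move: h; case: (g (+) g') => //= /negbTE ->.
by rewrite mul0r addr0 addrC.
Qed.

Lemma rho_psi g m alpha y phi : rho g m alpha (psi y phi) =
  psi y (rho g m alpha phi) + alpha (tau g (- m) y) *: psi (tau g (- m) y) phi.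
Proof.
apply/funext => S; pose B := (bd S + `|y.2|).+1.
pose N := (B + `|m| + `|m|)%N; set y' := tau g (- m) y.
have yy' : tau g m y' = y by rewrite /y' -{1}(opprK m) tauK.
have -> : (psi y (rho g m alpha phi) + alpha y' *: psi y' phi) S =
    \sum_(x <- win N) alpha x * psi y (nop g m x phi) S + alpha y' * psi y' phi S.
  congr (_ + _); pose chi : fock := \sum_(x <- win N) alpha x *: nop g m x phi.
  transitivity (psi y chi S).
    apply: (@op_local B); rewrite ?energy_pickle /B; [lia| |lia].
    move=> T TB; rewrite (@rho_win N) /chi ?sum_fct //.
    by rewrite /N /B; lia.
  rewrite /chi linear_sum sum_fct; apply: eq_bigr => x _.
  by rewrite linearZ.
rewrite (@rho_win N); last by rewrite /N /B; lia.
transitivity (\sum_(x <- win N) (alpha x * psi y (nop g m x phi) S +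
    (y' == x)%:R * (alpha x * psi x phi S))).
  apply: eq_bigr => x _; rewrite -(inj_eq (@tau_inj g m)) yy' eq_sym.
  rewrite mulrCA -mulrDr; congr (_ * _).
  have lin z c p q : psi z (p - c *: q) = psi z p - c *: psi z q :> fock.
    by rewrite linearB linearZ.
  have lin' z c p q : psi z (c *: p - q) = c *: psi z p - psi z q :> fock.
    by rewrite linearB linearZ.
  rewrite /nop psid_psi lin' psi_car opprK lin; by rewrite -addrA addrC.
rewrite big_split /= sum_pick ?win_uniq //.
have -> : y' \in win N by rewrite mem_win /y' /N /B /=; lia.
by rewrite mul1r.
Qed.

(** ** The vacuum vectors *)

Definition vac : fock := fun S => (S == fset0)%:R.

Lemma iota_vac a : op false a vac = 0.
Proof.
apply/funext => S; rewrite /op; case: ifP => // _.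
rewrite /vac (_ : _ == _ = false) ?mulr0 //; apply/negbTE.
by apply/fset0Pn; exists a; rewrite fset1U1.
Qed.

Lemma psi_vac x : x.2 < 0 -> psi x vac = 0.
Proof. by move=> x0; rewrite /psi leNgt x0 iota_vac. Qed.

Lemma psid_vac x : 0 <= x.2 -> psid x vac = 0.
Proof. by move=> x0; rewrite /psid x0 iota_vac. Qed.

Lemma rho_vac g m alpha : (forall x, 0 <= x.2 -> x.2 + m < 0 -> alpha x = 0) ->
  rho g m alpha vac = 0.
Proof.
move=> h; apply/funext => S; apply: big1 => x _.
suff -> : alpha x * nop g m x vac S = (alpha x *: nop g m x vac) S.
  have [y0|y0] := leP 0 (x.2 + m).
    rewrite /nop psid_vac // linear0 /cst (_ : _ && _ = false).
      by rewrite scale0r subr0 scaler0.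
    by apply/negP => /andP[/andP[_ /eqP m0]]; lia.
  have [x0|x0] := leP 0 x.2; first by rewrite h // scale0r.
  rewrite /nop psi_psid psi_vac // linear0 subr0 eq_sym tau_id /cst x0 andbT.
  by rewrite subrr scaler0.
by [].
Qed.

Definition theta (c : 'I_k) : fock -> fock := psi (true, c, 0).
HB.instance Definition _ c := GRing.Linear.on (theta c).

(** Filling the modes (+, c, 0) for the colours c of s. *)
Definition top_vec (s : seq 'I_k) : fock := foldr theta vac s.

Lemma top_vec_neq0 s : uniq s -> top_vec s != 0.
Proof.
elim: s => [_|c s IH /= /andP[cs us]].
  apply/eqP => /(congr1 (fun phi : fock => phi fset0)) /eqP.
  by rewrite /= /vac eqxx; apply/negP/oner_neq0.
have top0 t : c \notin t -> psid (true, c, 0) (top_vec t) = 0.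
  elim: t => [|d t IHt]; first by move=> _; rewrite /= psid_vac.
  rewrite inE negb_or => /andP[cd ct] /=.
  rewrite /theta psid_psi IHt // linear0 subr0 !xpair_eqE (negbTE cd) /=.
  exact: scale0r.
apply: contraNN (IH us) => /eqP h.
have := psid_psi (true, c, 0) (true, c, 0) (top_vec s).
by rewrite -/(theta c _) h linear0 eqxx scale1r top0 // linear0 subr0 => <-.
Qed.

End Currents.

Section FockModule.
Variables (K : numClosedFieldType) (k : nat).
Local Notation fock := (fock K).
Local Notation mode := (mode k).
Local Notation win := (@win k).
Implicit Types (phi chi : fock) (x y : mode).

Lemma rho_commE g m (alpha : mode -> K) g' m' alpha' c phi :
  (exists N0, forall N, (N0 <= N)%N -> anomaly g m alpha g' m' alpha' N = c) ->
  rho g m alpha (rho g' m' alpha' phi) = rho g' m' alpha' (rho g m alpha phi)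
  + rho (g (+) g') (m + m')
    (fun x => alpha x * alpha' (tau g m x) - alpha' x * alpha (tau g' m' x)) phi
  + c *: phi.
Proof.
move=> [N1 h1]; apply/funext => S; apply/eqP.
have [N0 h0] := rho_comm g m alpha g' m' alpha' phi S.
have /eqP := h0 _ (leq_maxl N0 N1); rewrite h1 ?leq_maxr // subr_eq.
by rewrite addrC addrA.
Qed.

Lemma count_iota lo N M : (N <= M)%N ->
  count (fun j => lo <= j < N)%N (iota 0 M) = (N - lo)%N.
Proof.
move=> NM; rewrite -size_filter -[RHS](size_iota lo); apply: perm_size.
apply: uniq_perm; rewrite ?filter_uniq ?iota_uniq // => j.
by rewrite mem_filter !mem_iota; lia.
Qed.

(** The occupied energies p, -N <= p < 0, for which p + m is still within the
    cutoff: all N of them if m >= 0, while the |m| lowest are lost if m < 0. *)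
Lemma sea_count (m : int) N : (`|m| <= N)%N ->
  \sum_(j <- iota 0 (N + N))
     ((j%:Z - N%:Z < 0) && (- N%:Z <= j%:Z - N%:Z + m < N%:Z))%R%:R
  = N%:R - (if 0 <= m then 0%N else absz m)%:R :> K.
Proof.
move=> mN; set lo := (if _ then _ else _).
transitivity ((count (fun j => lo <= j < N)%N (iota 0 (N + N)))%:R : K); last first.
  rewrite count_iota ?leq_addr // natrB // /lo; case: ifP => // _; lia.
rewrite -sum1_count -natr_sum; congr (_%:R); rewrite [RHS]big_mkcond /=.
apply: eq_big_seq => j; rewrite mem_iota => jN.
have <- : ((j%:Z - N%:Z < 0) && (- N%:Z <= j%:Z - N%:Z + m < N%:Z)) =
    (lo <= j < N)%N by rewrite /lo; case: ifP => m0; lia.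
by case: ifP.
Qed.

Lemma sea_anomaly (m : int) N (a b : bool -> K) : (`|m| <= N)%N ->
  \sum_(x <- win N) (x.2 < 0)%R%:R *
    ((- N%:Z <= x.2 + m < N%:Z)%R%:R * a x.1.1 - (- N%:Z <= x.2 - m < N%:Z)%R%:R * b x.1.1)
  = (N%:R - (if 0 <= m then 0%N else absz m)%:R) * (k%:R * (a true + a false))
  - (N%:R - (if 0 <= - m then 0%N else absz (- m))%:R) * (k%:R * (b true + b false)).
Proof.
move=> mN; rewrite big_allpairs_dep /=.
have sumb (c : bool -> K) : \sum_(sc <- enum {: bool * 'I_k}) c sc.1 =
    k%:R * (c true + c false).
  rewrite big_enum /= -(pair_bigA _ (fun s (_ : 'I_k) => c s)) /= big_bool.
  by rewrite !sumr_const card_ord mulrDr !mulr_natl.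
rewrite -(sea_count mN) -(@sea_count (- m)) ?abszN // -!sumb.
rewrite !mulr_sumr -sumrB; apply: eq_bigr => sc _.
rewrite !mulr_suml -sumrB; apply: eq_bigr => j _.
by rewrite mulrBr !mulrA -!natrM !mulnb.
Qed.

Definition Emode (m : int) : fock -> fock := rho true m (fun x => (x.1.1)%:R).
Definition Fmode (m : int) : fock -> fock := rho true m (fun x => (~~ x.1.1)%:R).
Definition Hmode (m : int) : fock -> fock :=
  rho false m (fun x => if x.1.1 then 1 else -1).

(** The translation operator: [Tmode, Emode n] = -n Emode (n - 1). *)
Definition Tmode : fock -> fock := rho false (-1) (fun x => x.2%:~R).

HB.instance Definition _ m := GRing.Linear.on (Emode m).
HB.instance Definition _ m := GRing.Linear.on (Fmode m).
HB.instance Definition _ m := GRing.Linear.on (Hmode m).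
HB.instance Definition _ := GRing.Linear.on Tmode.

Lemma rho0 g m phi : rho g m (fun _ : mode => 0) phi = 0.
Proof. by apply/funext => S; apply: big1 => x _; rewrite mul0r. Qed.

Fact Emode_comm m n phi : Emode m (Emode n phi) = Emode n (Emode m phi).
Proof.
rewrite /Emode (@rho_commE _ _ _ _ _ _ 0) => [|]; last first.
  exists 0%N => N _; apply: big1 => x _.
  by case: x => -[[] c] p; rewrite /= ?(mulr0, mul0r) subr0 mulr0.
rewrite scale0r addr0 (@rho_eq _ _ (true (+) true) _ _ (fun=> 0)) ?rho0 ?addr0 // => x.
by case: x => -[[] c] p; rewrite /= ?(mulr0, mul0r) subr0.
Qed.

Fact Fmode_comm m n phi : Fmode m (Fmode n phi) = Fmode n (Fmode m phi).
Proof.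
rewrite /Fmode (@rho_commE _ _ _ _ _ _ 0) => [|]; last first.
  exists 0%N => N _; apply: big1 => x _.
  by case: x => -[[] c] p; rewrite /= ?(mulr0, mul0r) subr0 mulr0.
rewrite scale0r addr0 (@rho_eq _ _ (true (+) true) _ _ (fun=> 0)) ?rho0 ?addr0 // => x.
by case: x => -[[] c] p; rewrite /= ?(mulr0, mul0r) subr0.
Qed.

Fact Hmode_Emode m n phi :
  Hmode m (Emode n phi) = Emode n (Hmode m phi) + 2%:R *: Emode (m + n) phi.
Proof.
rewrite /Hmode /Emode rho_comm0 //= -rhoZ; congr (_ + _); apply: rho_eq => x.
by case: x => -[[] c] p /=; ring.
Qed.

Fact Hmode_Fmode m n phi :
  Hmode m (Fmode n phi) = Fmode n (Hmode m phi) - 2%:R *: Fmode (m + n) phi.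
Proof.
rewrite /Hmode /Fmode rho_comm0 //= -scaleNr -rhoZ; congr (_ + _).
by apply: rho_eq => x; case: x => -[[] c] p /=; ring.
Qed.

Lemma Tmode_Emode n phi :
  Tmode (Emode n phi) = Emode n (Tmode phi) - n%:~R *: Emode (n - 1) phi.
Proof.
rewrite /Tmode /Emode rho_comm0 //= -scaleNr -rhoZ addrC [-1 + n]addrC.
rewrite [RHS]addrC; congr (_ + _); apply: rho_eq => x.
by case: x => -[[] c] p /=; rewrite ?rmorphD /=; ring.
Qed.

Fact Emode_Fmode m n phi : Emode m (Fmode n phi) =
  Fmode n (Emode m phi) + Hmode (m + n) phi
  + (m%:~R * k%:R * (m + n == 0)%:R) *: phi.
Proof.
rewrite /Emode /Fmode (@rho_commE _ _ _ _ _ _ (m%:~R * k%:R * (m + n == 0)%:R)).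
  congr (_ + _ + _); apply: rho_eq => x.
  by case: x => -[[] c] p /=; ring.
exists `|m|%N => N mN; rewrite /anomaly /=.
have [mn0|mn0] := eqVneq (m + n) 0; last first.
  by rewrite mulr0 big1 // => x _; rewrite /cst /= (negbTE mn0) mul0r.
have -> : n = - m by lia.
transitivity (\sum_(x <- win N) (x.2 < 0)%R%:R *
    ((- N%:Z <= x.2 + m < N%:Z)%R%:R * (x.1.1)%:R
     - (- N%:Z <= x.2 - m < N%:Z)%R%:R * (~~ x.1.1)%:R : K)).
  apply: eq_bigr => x _; rewrite /cst subrr /= !mem_win /=.
  by case: x.1.1; rewrite /= ?mulr1 ?mulr0.
rewrite (sea_anomaly (fun s => s%:R) (fun s => (~~ s)%:R)) //= addr0 add0r !mulr1.
rewrite -mulrBl; congr (_ * _).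
by case: m mN {mn0} => [[|p]|p] _; rewrite ?NegzE ?rmorphN /=; ring.
Qed.

Definition fock_fam : family k fock :=
  Family Emode_comm Fmode_comm Hmode_Emode Hmode_Fmode Emode_Fmode.

(** ** Adjointness *)

Lemma dual_nop g m x phi l : dual phi l ->
  dual (nop g m x phi) (fun chi => l (nop g (- m) (tau g m x) chi)).
Proof.
move=> d; have d1 := dual_op (0 <= x.2) (choice.pickle x)
  (dual_op (~~ (0 <= (tau g m x).2)) (choice.pickle (tau g m x)) d).
have := dual_lin (- cst K g m x) d d1.
rewrite scaleNr addrC; apply: dual_ext => chi.
rewrite negbK rmorphN /= rmorph_nat mulNr -mulNr -(dual_linear d); congr (l _).
rewrite addrC scaleNr /nop tauK; congr (_ - _ *: _).
rewrite /cst oppr_eq0; case: g {d1} => //=; case: eqP => //= ->.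
by rewrite addr0.
Qed.

Lemma dual_rho g m (alpha beta : mode -> K) phi l :
  (forall x, beta (tau g m x) = (alpha x)^*) -> dual phi l ->
  dual (rho g m alpha phi) (fun chi => l (rho g (- m) beta chi)).
Proof.
move=> ab d; case: (d) => s _ lE.
pose N0 := (\max_(p <- s) (bd k p.2) + `|m|)%N.
have bN p : p \in s -> (bd k p.2 + `|(- m)%R| <= N0)%N.
  move=> ps; rewrite abszN leq_add2r.
  exact: (@leq_bigmax_seq _ s xpredT (fun q => bd k q.2) p ps isT).
have lrho N chi : (N0 <= N)%N ->
    l (rho g (- m) beta chi) = \sum_(y <- win N) beta y * l (nop g (- m) y chi).
  move=> NN; rewrite lE.
  under [RHS]eq_bigr do rewrite lE mulr_sumr.
  rewrite exchange_big; apply: eq_big_seq => p ps /=.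
  rewrite (@rho_win _ _ N) ?(leq_trans (bN _ ps)) // mulr_sumr.
  by apply: eq_bigr => y _; rewrite mulrCA.
have win_mono (a b : nat) (z : int) : ~~ (- a%:Z <= z < a%:Z) -> (b <= a)%N ->
    ~~ (- b%:Z <= z < b%:Z) by lia.
have lnop y chi : y \notin win N0 -> l (nop g (- m) y chi) = 0.
  move=> yN; rewrite lE big1_seq // => p /= ps; rewrite nop_vanish ?mulr0 //.
  move: yN (bN p ps); rewrite !mem_win; exact: win_mono.
pose N := (N0 + `|m|)%N.
have nopN x : x \notin win N -> nop g m x phi = 0.
  move=> xN; apply: (dual_pos (dual_nop g m x d)); apply: lnop.
  by move: xN; rewrite !mem_win /N /=; lia.
have -> : rho g m alpha phi = \sum_(x <- win N) alpha x *: nop g m x phi.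
  apply/funext => S; rewrite sum_fct (@rho_win _ _ (N + (bd k S + `|m|))) ?leq_addl //.
  apply: big_support; rewrite ?win_uniq //.
    by move=> x _ /nopN ->; rewrite mulr0.
  by move=> x; rewrite !mem_win; lia.
apply: dual_ext (dual_sum (win N) alpha (fun x => dual_nop g m x d)) => chi.
rewrite (lrho N0) //; under eq_bigr do rewrite -ab.
rewrite -(big_map (tau g m) xpredT (fun y => beta y * l (nop g (- m) y chi))).
apply: big_support.
- by rewrite map_inj_uniq ?win_uniq //; exact: tau_inj.
- exact: win_uniq.
- by move=> y _ yN; rewrite lnop ?mulr0.
move=> y; rewrite mem_win => yN /mapP[]; exists (tau g (- m) y).
  by rewrite mem_win /N /=; lia.
by rewrite -{1}(opprK m) tauK.
Qed.

Lemma dual_E m phi l : dual phi l ->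
  dual (Emode m phi) (fun chi => l (Fmode (- m) chi)).
Proof.
apply: dual_rho => -[[s c] p] /=.
by rewrite addbT negbK rmorph_nat.
Qed.

(** ** Highest weight vectors *)

Lemma Emode_theta m (c : 'I_k) phi : Emode m (theta c phi) = theta c (Emode m phi).
Proof. by rewrite /Emode /theta rho_psi /= scale0r addr0. Qed.

Lemma Emode_vac m : 0 <= m -> Emode m (vac K) = 0.
Proof. by move=> m0; apply: rho_vac => x x0 xm; lia. Qed.

Lemma Tmode_vac : Tmode (vac K) = 0.
Proof. by apply: rho_vac => x x0 xm; have -> : x.2 = 0 by lia. Qed.

Local Notation topv := (@top_vec K k).

Lemma hole_top s (c : 'I_k) : psi (false, c, -1) (topv s) = 0.
Proof.
elim: s => [|d s IH] /=; first exact: psi_vac.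
by rewrite /theta psi_car IH linear0 oppr0.
Qed.

Lemma hwv_top s : uniq s -> hwv (size s) fock_fam (topv s).
Proof.
move=> us; split; first exact: top_vec_neq0.
- elim: s {us} => [|c s IH]; first exact: Emode_vac.
  by rewrite /= Emode_theta IH linear0.
- elim: s {us} => [|c s IH]; first by apply: rho_vac => x x0 xm; lia.
  rewrite /= /Fmode /theta rho_psi -/(Fmode 1 _) IH linear0 add0r.
  by rewrite [tau _ _ _](_ : _ = (false, c, -1)) // hole_top scaler0.
- elim: s {us} => [|c s IH].
    by rewrite scale0r; apply: rho_vac => x x0 xm; lia.
  rewrite /= /Hmode /theta rho_psi -/(Hmode 0 _) IH linearZ.
  by rewrite [tau _ _ _](_ : _ = (true, c, 0)) //= -scalerDl -natr1.
Qed.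

Lemma dual_top s : exists l, dual (topv s) l.
Proof.
elim: s => [|c s [l d]]; last by eexists; exact: dual_op d.
exists (fun chi => chi fset0), [:: (1, fset0)]; last first.
  by move=> chi; rewrite big_seq1 rmorph1 mul1r.
by rewrite big_seq1 scale1r.
Qed.

End FockModule.

(** * The action of U(nbar_-) on highest weight vectors *)

Section FamilyAction.
Variables (K : fieldType) (k : nat) (V : lmodType K) (r : nat).
Local Notation A := (Uenv (subLie (nbar_le K r))).
Implicit Types (f : family k V) (a b : A) (v w : V).

Fact fE_comm f (m n : nat) v : fE f (- (r + m)%N%:Z) (fE f (- (r + n)%N%:Z) v) =
  fE f (- (r + n)%N%:Z) (fE f (- (r + m)%N%:Z) v).
Proof. exact: fEE. Qed.

Definition nbact f a v : V := uact (@xrep K r V (fun j => fE f (- (r + j)%N%:Z)) (fE_comm f)) a v.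

Lemma nbactD f a b v : nbact f (a + b) v = nbact f a v + nbact f b v.
Proof. exact: uactD. Qed.

Lemma nbactM f a b v : nbact f (a * b) v = nbact f a (nbact f b v).
Proof. exact: uactM. Qed.

Lemma nbactZ f c a v : nbact f (c *: a) v = c *: nbact f a v.
Proof. by rewrite -[a in LHS]mul1r scalerAl nbactM /nbact uactA. Qed.

Lemma nbact0 f v : nbact f 0 v = 0.
Proof. by rewrite -(scale0r 0) nbactZ scale0r. Qed.

Lemma nbact_linear f a c v w : nbact f a (c *: v + w) = c *: nbact f a v + nbact f a w.
Proof. exact: uact_linear. Qed.

Lemma nbactv0 f a : nbact f a 0 = 0.
Proof. by have := nbact_linear f a (-1) 0 0; rewrite scaler0 addr0 scaleN1r addNr. Qed.

Lemma nbact_sum f (I : Type) (s : seq I) (F : I -> A) v :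
  nbact f (\sum_(x <- s) F x) v = \sum_(x <- s) nbact f (F x) v.
Proof.
by elim: s => [|x s IH]; [rewrite !big_nil nbact0|rewrite !big_cons nbactD IH].
Qed.

Lemma nbact_xneg f j v : nbact f (ugen (xneg K r j)) v = fE f (- (r + j)%N%:Z) v.
Proof. by rewrite /nbact uact_gen xrep_xneg. Qed.

Lemma nbact_umon f s v :
  nbact f (umon K r s) v = foldr (fun j w => fE f (- (r + j)%N%:Z) w) v s.
Proof.
elim: s => [|j s IH]; last by rewrite umon_cons nbactM IH nbact_xneg.
by rewrite /umon big_nil -[1 in LHS]scale1r /nbact uactA scale1r.
Qed.

Lemma nbact_exp f j n v :
  nbact f (ugen (xneg K r j) ^+ n) v = iter n (fE f (- (r + j)%N%:Z)) v.
Proof. by rewrite -umon_nseq nbact_umon; elim: n => //= n ->. Qed.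

Lemma nbact_ulc f l v :
  nbact f (ulc r l) v = \sum_(p <- l) p.1 *: nbact f (umon K r p.2) v.
Proof. by rewrite /ulc nbact_sum; apply: eq_bigr => p _; rewrite nbactZ. Qed.

Lemma nbact_comm f (h : {linear V -> V}) a v :
  (forall m w, h (fE f m w) = fE f m (h w)) -> h (nbact f a v) = nbact f a (h v).
Proof.
move=> hE; have [l ->] := ulc_surj a; rewrite !nbact_ulc linear_sum.
apply: eq_bigr => p _; rewrite linearZ !nbact_umon /=; congr (_ *: _).
by elim: (p.2) => //= j s IH; rewrite hE IH.
Qed.

End FamilyAction.

Section ShiftAction.
Variables (K : fieldType) (k : nat) (V : lmodType K) (f : family k V).

Lemma nbact_shift_fam c v :
  nbact (shift_fam f) c v = nbact f (@xshift K 1 1 1 c) v.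
Proof.
have [l ->] := ulc_surj c; rewrite xshift_ulc !nbact_ulc big_map.
apply: eq_bigr => p _; rewrite !nbact_umon /=; congr (_ *: _).
elim: (p.2) => //= j s ->; congr (fE f _ _); lia.
Qed.

Lemma nbact_xshift12 c v :
  nbact f (@xshift K 1 2 0 c) v = nbact f (@xshift K 1 1 1 c) v.
Proof.
have [l ->] := ulc_surj c; rewrite !xshift_ulc !nbact_ulc !big_map.
apply: eq_bigr => p _; rewrite !nbact_umon /=; congr (_ *: _).
elim: (p.2) => //= j s ->; congr (fE f _ _); lia.
Qed.

End ShiftAction.

Lemma tandem_nbact (K : numFieldType) k (V V' : lmodType K) (f : family k V)
    (f' : family k V') v v' e d (a : Uenv (subLie (nbar_le K 1))) :
  Hom e d a -> tandem f f' v v' (2 * e%:Z + d%:Z) (nbact f a v) (nbact f' a v').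
Proof.
move=> [l hl ->]; rewrite !nbact_ulc big_seq [X in tandem _ _ _ _ _ _ X]big_seq.
apply: tandem_sum => p pl; have [<- <-] := hl p pl; apply: tandemZ; rewrite !nbact_umon.
elim: (p.2) => [|j s IH]; first exact: tandem_hw.
rewrite (_ : 2 * _ + _ = 2 * (sumn s)%:Z + (size s)%:Z - 2 * - (1 + j)%N%:Z - 1).
  exact: tandem_E.
by rewrite /=; lia.
Qed.

(** * Extremal vectors and the spectral shift *)

Section Extremal.
Variables (K : numFieldType) (k i : nat) (V : lmodType K) (f : family k V) (v : V).
Hypothesis hv : hwv i f v.
Local Notation e n := (iter n (fE f (-1)) v).

Lemma fH0_extremal n : fH f 0 (e n) = (i + 2 * n)%:R *: e n.
Proof.
elim: n => [|n IH]; first by case: hv => _ _ _ ->; rewrite muln0 addn0.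
rewrite iterS fHE IH linearZ /= add0r -scalerDl -natrD; congr (_%:R *: _); lia.
Qed.

(** The sl(2)-triple x_alpha(-1), x_{-alpha}(1), h(0) - k has v as a lowest weight
    vector of weight i - k. *)
Lemma fF1_extremal n :
  fF f 1 (e n.+1) = (n.+1%:R * (k%:R - i%:R - n%:R)) *: e n.
Proof.
have FE w : fF f 1 (fE f (-1) w) = fE f (-1) (fF f 1 w) - fH f 0 w + k%:R *: w.
  have := fEF f (-1) 1 w; rewrite addNr eqxx mulr1 mulN1r scaleNr => ->.
  set x := fF _ _ _; set z := fH _ _ _; set t := _ *: w.
  by rewrite (addrAC (x + z)) addrK subrK.
elim: n => [|n IH].
  rewrite FE; case: hv => _ _ -> ->; rewrite linear0 sub0r -scaleNr -scalerDl.
  by congr (_ *: _); ring.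
rewrite iterS FE IH linearZ /= -iterS fH0_extremal -scalerBl -scalerDl.
by congr (_ *: _); rewrite !natrD natrM; ring.
Qed.

Hypothesis ik : (i <= k)%N.

Lemma extremal_neq0 n : (n <= k - i)%N -> e n != 0.
Proof.
elim: n => [|n IH] ni; first by case: hv.
apply/eqP => e0; have /eqP := fF1_extremal n.
rewrite e0 linear0 eq_sym scaler_eq0 (negbTE (IH (ltnW ni))) orbF.
rewrite -natrB // -natrB; last by lia.
by rewrite mulf_eq0 !pnatr_eq0 /=; lia.
Qed.

(** The extremal vector is killed by x_alpha(-1), by assumption, and by
    x_{-alpha}(2), because v is; these are the images of x_alpha(0) and
    x_{-alpha}(1) under the spectral shift. *)
Lemma hwv_shift : e (k - i + 1) = 0 -> hwv (k - i) (shift_fam f) (e (k - i)).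
Proof.
move=> etop; case: (hv) => v0 E0v F1v H0v.
have H1v : fH f 1 v = 0.
  have := fEF f 0 1 v; rewrite F1v E0v !linear0 !add0r.
  by rewrite !mul0r scale0r addr0 => <-.
have F2v : fF f 2 v = 0.
  have := fHF f 1 1 v; rewrite F1v H1v !linear0 sub0r => /esym/eqP.
  by rewrite oppr_eq0 scaler_eq0 pnatr_eq0 /= => /eqP.
have E0e n : fE f 0 (e n) = 0.
  by elim: n => //= n IH; rewrite fEE IH linear0.
have H1e n : fH f 1 (e n) = 0.
  by elim: n => //= n IH; rewrite fHE IH linear0 addrN E0e scaler0 addr0.
have F2e n : fF f 2 (e n) = 0.
  elim: n => //= n IH; have := fEF f (-1) 2 (e n).
  rewrite IH linear0 (_ : -1 + 2 = 1) // H1e mulr0 scale0r !addr0.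
  by move=> <-.
split; rewrite /= ?sub0r //.
- exact: extremal_neq0.
- by rewrite -iterS -addn1.
- rewrite /shiftH fH0_extremal mulr1 -scalerBl; congr (_ *: _).
  by rewrite natrD natrM natrB //; ring.
Qed.

End Extremal.

(** * Annihilators in the Fock module *)

Section FockAnnihilators.
Variables (K : numClosedFieldType) (k : nat).
Local Notation A := (Uenv (subLie (nbar_le K 1))).
Local Notation fockf := (fock_fam K k).
Local Notation y j := (ugen (xneg K 1 j)).
Local Notation sh := (@xshift K 1 1 1).
Local Notation R := (Rcomp K 1).

(** The colours are chosen so that one more theta leads from i to i + 1. *)
Definition top_of i : fock K := @top_vec K k (drop (k - i) (enum 'I_k)).

Lemma hwv_top_of i : (i <= k)%N -> hwv i fockf (top_of i).
Proof.
move=> ik; have := @hwv_top K k (drop (k - i) (enum 'I_k)).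
rewrite size_drop size_enum_ord subKn //; apply.
exact/drop_uniq/enum_uniq.
Qed.

Lemma top_of0 : top_of 0 = vac K.
Proof. by rewrite /top_of subn0 drop_oversize // size_enum_ord. Qed.

Lemma top_ofS i : (i < k)%N -> exists c : 'I_k, top_of i.+1 = theta c (top_of i).
Proof.
move=> ik; have lt : (k - i.+1 < size (enum 'I_k))%N by rewrite size_enum_ord; lia.
exists (nth (Ordinal ik) (enum 'I_k) (k - i.+1)).
rewrite /top_of (_ : k - i = (k - i.+1).+1)%N; last by lia.
by rewrite (drop_nth (Ordinal ik)).
Qed.

Lemma dual_nbact (s : seq nat) phi l : dual phi l ->
  dual (nbact fockf (umon K 1 s) phi)
    (fun chi => l (foldl (fun w j => fF fockf (1 + j)%N w) chi s)).
Proof.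
move=> d; rewrite nbact_umon; elim: s => [|j s IH] //=.
apply: dual_ext (dual_E k (- (1 + j)%N%:Z) IH) => chi.
by rewrite opprK.
Qed.

(** A highest weight vector of the Fock module, of positive norm, has the
    smallest possible annihilator: if a does not kill it then a^* a rescales it
    by a nonzero factor, and a^* a rescales any other highest weight vector of
    the same weight by the same factor. *)
Lemma fock_transfer i (V : lmodType K) (f : family k V) v e d (a : A) :
  (i <= k)%N -> hwv i f v -> Hom e d a -> nbact f a v = 0 ->
  nbact fockf a (top_of i) = 0.
Proof.
move=> ik hv ha av0; have hv' := hwv_top_of ik.
set w := nbact fockf a _; have [l dl] := @dual_top K k (drop (k - i) (enum 'I_k)).
have Gw : tandem f fockf v (top_of i) (2 * e%:Z + d%:Z) 0 w.
  by rewrite -av0; exact: tandem_nbact.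
case: ha (av0) => s hs aE _.
pose low (W : lmodType K) (g : family k W) t x : W :=
  foldl (fun w j => fF g (1 + j)%N w) x t.
pose adj (W : lmodType K) (g : family k W) x : W :=
  \sum_(p <- s) (p.1)^* *: low W g p.2 x.
have dw : dual w (fun chi => l (adj _ fockf chi)).
  rewrite /w aE nbact_ulc.
  have := dual_sum s fst (fun p => dual_nbact p.2 dl); apply: dual_ext => chi.
  rewrite /adj; elim: (s) => [|p t IH].
    by rewrite !big_nil -[X in l X](scaler0 _ 0) -[X in l X]addr0 (dual_linear dl)
      mul0r add0r; case: dl => s' _ ->; rewrite big1 // => q _; rewrite mulr0.
  by rewrite !big_cons IH (dual_linear dl).
have Glow t n x x' : tandem f fockf v (top_of i) n x x' ->
    tandem f fockf v (top_of i) (n - 2 * (sumn t)%:Z - (size t)%:Z) (low _ f t x) (low _ fockf t x').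
  elim: t n x x' => [|j t IH] n x x' g; first by rewrite /= mulr0 !subr0.
  have := IH _ _ _ (tandem_F (1 + j)%N%:Z g); congr (tandem _ _ _ _ _ _ _).
  by rewrite /=; lia.
have : tandem f fockf v (top_of i) 0 (adj _ f 0) (adj _ fockf w).
  rewrite /adj big_seq [X in tandem _ _ _ _ _ _ X]big_seq; apply: tandem_sum => p ps.
  apply: tandemZ; have [pd pe] := hs p ps.
  have := Glow p.2 _ _ _ Gw; rewrite pd pe; congr (tandem _ _ _ _ _ _ _); lia.
have -> : adj _ f 0 = 0.
  rewrite /adj big1 // => p _; rewrite /low.
  by elim: (p.2) => [|j t IH] /=; rewrite ?scaler0 // linear0.
move=> /(tandem_degree0 hv hv')[c [/esym/eqP]].
case: (hv) => v0 _ _ _; rewrite scaler_eq0 (negbTE v0) orbF => /eqP -> h.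
apply: (dual_pos dw); rewrite h scale0r.
by case: dl => s' _ ->; rewrite big1 // => q _; rewrite mulr0.
Qed.

(** The vector has norm 0: x_{-alpha}(1), the adjoint of x_alpha(-1), kills it as
    in a finite-dimensional sl(2)-module. *)
Lemma fock_extremal i : (i <= k)%N ->
  iter (k - i + 1) (fE fockf (-1)) (top_of i) = 0.
Proof.
move=> ik; have [l dl] := dual_top K (drop (k - i) (enum 'I_k)).
have [l' dl'] : exists l', dual (iter (k - i) (fE fockf (-1)) (top_of i)) l'.
  elim: (k - i)%N => [|n [l' dl']]; first by exists l.
  by eexists; exact: dual_E dl'.
have := dual_E k (-1) dl'; rewrite addn1 => /dual_pos; apply.
rewrite opprK -[Fmode _ _ _]/(fF fockf 1 _) -[Emode _ _ _]/(fE fockf (-1) _) -iterS.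
rewrite (fF1_extremal (hwv_top_of ik)) natrB // subrr mulr0 scale0r.
by case: dl' => s' _ ->; rewrite big1 // => q _; rewrite mulr0.
Qed.

(** The fermions theta_c commute with all modes of x_alpha. *)
Lemma annih_succ i (a : A) : (i < k)%N -> nbact fockf a (top_of i) = 0 ->
  nbact fockf a (top_of i.+1) = 0.
Proof.
move=> ik; have [c ->] := top_ofS ik.
rewrite -(nbact_comm (h := theta c) a); last by move=> m w; rewrite /= Emode_theta.
by move=> ->; rewrite linear0.
Qed.

(** The translation operator kills the vacuum, and acts on x_alpha(z) as d/dz; so
    it takes each coefficient of x_alpha(z)^q to the next one. *)
Lemma Tmode_Rcomp q s : Tmode k (nbact fockf (R q s) (vac K)) =
  s.+1%:R *: nbact fockf (R q s.+1) (vac K).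
Proof.
elim: q s => [|q IH] s.
  rewrite {2}/Rcomp /= big_nil nbact0 scaler0 /Rcomp /=; case: s => [|s] /=.
    by rewrite big_seq1 nbact_umon /= Tmode_vac.
  by rewrite big_nil nbact0 linear0.
have TE (j : nat) w : Tmode k (fE fockf (- (1 + j)%N%:Z) w) =
    fE fockf (- (1 + j)%N%:Z) (Tmode k w) + j.+1%:R *: fE fockf (- (1 + j.+1)%N%:Z) w.
  rewrite /= Tmode_Emode rmorphN /= scaleNr opprK; congr (_ + _ *: Emode _ _ _).
  lia.
rewrite !Rcomp_recl !nbact_sum linear_sum /=.
under eq_bigr do rewrite nbactM nbact_xneg TE IH linearZ /=.
under [in RHS]eq_bigr do rewrite nbactM nbact_xneg.
rewrite scaler_sumr big_split /= addrC.
pose F n := fE fockf (- (1 + n)%N%:Z) (nbact fockf (R q (s.+1 - n)) (vac K)).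
transitivity (\sum_(0 <= n < s.+2) n%:R *: F n
    + \sum_(0 <= n < s.+2) (s.+1 - n)%N%:R *: F n).
  congr (_ + _).
    rewrite [RHS]big_nat_recl // scale0r add0r; apply: eq_bigr => n _.
    by rewrite /F subSS.
  rewrite [RHS]big_nat_recr //= subnn scale0r addr0.
  by apply: eq_big_nat => n /andP[_ ns]; rewrite /F -subSn.
rewrite -big_split /=; apply: eq_big_nat => n /andP[_ ns].
by rewrite -scalerDl -natrD subnKC.
Qed.

Lemma annih_R i s : (i <= k)%N -> nbact fockf (R k.+1 s) (top_of i) = 0.
Proof.
elim: i => [|i IH] ik; last by apply: annih_succ (IH (ltnW ik)).
rewrite top_of0; elim: s => [|s IHs].
  have := @fock_extremal 0 (leq0n _); rewrite top_of0 subn0 addn1.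
  rewrite /Rcomp (_ : comps k.+1 0 = [:: nseq k.+1 0%N]).
    by rewrite big_seq1 umon_nseq nbact_exp.
  by elim: (k) => //= m ->.
have /eqP := Tmode_Rcomp k.+1 s; rewrite IHs linear0 eq_sym scaler_eq0.
by rewrite pnatr_eq0 /= => /eqP.
Qed.

Lemma annih_hideal i e d a : (i <= k)%N -> hideal k i e d a -> nbact fockf a (top_of i) = 0.
Proof.
move=> ik; elim=> [|b c _ IHb _ IHc|e1 d1 s g _ _ _|d1 g _ _].
- exact: nbact0.
- by rewrite nbactD IHb IHc addr0.
- by rewrite nbactM annih_R // nbactv0.
- by rewrite nbactM nbact_exp fock_extremal // nbactv0.
Qed.

Lemma annih_shift i e d c : (i <= k)%N -> Hom e d c ->
  nbact fockf (sh c * y 0 ^+ (k - i)) (top_of i) = 0 ->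
  nbact fockf c (top_of (k - i)) = 0.
Proof.
move=> ik hc; rewrite nbactM nbact_exp -nbact_shift_fam addn0 => h.
apply: fock_transfer hc h; first exact: leq_subr.
by apply: hwv_shift; [exact: hwv_top_of|exact: ik|exact: fock_extremal].
Qed.

(** The ideals exhaust the annihilators.  An element killing the top vector of
    Lambda_{k,i} also kills that of Lambda_{k,i+1}, so by descending induction
    on i it is, modulo the ideal of Lambda_{k,i}, a multiple of
    x_alpha(-1)^(k-i); the cofactor kills an extremal vector, which is a shifted
    highest weight vector of Lambda_{k,k-i}, and its degree is smaller. *)
Lemma annih_ideal i e d a : (i <= k)%N -> Hom e d a ->
  nbact fockf a (top_of i) = 0 -> hideal k i e d a.
Proof.
have [n] := ubnP (e + d); elim: n i e d a => // n IHn.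
(* The common step: the cofactor b of x_alpha(-1)^(k-i) belongs to the shifted
   ideal modulo x_alpha(-1), which itself kills the extremal vector. *)
have step i e' d' b : (i <= k)%N -> (0 < d' + (k - i))%N -> (e' + (d' + (k - i)) < n.+1)%N ->
    Hom e' d' b ->
    nbact fockf (b * y 0 ^+ (k - i)) (top_of i) = 0 ->
    hideal k i e' (d' + (k - i)) (b * y 0 ^+ (k - i)).
  move=> ik d0 edn' /Hom_split[b' [c [bE hb' hc b0 c0]]]; rewrite bE mulrDl.
  have XI : hideal k i e' (d' + (k - i)) (y 0 * b' * y 0 ^+ (k - i)).
    case: d' b0 hb' {c0 hc d0 edn'} => [/(_ erefl) -> _|d' _ hb'].
      by rewrite mulr0 mul0r; exact: hideal0.
    rewrite (umulC (y 0)) -mulrA -exprS -(addn1 (k - i)).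
    by apply: hidealX hb' _; rewrite /=; lia.
  rewrite nbactD (annih_hideal ik XI) add0r => ck; apply: hidealD => //.
  have [ed|de] := ltnP e' d'; first by rewrite (c0 ed) xshift0 mul0r; exact: hideal0.
  have cI : hideal k (k - i) (e' - d') d' c.
    apply: (IHn _ _ _ _ _ _ hc); rewrite ?leq_subr ?subnK //; first by lia.
    exact: annih_shift hc ck.
  by have := hideal_shift ik cI; rewrite subnK.
move=> i; have [j] := ubnP (k - i); elim: j i => // j IHj i ij e d a edn ik ha av.
have [iE|ik'] := eqVneq i k; last first.
  have lt : (i < k)%N by lia.
  have [|a' [b [aE ha' hb le]]] := hideal_succ lt (IHj i.+1 _ e d a edn lt ha (annih_succ lt av)).
    by lia.
  rewrite aE; case: le => [le|->]; last by rewrite mul0r addr0.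
  apply: hidealD => //; rewrite -(subnK le); apply: step => //.
  - by rewrite subnK //; lia.
  - by rewrite subnK.
  - by move: av; rewrite aE nbactD (annih_hideal ik ha') add0r.
have ki : (k - i = 0)%N by rewrite iE subnn.
case: d ha edn => [|d] ha edn.
  suff -> : a = 0 by exact: hideal0.
  case: ha av => l hl ->; rewrite nbact_ulc /ulc => av.
  have mon1 p : p \in l -> umon K 1 p.2 = 1.
    by move=> /hl[/size0nil -> _]; rewrite /umon big_nil.
  have aE : \sum_(p <- l) p.1 *: umon K 1 p.2 = (\sum_(p <- l) p.1) *: 1.
    by rewrite scaler_suml; apply: eq_big_seq => p /mon1 ->.
  have f1 w : nbact fockf (1 : A) w = w.
    by rewrite -(scale1r (1 : A)) /nbact uactA scale1r.
  have : (\sum_(p <- l) p.1) *: top_of i = 0.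
    by rewrite -av scaler_suml; apply: eq_big_seq => p /mon1 ->; rewrite f1.
  rewrite aE; move/eqP; have [v0 _ _ _] := hwv_top_of ik.
  by rewrite scaler_eq0 (negbTE v0) orbF => /eqP ->; rewrite scale0r.
by have := step i e d.+1 a; rewrite ki addn0 expr0 mulr1; apply.
Qed.

End FockAnnihilators.

(** * The grading of a highest weight module *)

(** The square-zero extension of the scalars by a module: a commutative ring in
    which linear identities between vectors become polynomial ones, decided by
    the ring tactic. *)
Section SquareZero.
Variables (K : fieldType) (V : lmodType K).

Definition sqz : Type := (K * V)%type.
HB.instance Definition _ := GRing.Zmodule.on sqz.

Definition sqz_mul (a b : sqz) : sqz := (a.1 * b.1, a.1 *: b.2 + b.1 *: a.2).

Fact sqz_mulA : associative sqz_mul.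
Proof.
move=> a b c; congr pair; rewrite /= ?mulrA // !scalerDr !scalerA.
by rewrite -addrA (mulrC c.1 b.1) (mulrC c.1 a.1).
Qed.

Fact sqz_mulC : commutative sqz_mul.
Proof. by move=> a b; congr pair; rewrite /= 1?mulrC 1?addrC. Qed.

Fact sqz_mul1 : left_id (1, 0) sqz_mul.
Proof. by move=> [a v]; congr pair; rewrite /= ?mul1r // scale1r scaler0 addr0. Qed.

Fact sqz_mulDl : left_distributive sqz_mul +%R.
Proof.
move=> a b c; congr pair; first exact: mulrDl.
by rewrite /= scalerDl scalerDr addrACA.
Qed.

Fact sqz_one : (1, 0) != 0 :> sqz.
Proof. by apply/eqP => -[] /eqP; rewrite oner_eq0. Qed.

HB.instance Definition _ := GRing.Zmodule_isComNzRing.Build sqz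
  sqz_mulA sqz_mulC sqz_mul1 sqz_mulDl sqz_one.

Definition sv (v : V) : sqz := (0, v).
Definition sc (c : K) : sqz := (c, 0).

Lemma svD v w : sv (v + w) = sv v + sv w.
Proof. by congr pair; rewrite /= addr0. Qed.

Lemma svN v : sv (- v) = - sv v.
Proof. by congr pair; rewrite /= oppr0. Qed.

Lemma svZ c v : sv (c *: v) = sc c * sv v.
Proof. by congr pair; rewrite /= ?mulr0 // scale0r addr0. Qed.

Lemma sv0 : sv 0 = 0. Proof. by []. Qed.

Fact sc_additive : zmod_morphism sc.
Proof. by move=> a b; congr pair; rewrite /= subr0. Qed.

Fact sc_multiplicative : monoid_morphism sc.
Proof. by split=> // a b; congr pair; rewrite /= !scaler0 addr0. Qed.

HB.instance Definition _ := GRing.isZmodMorphism.Build K sqz sc sc_additive.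
HB.instance Definition _ := GRing.isMonoidMorphism.Build K sqz sc sc_multiplicative.

Lemma sv_inj v w : sv v = sv w -> v = w.
Proof. by case. Qed.

End SquareZero.

Ltac module_ring :=
  apply: sv_inj; rewrite ?(svD, svN, svZ, sv0); ring.

Section Casimir.
Variables (K : numFieldType) (k : nat) (V : lmodType K) (f : family k V).
Local Notation E := (fE f).
Local Notation F := (fF f).
Local Notation H := (fH f).
Implicit Types (w : V) (m n : int).

(** Twice the m-th summand of the Casimir operator, the sum being taken over all
    integers m in normal order. *)
Definition casm m w : V :=
  H (- m) (H m w) + 2%:R *: E (- m) (F m w) + 2%:R *: F (- m) (E m w).

Let FE m n w : F m (E n w) =
  E n (F m w) - H (n + m) w - (n%:~R * k%:R * (n + m == 0)%:R) *: w.
Proof. by rewrite fEF; module_ring. Qed.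

Let linP (h : {linear V -> V}) c a b : h (a + c *: b) = h a + c *: h b.
Proof. by rewrite linearD linearZ. Qed.

Let linN (h : {linear V -> V}) c a b : h (a - c *: b) = h a - c *: h b.
Proof. by rewrite linearB linearZ. Qed.

Let linBN (h : {linear V -> V}) c a b d : h (a - d - c *: b) = h a - h d - c *: h b.
Proof. by rewrite !linearB linearZ. Qed.

Let linBP (h : {linear V -> V}) c a b d : h (a + d + c *: b) = h a + h d + c *: h b.
Proof. by rewrite !linearD linearZ. Qed.

Let lin_casm (h : {linear V -> V}) m w : h (casm m w) =
  h (H (- m) (H m w)) + 2%:R *: h (E (- m) (F m w)) + 2%:R *: h (F (- m) (E m w)).
Proof. by rewrite /casm !linearD !linearZ. Qed.

Lemma casm_E0 m w : casm m (E 0 w) = E 0 (casm m w).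
Proof.
rewrite lin_casm /casm (fHE f m 0) (linP (H (- m))) (fHE f (- m) 0) !addr0.
rewrite (FE m 0) (linBN (E (- m))) (fEE f (- m) 0) (fEE f m 0) (FE (- m) 0) !add0r.
by rewrite !mul0r; module_ring.
Qed.

Lemma casm_F0 m w : casm m (F 0 w) = F 0 (casm m w).
Proof.
rewrite lin_casm /casm (fHF f m 0) (linN (H (- m))) (fHF f (- m) 0) !addr0.
rewrite (fFF f m 0) (fEF f (- m) 0) (fEF f m 0) (linBP (F (- m))) (fFF f (- m) 0) !addr0.
rewrite oppr_eq0 rmorphN /=; have [->|_] := eqVneq m 0; last by rewrite !mulr0 !scale0r; module_ring.
by rewrite mulr0z oppr0 !mul0r !scale0r; module_ring.
Qed.

(** Commuting x_alpha(-1) and x_{-alpha}(1) past the m-th summand leaves the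
    difference of two consecutive terms of these sequences; the sum over m
    telescopes, and the level and the value at the centre are all that remains in
    the limit. *)
Definition telE m w := H (- m) (E (m - 1) w) - E (- m) (H (m - 1) w).
Definition telF m w := H (1 - m) (F m w) - F (1 - m) (H m w).

Lemma casm_E1 m w : casm m (E (-1) w) =
  E (-1) (casm m w) + 2%:R *: (telE m w - telE (m + 1) w)
  + (2%:R * k%:R * (m == 1)%:R) *: E (- m) w
  + (2%:R * k%:R * (m == -1)%:R) *: E m w.
Proof.
have m1 : -1 + m = m - 1 by rewrite addrC.
have m2 : - m - 1 = - (m + 1) by rewrite opprD.
have m3 : -1 - m = - (m + 1) by rewrite opprD addrC.
rewrite lin_casm /casm /telE (fHE f m (-1)) (linP (H (- m))) (fHE f (- m) (-1)) addrK.
rewrite (FE m (-1)) (linBN (E (- m))) (fEE f (- m) (-1)) (fEE f m (-1)) (FE (- m) (-1)).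
rewrite m1 m2 m3 subr_eq0 oppr_eq0 addr_eq0.
by module_ring.
Qed.

Lemma casm_F1 m w : casm m (F 1 w) =
  F 1 (casm m w) + 2%:R *: (telF m w - telF (m + 1) w)
  - (2%:R * k%:R * m%:~R * (m == 1)%:R) *: F m w
  + (2%:R * k%:R * m%:~R * (m == -1)%:R) *: F (- m) w.
Proof.
have m1 : 1 - (m + 1) = - m by rewrite opprD addrCA subrr addr0.
have m2 : - m + 1 = 1 - m by rewrite addrC.
rewrite lin_casm /casm /telF m1 (fHF f m 1) (linN (H (- m))) (fHF f (- m) 1).
rewrite (fFF f m 1) (fEF f (- m) 1) (fEF f m 1) (linBP (F (- m))) (fFF f (- m) 1).
rewrite m2 subr_eq0 addr_eq0 rmorphN (eq_sym 1) /=.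
by module_ring.
Qed.

Lemma telE01 w : telE 0 w + telE 1 w = 4%:R *: E (-1) w.
Proof.
rewrite /telE subrr oppr0 sub0r (fHE f 0 (-1)) add0r.
have -> : E 0 (H (-1) w) = H (-1) (E 0 w) - 2%:R *: E (-1) w.
  by rewrite fHE addr0; module_ring.
by module_ring.
Qed.

Lemma telF01 w : telF 0 w + telF 1 w = - (4%:R *: F 1 w).
Proof.
rewrite /telF subrr subr0 (fHF f 0 1) add0r.
have -> : H 1 (F 0 w) = F 0 (H 1 w) - 2%:R *: F 1 w by rewrite fHF addr0.
by module_ring.
Qed.

Definition casimir (N : nat) w : V :=
  casm 0 w + 2%:R *: \sum_(1 <= j < N.+1) casm j%:Z w.

Fact casimir_linear N : linear (casimir N).
Proof.
have casm_lin m : linear (casm m).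
  by move=> a v w; rewrite /casm !linearP; module_ring.
move=> a v w; rewrite /casimir casm_lin.
have -> : \sum_(1 <= j < N.+1) casm j (a *: v + w) =
    a *: \sum_(1 <= j < N.+1) casm j%:Z v + \sum_(1 <= j < N.+1) casm j%:Z w.
  by rewrite scaler_sumr -big_split; apply: eq_bigr => j _; rewrite casm_lin.
by module_ring.
Qed.

HB.instance Definition _ N :=
  GRing.isLinear.Build K V V *:%R (casimir N) (casimir_linear N).

Lemma casimir_E0 N w : casimir N (E 0 w) = E 0 (casimir N w).
Proof.
rewrite /casimir (linP (E 0)) (linear_sum (E 0)) casm_E0; congr (_ + _ *: _).
by apply: eq_bigr => j _; rewrite casm_E0.
Qed.

Lemma casimir_F0 N w : casimir N (F 0 w) = F 0 (casimir N w).
Proof.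
rewrite /casimir (linP (F 0)) (linear_sum (F 0)) casm_F0; congr (_ + _ *: _).
by apply: eq_bigr => j _; rewrite casm_F0.
Qed.

Lemma casimir_E1 N w : (0 < N)%N -> telE N.+1%:Z w = 0 ->
  casimir N (E (-1) w) = E (-1) (casimir N w) + (4%:R * (k%:R + 2%:R)) *: E (-1) w.
Proof.
move=> N0 tN; rewrite /casimir (linP (E (-1))) (linear_sum (E (-1))) casm_E1.
have -> : \sum_(1 <= j < N.+1) casm j (E (-1) w) =
    \sum_(1 <= j < N.+1) E (-1) (casm j%:Z w)
    + 2%:R *: telE 1 w + (2%:R * k%:R) *: E (-1) w.
  have -> : telE 1 w =
      \sum_(1 <= j < N.+1) (telE j%:Z w - telE (j%:Z + 1) w).
    rewrite -(subr0 (telE 1 w)) -[X in _ - X]tN.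
    rewrite -[LHS]opprB -(telescope_sumr (fun j => telE j%:Z w)) // -sumrN.
    by apply: eq_bigr => j _; rewrite opprB -addn1 PoszD.
  have -> : (2%:R * k%:R) *: E (-1) w = \sum_(1 <= j < N.+1)
      (2%:R * k%:R * (j%:Z == 1)%:R) *: E (- j%:Z) w.
    rewrite big_ltn // mulr1 big_nat_cond big1 ?addr0 // => j /andP[/andP[j1 _] _].
    by rewrite eqz_nat gtn_eqF // mulr0 scale0r.
  rewrite scaler_sumr -!big_split; apply: eq_bigr => j _ /=.
  by rewrite casm_E1 mulr0 scale0r addr0.
rewrite !mulr0 !scale0r !addr0 add0r.
have -> : telE 0 w = 4%:R *: E (-1) w - telE 1 w by rewrite -telE01 addrK.
by module_ring.
Qed.

Lemma casimir_F1 N w : (0 < N)%N -> telF N.+1%:Z w = 0 ->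
  casimir N (F 1 w) = F 1 (casimir N w) - (4%:R * (k%:R + 2%:R)) *: F 1 w.
Proof.
move=> N0 tN; rewrite /casimir (linP (F 1)) (linear_sum (F 1)) casm_F1.
have -> : \sum_(1 <= j < N.+1) casm j (F 1 w) =
    \sum_(1 <= j < N.+1) F 1 (casm j%:Z w)
    + 2%:R *: telF 1 w - (2%:R * k%:R) *: F 1 w.
  have -> : telF 1 w =
      \sum_(1 <= j < N.+1) (telF j%:Z w - telF (j%:Z + 1) w).
    rewrite -(subr0 (telF 1 w)) -[X in _ - X]tN.
    rewrite -[LHS]opprB -(telescope_sumr (fun j => telF j%:Z w)) // -sumrN.
    by apply: eq_bigr => j _; rewrite opprB -addn1 PoszD.
  have -> : (2%:R * k%:R) *: F 1 w = \sum_(1 <= j < N.+1)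
      (2%:R * k%:R * j%:Z%:~R * (j%:Z == 1)%:R) *: F j%:Z w.
    rewrite big_ltn // !mulr1 big_nat_cond big1 ?addr0 // => j /andP[/andP[j1 _] _].
    by rewrite eqz_nat gtn_eqF // mulr0 scale0r.
  rewrite scaler_sumr -sumrN -!big_split; apply: eq_bigr => j _ /=.
  by rewrite casm_F1 mulr0 scale0r addr0.
rewrite !mulr0 !scale0r !addr0 add0r subr0.
have -> : telF 0 w = - (4%:R *: F 1 w) - telF 1 w by rewrite -telF01 addrK.
by module_ring.
Qed.

(** The condition under which the cutoff of the Casimir operator is harmless. *)
Definition restricted w := exists N0 : nat, forall m, N0%:Z <= m ->
  [/\ E m w = 0, F m w = 0 & H m w = 0].

Lemma restricted_E n w : restricted w -> restricted (E n w).
Proof.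
move=> [N0 h]; exists (N0 + `|n|).+1 => m mN.
have [E0 F0 H0] := h m ltac:(lia); have [E1 F1 H1] := h (m + n) ltac:(lia).
split; first by rewrite fEE E0 linear0.
  rewrite FE F0 linear0 (addrC n) H1 (_ : m + n == 0 = false); last by lia.
  by rewrite mulr0 scale0r !subr0.
by rewrite fHE H0 E1 linear0 scaler0 addr0.
Qed.

Lemma restricted_F n w : restricted w -> restricted (F n w).
Proof.
move=> [N0 h]; exists (N0 + `|n|).+1 => m mN.
have [E0 F0 H0] := h m ltac:(lia); have [E1 F1 H1] := h (m + n) ltac:(lia).
split; last by rewrite fHF H0 F1 linear0 scaler0 subr0.
  rewrite fEF E0 linear0 H1 (_ : m + n == 0 = false); last by lia.
  by rewrite mulr0 scale0r !addr0.
by rewrite fFF F0 linear0.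
Qed.

Lemma restricted_lin a v w : restricted v -> restricted w -> restricted (a *: v + w).
Proof.
move=> [N0 h] [N1 h1]; exists (maxn N0 N1) => m mN.
have [E0 F0 H0] := h m ltac:(lia); have [E1 F1 H1] := h1 m ltac:(lia).
by rewrite !linearP /= E0 F0 H0 E1 F1 H1 !scaler0 !addr0.
Qed.

Lemma hwv_modes i v : hwv i f v -> forall m, 1 <= m ->
  [/\ E m v = 0, F m v = 0 & H m v = 0].
Proof.
move=> [_ E0 F1 _].
have two : (2%:R : K) != 0 by rewrite pnatr_eq0.
have H1 : H 1 v = 0.
  have := fEF f 0 1 v; rewrite F1 E0 !linear0 !add0r.
  by rewrite !mul0r scale0r addr0 => <-.
have Em (m : nat) : E m%:Z v = 0.
  elim: m => // m IH; have := fHE f 1 m v.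
  rewrite IH H1 !linear0 add0r => /esym/eqP.
  by rewrite scaler_eq0 (negbTE two) -PoszD add1n => /eqP.
have Fm (m : nat) : F m.+1%:Z v = 0.
  elim: m => // m IH; have := fHF f 1 m.+1 v.
  rewrite IH H1 !linear0 sub0r => /esym/eqP.
  by rewrite oppr_eq0 scaler_eq0 (negbTE two) -PoszD add1n => /eqP.
case=> [[|m]|m] // _; split; [exact: Em|exact: Fm|].
have := fEF f m.+1 0 v; rewrite Em linear0 addr0.
have := fEF f m 1 v; rewrite F1 Em !linear0 add0r -PoszD addn1.
by rewrite mulr0 scale0r addr0 => <-.
Qed.

End Casimir.

(** The operators T - d, for the eigenvalues d other than c, eliminate the other
    eigenspaces one after another. *)
Lemma eigen_split (K : fieldType) (V : lmodType K) (T : {linear V -> V})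
    (s : seq (K * V)) :
  (forall p, p \in s -> T p.2 = p.1 *: p.2) -> \sum_(p <- s) p.2 = 0 ->
  forall c, \sum_(p <- s | p.1 == c) p.2 = 0.
Proof.
move=> hs s0 c.
suff key (t : seq K) : forall (g : K -> K),
    \sum_(p <- s) g p.1 *: p.2 = 0 -> g c != 0 ->
    {in s, forall p, p.1 == c \/ (p.1 \in t \/ g p.1 = 0)} ->
    \sum_(p <- s | p.1 == c) p.2 = 0.
  apply: (key (map fst s) (fun=> 1)); rewrite ?oner_neq0 //.
    by under eq_bigr do rewrite scale1r.
  by move=> p ps; right; left; exact: map_f.
elim: t => [|d t IH] g gs gc hg.
  move: gs; rewrite (bigID (fun p => p.1 == c)) /=.
  rewrite [X in _ + X]big1_seq ?addr0 => [|p /andP[/negbTE pc ps]]; last first.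
    by have [|[//|->]] := hg p ps; [rewrite pc|rewrite scale0r].
  under eq_bigr => p /eqP pc do rewrite pc.
  by rewrite -scaler_sumr => /eqP; rewrite scaler_eq0 (negbTE gc) => /eqP.
have [dc|dc] := eqVneq d c.
  apply: (IH g) => // p ps; have := hg p ps; rewrite inE dc.
  by case=> [->|[/orP[->|->]|->]]; [left|left|right; left|right; right].
apply: (IH (fun x => (x - d) * g x)).
- have := congr1 T gs; rewrite linear_sum linear0.
  have -> : \sum_(p <- s) T (g p.1 *: p.2) = \sum_(p <- s) p.1 *: (g p.1 *: p.2).
    by apply: eq_big_seq => p ps; rewrite linearZ /= hs // !scalerA mulrC.
  have gsd : \sum_(p <- s) d *: (g p.1 *: p.2) = 0 by rewrite -scaler_sumr gs scaler0.
  move=> Ts; transitivity (\sum_(p <- s) p.1 *: (g p.1 *: p.2)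
      - \sum_(p <- s) d *: (g p.1 *: p.2)); last by rewrite Ts gsd subr0.
  rewrite -sumrB; by apply: eq_bigr => p _; rewrite !scalerA -scalerBl mulrBl.
- by rewrite mulf_neq0 // subr_eq0 eq_sym.
- move=> p ps; have [->|[|->]] := hg p ps; first by left.
    rewrite inE => /orP[/eqP ->|->]; last by right; left.
    by right; right; rewrite subrr mul0r.
  by right; right; rewrite mulr0.
Qed.

Section Grading.
Variables (K : numFieldType) (k i : nat) (V : lmodType K) (f : family k V) (v : V).
Hypothesis hv : hwv i f v.

Let k2 : (k%:R + 2%:R : K) != 0.
Proof. by rewrite -natrD pnatr_eq0 addn2. Qed.

(** The Casimir operator, cut off at N, corrected by h(0) so as to measure the
    principal degree. *)
Definition degop N w : V := (k%:R + 2%:R)^-1 *: casimir f N w - fH f 0 w.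

Fact degop_linear N : linear (degop N).
Proof. by move=> a w w'; rewrite /degop !linearP /=; module_ring. Qed.

HB.instance Definition _ N :=
  GRing.isLinear.Build K V V *:%R (degop N) (degop_linear N).

Definition deg0 : K := (k%:R + 2%:R)^-1 * (i%:R * i%:R + 2%:R * i%:R) - i%:R.

Let linZB (h : {linear V -> V}) c x y : h (c *: x - y) = c *: h x - h y.
Proof. by rewrite linearB linearZ. Qed.

Let linZ (h : {linear V -> V}) c x : h (c *: x) = c *: h x.
Proof. by rewrite linearZ. Qed.

Lemma degop_E0 N w : degop N (fE f 0 w) = fE f 0 (degop N w) - 2%:R *: fE f 0 w.
Proof.
rewrite /degop casimir_E0 fHE addr0 (linZB (fE f 0)) /=.
by module_ring.
Qed.

Lemma degop_F0 N w : degop N (fF f 0 w) = fF f 0 (degop N w) + 2%:R *: fF f 0 w.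
Proof.
rewrite /degop casimir_F0 fHF addr0 (linZB (fF f 0)) /=.
by module_ring.
Qed.

Let fourE x : (k%:R + 2%:R)^-1 *: ((4%:R * (k%:R + 2%:R)) *: x) = 4%:R *: x :> V.
Proof. by rewrite scalerA mulrCA mulVf ?mulr1. Qed.

Lemma degop_E1 N w : (0 < N)%N -> telE f N.+1%:Z w = 0 ->
  degop N (fE f (-1) w) = fE f (-1) (degop N w) + 2%:R *: fE f (-1) w.
Proof.
move=> N0 t; rewrite /degop casimir_E1 // scalerDr fourE fHE add0r (linZB (fE f (-1))) /=.
by module_ring.
Qed.

Lemma degop_F1 N w : (0 < N)%N -> telF f N.+1%:Z w = 0 ->
  degop N (fF f 1 w) = fF f 1 (degop N w) - 2%:R *: fF f 1 w.
Proof.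
move=> N0 t; rewrite /degop casimir_F1 // scalerBr fourE fHF add0r (linZB (fF f 1)) /=.
by module_ring.
Qed.

Lemma degop_hw N : degop N v = deg0 *: v.
Proof.
have [_ E0 _ H0] := hv; have hm := hwv_modes hv.
rewrite /degop /casimir big_nat big1 => [|j /andP[j1 _]]; last first.
  by rewrite /casm; have [-> -> ->] := hm j j1; rewrite !linear0 !addr0.
rewrite scaler0 addr0 /casm oppr0 E0 fEF E0 mul0r mul0r scale0r addr0 addr0.
rewrite !linear0 add0r H0 linearZ /= H0 /deg0.
by module_ring.
Qed.

Variables (V' : lmodType K) (f' : family k V') (v' : V').

Lemma tandem_eigen n w w' : tandem f f' v v' n w w' -> restricted f w /\
  exists N0, forall N, (N0 <= N)%N -> degop N w = (deg0 + 2%:R * n%:~R) *: w.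
Proof.
have step (c : K) (op : V -> V) x m : (forall a y, op (a *: y) = a *: op y) ->
    restricted f x ->
    (forall N, (0 < N)%N -> telE f N.+1%:Z x = 0 -> telF f N.+1%:Z x = 0 ->
       degop N (op x) = op (degop N x) + (2%:R * c) *: op x) ->
    (exists N0, forall N, (N0 <= N)%N -> degop N x = (deg0 + 2%:R * m) *: x) ->
    exists N0, forall N, (N0 <= N)%N ->
      degop N (op x) = (deg0 + 2%:R * (m + c)) *: op x.
  move=> opZ [N1 r] h [N0 hx]; exists (maxn N0 N1).+1 => N NN.
  have [E1 F1 H1] := r N ltac:(lia); have [E2 F2 H2] := r N.+1 ltac:(lia).
  have N0N : (N0 <= N)%N by lia.
  have Npos : (0 < N)%N by lia.
  rewrite h //; first by rewrite (hx N N0N) opZ; module_ring.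
  - rewrite /telE (_ : N.+1%:Z - 1 = N); last by lia.
    by rewrite E1 H1 !linear0 addr0.
  - by rewrite /telF F2 H2 !linear0 addr0.
elim=> {n w w'} [|n|n a w1 w1' w2 w2' _ [r1 [N1 h1]] _ [r2 [N2 h2]]|
  n w w' _ [r h]|n w w' _ [r h]|n w w' _ [r h]|n w w' _ [r h]].
- split; last by exists 0%N => N _; rewrite degop_hw mulr0 addr0.
  by exists 1%N => m m1; exact: hwv_modes hv _ m1.
- split; last by exists 0%N => N _; rewrite linear0 scaler0.
  by exists 0%N => m _; rewrite !linear0.
- split; first exact: restricted_lin.
  exists (maxn N1 N2) => N NN; rewrite linearP /= h1 ?h2; try lia.
  by module_ring.
- split; first exact: restricted_F.
  have := step 1 (fF f 0) w n%:~R (linZ (fF f 0)) r.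
  rewrite rmorphD /=; apply => // N _ _ _; rewrite degop_F0 mulr1 //.
- split; first exact: restricted_E.
  have := step 1 (fE f (-1)) w n%:~R (linZ (fE f (-1))) r.
  by rewrite rmorphD /=; apply => // N N0 t _; rewrite degop_E1 // mulr1.
- split; first exact: restricted_E.
  have := step (-1) (fE f 0) w n%:~R (linZ (fE f 0)) r.
  rewrite rmorphB /=; apply => // N _ _ _; rewrite degop_E0.
  by rewrite mulrN1 scaleNr.
- split; first exact: restricted_F.
  have := step (-1) (fF f 1) w n%:~R (linZ (fF f 1)) r.
  rewrite rmorphB /=; apply => // N N0 _ t; rewrite degop_F1 //.
  by rewrite mulrN1 scaleNr.
Qed.

(** The degree, which a priori only belongs to the words, is read off from the
    vectors by the Casimir operator; its eigenspaces are independent. *)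
Lemma tandem_split (s : seq (int * V * V')) :
  (forall p, p \in s -> tandem f f' v v' p.1.1 p.1.2 p.2) ->
  \sum_(p <- s) p.1.2 = 0 -> forall n, \sum_(p <- s | p.1.1 == n) p.1.2 = 0.
Proof.
move=> hs s0 n.
have [N hN] : exists N, forall p, p \in s ->
    degop N p.1.2 = (deg0 + 2%:R * p.1.1%:~R) *: p.1.2.
  suff [N hN] : exists N0, forall N, (N0 <= N)%N -> forall p, p \in s ->
      degop N p.1.2 = (deg0 + 2%:R * p.1.1%:~R) *: p.1.2.
    by exists N; exact: hN.
  elim: s hs {s0} => [|q s IH] hs; first by exists 0%N.
  have [|N1 h1] := IH; first by move=> p ps; apply: hs; rewrite inE ps orbT.
  have [_ [N2 h2]] := tandem_eigen (hs q (mem_head _ _)).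
  exists (maxn N1 N2) => N NN p; rewrite inE => /orP[/eqP->|ps].
    by apply: h2; lia.
  by apply: h1 => //; lia.
pose ev (m : int) : K := deg0 + 2%:R * m%:~R.
have ev_inj : injective ev.
  move=> a b /addrI /mulfI; rewrite pnatr_eq0 => /(_ isT) /eqP.
  by rewrite eqr_int => /eqP.
have := @eigen_split _ _ (degop N) [seq (ev p.1.1, p.1.2) | p <- s].
rewrite !big_map => /(_ _ s0 (ev n)); rewrite big_map /=.
under eq_bigl do rewrite (inj_eq ev_inj).
by apply=> q /mapP[p ps ->]; exact: hN.
Qed.

End Grading.

(** * Representations of the affine algebra *)

Section RepFamily.
Variables (K : fieldType) (k : nat) (V : lmodType K) (rho : lieRep (affine K) V).
Hypothesis hk : forall v, rho (kk K) v = k%:R *: v.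

Definition repop (X : affine K) (v : V) : V := rho X v.

Fact repop_linear X : linear (repop X).
Proof. by move=> a v w; exact: rep_linearr. Qed.

HB.instance Definition _ X :=
  GRing.isLinear.Build K V V *:%R (repop X) (repop_linear X).

Lemma rep_modes a m b n v : rho (tmono a m) (rho (tmono b n) v) =
  rho (tmono b n) (rho (tmono a m) v) + rho (tmono (lie_br a b) (m + n)) v
  + (m%:~R * trform a b * (m + n == 0)%:R * k%:R) *: v.
Proof.
have := rep_br rho (tmono a m) (tmono b n) v.
rewrite [lie_br _ _]affine_br_tmono addrC rep_linearl hk scalerA.
by move/eqP; rewrite eq_sym subr_eq => /eqP ->; module_ring.
Qed.

Lemma rep_tmonoZ c a m v : rho (tmono (c *: a) m) v = c *: rho (tmono a m) v.
Proof.
rewrite -[c *: a]addr0 tmono_linear tmono0 rep_linearl.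
by have := rep_linearl rho (-1) 0 0 v; rewrite scaler0 addr0 scaleN1r addNr => ->;
  rewrite addr0.
Qed.

Lemma rep_tmono0 m v : rho (tmono 0 m) v = 0.
Proof. by rewrite -(scale0r 0) rep_tmonoZ scale0r. Qed.

Lemma trform_table :
  [/\ trform (xa K) (xma K) = 1, trform (xma K) (xma K) = 0,
      trform (hh K) (xa K) = 0 & trform (hh K) (xma K) = 0].
Proof.
by split; rewrite /trform /mxtrace !big_ord_recl big_ord0 !mxE
  !big_ord_recl !big_ord0 !mxE /=; ring.
Qed.

Local Notation E m := (repop (tmono (xa K) m) : {linear V -> V}).
Local Notation F m := (repop (tmono (xma K) m) : {linear V -> V}).
Local Notation H m := (repop (tmono (hh K) m) : {linear V -> V}).

Fact rep_EE m n v : E m (E n v) = E n (E m v).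
Proof.
rewrite /= /repop rep_modes lie_brxx rep_tmono0 trform_xa.
by rewrite mulr0 !mul0r scale0r !addr0.
Qed.

Fact rep_FF m n v : F m (F n v) = F n (F m v).
Proof.
have [_ t _ _] := trform_table.
rewrite /= /repop rep_modes lie_brxx rep_tmono0 t.
by rewrite mulr0 !mul0r scale0r !addr0.
Qed.

Fact rep_HE m n v : H m (E n v) = E n (H m v) + 2%:R *: E (m + n) v.
Proof.
have [_ _ t _] := trform_table.
rewrite /= /repop rep_modes t mulr0 !mul0r scale0r addr0.
by rewrite sl2_hh_xa rep_tmonoZ.
Qed.

Fact rep_HF m n v : H m (F n v) = F n (H m v) - 2%:R *: F (m + n) v.
Proof.
have [_ _ _ t] := trform_table.
rewrite /= /repop rep_modes t mulr0 !mul0r scale0r addr0.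
by rewrite (_ : lie_br _ _ = - 2%:R *: xma K) ?rep_tmonoZ ?sl2_hh_xma ?scaleNr.
Qed.

Fact rep_EF m n v : E m (F n v) =
  F n (E m v) + H (m + n) v + (m%:~R * k%:R * (m + n == 0)%:R) *: v.
Proof.
have [t _ _ _] := trform_table.
by rewrite /= /repop rep_modes t sl2_xa_xma mulr1 mulrAC.
Qed.

Definition rep_fam : family k V := Family rep_EE rep_FF rep_HE rep_HF rep_EF.

Lemma sl2_span (a : sl2 K) : exists b c d : K, a = b *: xa K + c *: xma K + d *: hh K.
Proof.
exists (sl2_val a 0 1), (sl2_val a 1 0), (sl2_val a 0 0); apply: val_inj.
have /eqP := valP a; rewrite /mxtrace !big_ord_recl big_ord0 addr0.
set i1 := lift ord0 ord0 => tr0; have {tr0} tr0 : sl2_val a i1 i1 = - sl2_val a 0 0.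
  by apply/eqP; rewrite -addr_eq0 addrC; apply/eqP.
have i1E : i1 = 1 by apply: val_inj.
apply/matrixP => p q; rewrite /= !mxE.
have ord2 (z : 'I_2) : z = 0 \/ z = 1.
  by case: z => -[|[|//]] zl; [left|right]; apply: val_inj.
rewrite i1E in tr0.
by have [->|->] := ord2 p; have [->|->] := ord2 q; rewrite /= ?tr0; ring.
Qed.

End RepFamily.

Section Irreducible.
Variables (K : numFieldType) (k i : nat) (V : lmodType K).
Variable rho : lieRep (affine K) V.
Hypothesis hirr : irreducible_rep rho.
Variable v : V.
Hypothesis hw : highest_weight_vector k i rho v.

Let P0 (X : affine K) : rho X 0 = 0.
Proof. by have := rep_linearr rho X (-1) 0 0; rewrite scaler0 addr0 scaleN1r addNr. Qed.

Lemma level_scalar w : rho (kk K) w = k%:R *: w.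
Proof.
have [_ /(_ [set w | rho (kk K) w = k%:R *: w])] := hirr.
case=> [|a x y /= hx hy|X x /= hx||W].
- by rewrite /= P0 scaler0.
- by rewrite rep_linearr hx hy scalerDr !scalerA mulrC.
- have := rep_br rho (kk K) X x.
  have -> : lie_br (kk K) X = 0 by have := affine_brkl 1 X; rewrite scale1r.
  have -> : rho 0 x = 0.
    by have := rep_linearl rho (-1) 0 0 x; rewrite scaler0 addr0 scaleN1r addNr.
  move/esym/eqP; rewrite subr_eq0 => /eqP ->; rewrite hx.
  by have := rep_linearr rho X k%:R x 0; rewrite P0 !addr0.
- case: hw => v0 _ _ _ kv W; have : [set 0 : V] v by rewrite -W.
  by move=> /= v00; rewrite v00 eqxx in v0.
- by have : setT w by []; rewrite -W.
Qed.

Definition lfam := rep_fam level_scalar.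

Lemma hwv_lfam : hwv i lfam v.
Proof. by case: hw => v0 e0 pos h0 _; split=> //; exact: pos. Qed.

(** In an irreducible module, a vector related to 0 vanishes: the sums of such
    vectors form a submodule, which by the grading cannot contain the highest
    weight vector. *)
Lemma irreducible_transfer (V' : lmodType K) (f' : family k V') v' n w :
  hwv i f' v' -> tandem lfam f' v v' n w 0 -> w = 0.
Proof.
move=> hv' gw; have hv := hwv_lfam.
pose W : set V := [set y | exists2 s : seq (int * V),
  forall p, p \in s -> tandem lfam f' v v' p.1 p.2 0 & y = \sum_(p <- s) p.2].
have W0 : W 0 by exists [::]; rewrite ?big_nil.
have Wlin a x y : W x -> W y -> W (a *: x + y).
  move=> [s hs ->] [t ht ->]; exists ([seq (p.1, a *: p.2) | p <- s] ++ t).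
    move=> p; rewrite mem_cat => /orP[/mapP[q /hs g ->]|/ht//] /=.
    by have := tandemZ a g; rewrite scaler0.
  by rewrite big_cat big_map scaler_sumr.
have WZ a x : W x -> W (a *: x) by move=> hx; rewrite -[a *: x]addr0; exact: Wlin.
have WD x y : W x -> W y -> W (x + y) by move=> hx; rewrite -[x]scale1r; exact: Wlin.
have Wop (h : {linear V -> V}) (d : int) : (forall m x, tandem lfam f' v v' m x 0 ->
    tandem lfam f' v v' (m + d) (h x) 0) -> forall x, W x -> W (h x).
  move=> hG x [s hs ->]; rewrite linear_sum.
  exists [seq (p.1 + d, h p.2) | p <- s]; last by rewrite big_map.
  by move=> p /mapP[q /hs g ->]; exact: hG.
have Wmode (a : sl2 K) m x : W x -> W (rho (tmono a m) x).
  move=> Wx; have [b [c [d ->]]] := sl2_span a.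
  have tZ e (z : sl2 K) : rho (tmono (e *: z) m) x = e *: rho (tmono z m) x.
    exact: rep_tmonoZ.
  have tD (z z' : sl2 K) : rho (tmono (z + z') m) x = rho (tmono z m) x + rho (tmono z' m) x.
    have := rep_linearl rho 1 (tmono z m) (tmono z' m) x.
    by rewrite !scale1r -tmonoD.
  rewrite !tD !tZ; apply: (WD); first apply: (WD); apply: WZ.
  - apply: (Wop (fE lfam m) (- (2 * m) - 1)) Wx => n' y g.
    by have := tandem_E m g; rewrite linear0 addrA.
  - apply: (Wop (fF lfam m) (- (2 * m) + 1)) Wx => n' y g.
    by have := tandem_F m g; rewrite linear0 addrA.
  - apply: (Wop (fH lfam m) (- (2 * m))) Wx => n' y g.
    by have := tandem_H m g; rewrite linear0.
have Wrho X x : W x -> W (rho X x).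
  move=> Wx; elim/affine_ind: X => [X Y IX IY|a m|c]; last 2 first.
  - exact: Wmode.
  - rewrite -[c *: _]addr0 rep_linearl level_scalar.
    have -> : rho 0 x = 0.
      by have := rep_linearl rho (-1) 0 0 x; rewrite scaler0 addr0 scaleN1r addNr.
    by rewrite addr0; apply/WZ/WZ.
  by have := rep_linearl rho 1 X Y x; rewrite !scale1r => ->; exact: WD.
have [_ /(_ W W0 Wlin Wrho)[WE|WE]] := hirr.
  have : W w by exists [:: (n, w)]; rewrite ?big_seq1 // => p; rewrite inE => /eqP ->.
  by rewrite WE.
have [s hs vE] : W v by rewrite WE.
have vs : v = \sum_(p <- s | p.1 == 0) p.2.
  pose t := (0, - v, - v') :: [seq (p.1, p.2, 0 : V') | p <- s].
  have ht p : p \in t -> tandem lfam f' v v' p.1.1 p.1.2 p.2.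
    rewrite inE => /orP[/eqP -> /=|/mapP[q /hs g ->] //].
    by rewrite -!scaleN1r; apply/tandemZ/tandem_hw.
  have t0 : \sum_(p <- t) p.1.2 = 0 by rewrite big_cons big_map -vE addNr.
  have := tandem_split hv ht t0 0; rewrite big_cons eqxx big_map /= => /eqP.
  by rewrite addrC subr_eq0 eq_sym => /eqP.
have G0 (r : seq (int * V)) : (forall p, p \in r -> tandem lfam f' v v' p.1 p.2 0) ->
    tandem lfam f' v v' 0 (\sum_(p <- r | p.1 == 0) p.2) 0.
  elim: r => [|p r IH] hr; first by rewrite big_nil; exact: tandem_zero.
  have h : tandem lfam f' v v' 0 (\sum_(q <- r | q.1 == 0) q.2) 0.
    by apply: IH => q qr; apply: hr; rewrite inE qr orbT.
  rewrite big_cons; case: eqP => // p0; rewrite -[X in tandem _ _ _ _ _ _ X]addr0.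
  by apply: tandemD => //; rewrite -p0; exact: hr (mem_head _ _).
have : tandem lfam f' v v' 0 v 0 by rewrite [X in tandem _ _ _ _ _ X]vs; exact: G0.
move/(tandem_degree0 hv hv')=> [c [vc /esym/eqP]].
case: hv' => v0' _ _ _; rewrite scaler_eq0 (negbTE v0') orbF => /eqP c0.
by case: hv => /eqP []; rewrite vc c0 scale0r.
Qed.

End Irreducible.

(** * Ideals and kernels *)

Section RepAction.
Variables (K : fieldType) (k : nat) (V : lmodType K) (rho : lieRep (affine K) V).
Hypothesis hk : forall v, rho (kk K) v = k%:R *: v.

Lemma uact_uincl r (a : Uenv (subLie (nbar_le K r))) v :
  uact rho (uincl a) v = nbact (rep_fam hk) a v.
Proof.
elim/Uenv_ind: a v => [X|c|a b IHa IHb|a b IHa IHb] v.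
- rewrite /uincl (ulift_gen (incl_lie_to_alg _)) uact_gen /nbact uact_gen.
  rewrite (xgen_ind (g := fun X => rho (subLie_val X) v)) //.
  by move=> c Y Z; rewrite subLie_valP rep_linearl.
- by rewrite /uincl (uliftA (incl_lie_to_alg _)) /nbact !uactA.
- by rewrite /uincl (uliftD (incl_lie_to_alg _)) nbactD uactD IHa IHb.
- by rewrite /uincl (uliftM (incl_lie_to_alg _)) nbactM uactM IHb IHa.
Qed.

End RepAction.

Lemma xshift_id (K : fieldType) (a : Uenv (subLie (nbar_le K 1))) :
  @xshift K 1 1 0 a = a.
Proof.
have [l ->] := ulc_surj a; rewrite xshift_ulc; congr ulc.
rewrite -[RHS]map_id; apply: eq_map => -[c s] /=; congr pair.
by rewrite (eq_map addn0) map_id.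
Qed.

Section Decomposition.
Variables (K : numFieldType) (k i : nat) (V : lmodType K) (f : family k V) (v : V).
Hypothesis hv : hwv i f v.
Local Notation A := (Uenv (subLie (nbar_le K 1))).

Lemma fH0_umon s : fH f 0 (nbact f (umon K 1 s) v) =
  (i%:R + 2%:R * (size s)%:R) *: nbact f (umon K 1 s) v.
Proof.
rewrite nbact_umon; elim: s => [|j s IH] /=.
  by case: hv => _ _ _ ->; rewrite mulr0 addr0.
rewrite fHE IH linearZ add0r -scalerDl; congr (_ *: _).
by rewrite -natr1; ring.
Qed.

(** If a, or its shift, kills a highest weight vector then so do its
    bihomogeneous components, as h(0) and the degree operator separate them. *)
Lemma annih_components t (a : A) : nbact f (@xshift K 1 1 t a) v = 0 ->
  exists2 s : seq A, a = \sum_(b <- s) b & forall b, b \in s ->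
    exists e d, Hom e d b /\ nbact f (@xshift K 1 1 t b) v = 0.
Proof.
have [l ->] := ulc_surj a; rewrite xshift_ulc nbact_ulc big_map /= => l0.
pose key (p : K * seq nat) := (sumn p.2, size p.2).
pose part x := [seq p <- l | key p == x].
pose X (p : K * seq nat) := p.1 *: nbact f (umon K 1 [seq (j + t)%N | j <- p.2]) v.
have size0 d : \sum_(p <- l | size p.2 == d) X p = 0.
  have := @eigen_split _ _ (fH f 0)
    [seq (i%:R + 2%:R * (size p.2)%:R, X p) | p <- l].
  rewrite !big_map => /(_ _ l0 (i%:R + 2%:R * d%:R)); rewrite big_map /=.
  have inj (n : nat) : (i%:R + 2%:R * n%:R == i%:R + 2%:R * d%:R :> K) = (n == d).
    by rewrite (inj_eq (addrI _)) (inj_eq (mulfI _)) ?pnatr_eq0 // eqr_nat.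
  under eq_bigl do rewrite inj.
  apply=> q /mapP[p pl ->]; rewrite /= /X linearZ /= fH0_umon size_map.
  by rewrite !scalerA mulrC.
have key0 e d : \sum_(p <- part (e, d)) X p = 0.
  pose F (p : K * seq nat) : int := 2 * (sumn p.2 + t * d)%N%:Z + d%:Z.
  have := @tandem_split _ _ _ _ _ _ hv _ f v
    [seq (F p, X p, X p) | p <- [seq p <- l | size p.2 == d]].
  rewrite !big_map big_filter => /(_ _ (size0 d) (2 * (e + t * d)%N%:Z + d%:Z)).
  rewrite big_map -big_filter -filter_predI => h.
    apply: etrans (h _).
      rewrite /part; congr bigop; apply: eq_filter => p /=.
      rewrite xpair_eqE; have [_|] := eqVneq (size p.2) d; last by rewrite !andbF.
      by rewrite !andbT /F; apply/eqP/eqP => [->//|]; lia.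
  move=> q /mapP[p]; rewrite mem_filter => /andP[/eqP pd pl] -> /=; apply: tandemZ.
  have hH := Hom_xshift 1 t (Hom_umon K 1 p.2); rewrite xshift_umon pd in hH.
  by have := tandem_nbact f f v v hH; rewrite /F mulnC.
exists [seq ulc 1 (part x) | x <- undup (map key l)].
  rewrite big_map /ulc; under [RHS]eq_bigr do rewrite big_filter.
  rewrite (exchange_big_dep xpredT) //=; apply: eq_big_seq => p pl.
  rewrite big_mkcond (bigD1_seq (key p)) ?undup_uniq ?mem_undup ?map_f //= eqxx.
  by rewrite big1 ?addr0 // => x; rewrite eq_sym => /negbTE ->.
move=> b /mapP[[e d] _ ->]; exists e, d; split.
  exists (part (e, d)) => // p; rewrite mem_filter => /andP[/eqP[pe pd] _].
  by rewrite pe pd.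
by rewrite xshift_ulc nbact_ulc big_map; exact: key0.
Qed.

End Decomposition.

Section Main.
Variables (K : numClosedFieldType) (k i : nat).
Hypothesis ik : (i <= k)%N.
Variables (L : lmodType K) (rhoL : lieRep (affine K) L) (vL : L).
Hypothesis hirr : irreducible_rep rhoL.
Hypothesis hw : highest_weight_vector k i rhoL vL.

Let fL := lfam hirr hw.
Let hv : hwv i fL vL := hwv_lfam hirr hw.
Local Notation y j := (ugen (xneg K 1 j)).
Local Notation R := (Rcomp K 1).
Local Notation sh := (@xshift K 1 1 1).

Lemma annih_from_fock e d (a : Uenv (subLie (nbar_le K 1))) : Hom e d a ->
  nbact (fock_fam K k) a (top_of K k i) = 0 -> nbact fL a vL = 0.
Proof.
move=> ha a0; have := tandem_nbact fL (fock_fam K k) vL (top_of K k i) ha.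
by rewrite a0; apply: irreducible_transfer; exact: hwv_top_of.
Qed.

Lemma annih_L_R s : nbact fL (R k.+1 s) vL = 0.
Proof. by apply: (annih_from_fock (Hom_Rcomp K 1 k.+1 s)); exact: annih_R. Qed.

Lemma annih_L_y : nbact fL (y 0 ^+ (k - i + 1)) vL = 0.
Proof.
apply: (annih_from_fock (Hom_expn K 1 0 _)); rewrite nbact_exp.
exact: fock_extremal.
Qed.

Lemma annih_L_ideal a : I_ideal k i a -> nbact fL a vL = 0.
Proof.
move=> [s hs ->]; rewrite nbact_sum big1_seq // => p /= ps; rewrite nbactM.
suff -> : nbact fL p.2 vL = 0 by rewrite nbactv0.
case: (hs p ps) => [[t /= kt <-]|->]; last exact: annih_L_y.
by rewrite RrelE mul1n // annih_L_R.
Qed.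

Lemma ideal_sum (s : seq (Uenv (subLie (nbar_le K 1)))) :
  (forall b, b \in s -> I_ideal k i b) -> I_ideal k i (\sum_(b <- s) b).
Proof.
elim: s => [|b s IH] hs; first by exists [::]; rewrite ?big_nil.
have [t ht tE] := hs b (mem_head _ _).
have [|t' ht' tE'] := IH; first by move=> c cs; apply: hs; rewrite inE cs orbT.
exists (t ++ t'); last by rewrite big_cons big_cat tE tE'.
by move=> p; rewrite mem_cat => /orP[/ht|/ht'].
Qed.

(** Bihomogeneous components are carried to the Fock space, where the annihilator
    is known. *)
Lemma ideal_annih_L a : nbact fL a vL = 0 -> I_ideal k i a.
Proof.
rewrite -(xshift_id a) => /(annih_components hv)[s -> hs].
rewrite xshift_id; apply: ideal_sum => b /hs[e [d [hb]]]; rewrite xshift_id => b0.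
apply: hideal_ideal (annih_ideal ik hb _).
exact: fock_transfer ik hv hb b0.
Qed.

Hypothesis iE : i = k.

(** R^1_{k,t} is a shifted relation, hence R^0_{k,t} modulo x_alpha(-1), and for
    i = k the latter kills the highest weight vector. *)
Lemma annih_L_ideal' a : I'_ideal k a -> nbact fL a vL = 0.
Proof.
move=> [s hs ->]; rewrite nbact_sum big1_seq // => p /= ps; rewrite nbactM.
suff -> : nbact fL p.2 vL = 0 by rewrite nbactv0.
case: (hs p ps) => t /= kt <-; rewrite RrelE //.
set n := (t - _)%N; have [g _ RE] := Rcomp_shift K k.+1 n.
rewrite -xshift_Rcomp nbact_xshift12.
have := annih_L_R (n + k.+1); rewrite RE nbactD umulC nbactM.
have := annih_L_y; rewrite iE subnn expr1 => ->.
by rewrite nbactv0 addr0.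
Qed.

(** For i = k the extremal vector is v itself: an element c of U(nbar_-) whose
    shift kills v annihilates the top vector of weight Lambda_{k,0}. *)
Lemma ideal'_annih_L a : nbact fL a vL = 0 -> I'_ideal k a.
Proof.
have aE : a = @xshift K 1 2 0 (@xshift K 2 1 0 a).
  have [l ->] := ulc_surj a; rewrite !xshift_ulc -map_comp; congr ulc.
  rewrite -[LHS]map_id; apply: eq_map => -[c s] /=; congr pair.
  by rewrite -map_comp -[LHS]map_id; apply: eq_map => j /=; rewrite !addn0.
rewrite aE; move: (xshift 1 0 a) => c {aE a}.
rewrite nbact_xshift12 => /(annih_components hv)[s -> hs].
have inI b : b \in s -> I'_ideal k (@xshift K 1 2 0 b).
  move=> /hs[e [d [hb b0]]]; apply: (@hideal0_ideal' _ _ e d).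
  apply: annih_ideal => //; have := @annih_shift K k i e d b ik hb.
  have -> : (k - i = 0)%N by rewrite iE subnn.
  rewrite expr0 mulr1; apply.
  exact: fock_transfer ik hv (Hom_xshift 1 1 hb) b0.
elim: s {hs} inI => [|b s IH] hs.
  by exists [::]; rewrite ?big_nil ?xshift0.
have [t ht tE] := hs b (mem_head _ _).
have [|t' ht' tE'] := IH; first by move=> c' cs; apply: hs; rewrite inE cs orbT.
exists (t ++ t'); last by rewrite big_cons xshiftD big_cat tE tE'.
by move=> p; rewrite mem_cat => /orP[/ht|/ht'].
Qed.

End Main.

(** * The generalized Verma module *)

Section VermaVector.
Variables (K : fieldType) (k : nat) (U : vectType K) (rhoU : lieRep (sl2 K) U) (u : U).
Hypothesis xau : rhoU (xa K) u = 0.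
Local Notation rhoN := (gvermaRep k rhoU).
Local Notation vN := (gverma_vector k rhoU u).

Lemma verma_xa_ge0 (m : int) : 0 <= m -> rhoN (tmono (xa K) m) vN = 0.
Proof.
move=> m0; have hX : in_subalg (ge0 K) (tmono (xa K) m).
  by apply/asboolP => n n0; rewrite tmonoE; case: eqP => // nm; lia.
have t0 w : tpure (evalRep k rhoU) w 0 = 0.
  by apply: (addrI (tpure (evalRep k rhoU) w 0)); rewrite -tpureDr !addr0.
rewrite /gverma_vector /= /ilmul -/(ilmul _ _) ilmul_pure mulr1.
have -> : ugen (tmono (xa K) m) = 1 * uincl (ugen (SubLie hX)).
  by rewrite mul1r /uincl (ulift_gen (incl_lie_to_alg _)).
rewrite tpure_balanced uact_gen /= /eval_act /= mulr0 scale0r addr0.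
case: eqP => _; first by rewrite xau t0.
have -> : rhoU 0 u = 0.
  by have := rep_linearl rhoU (-1) 0 0 u; rewrite scaler0 addr0 scaleN1r addNr.
exact: t0.
Qed.

Lemma ugen_xa_comm r m (b : Uenv (subLie (nbar_le K r))) :
  ugen (tmono (xa K) m) * uincl b = uincl b * ugen (tmono (xa K) m).
Proof.
have hm : tmono (xa K) m \in nbar_pred (K := K) predT.
  apply/asboolP; split=> // n; rewrite tmonoE.
  by exists (n == m)%:R => //; case: eqP; rewrite ?scale1r ?scale0r.
elim/Uenv_ind: b => [X|c|a b IHa IHb|a b IHa IHb].
- rewrite /uincl (ulift_gen (incl_lie_to_alg _)); apply/eqP; rewrite -subr_eq0.
  rewrite -ugen_br (@nbar_br0 _ predT) //; last first.
    have /asboolP[X2 Xa] := valP X; apply/asboolP; split=> // n.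
    by have [c cE _] := Xa n; exists c.
  by have := @ugen_linear K (affine K) (-1) 0 0; rewrite scaler0 addr0 scaleN1r addNr => ->.
- by rewrite /uincl (uliftA (incl_lie_to_alg _)) -scalerAl -scalerAr mul1r mulr1.
- by rewrite /uincl (uliftD (incl_lie_to_alg _)) mulrDl mulrDr -/(uincl a) -/(uincl b) IHa IHb.
- rewrite /uincl (uliftM (incl_lie_to_alg _)) -/(uincl a) -/(uincl b).
  by rewrite mulrA IHa -mulrA IHb mulrA.
Qed.

(** The nonnegative modes of x_alpha commute with U(nbar_-) and kill vN. *)
Lemma principal_neg (a : Uenv (subLie (nbar K))) : exists b : Uenv (subLie (nbar_le K 1)),
  uact rhoN (uincl a) vN = uact rhoN (uincl b) vN.
Proof.
suff key : forall b : Uenv (subLie (nbar_le K 1)), exists b' : Uenv (subLie (nbar_le K 1)),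
    uact rhoN (uincl a) (uact rhoN (uincl b) vN) = uact rhoN (uincl b') vN.
  have [b' bE] := key 1; exists b'; rewrite -bE.
  rewrite -(scale1r (1 : Uenv (subLie (nbar_le K 1)))) /uincl.
  by rewrite (uliftA (incl_lie_to_alg _)) uactA scale1r.
have act0 : uact rhoN (uincl (0 : Uenv (subLie (nbar_le K 1)))) vN = 0.
  rewrite -(scale0r (1 : Uenv (subLie (nbar_le K 1)))) /uincl.
  by rewrite (uliftA (incl_lie_to_alg _)) uactA scale0r.
have actD (b c : Uenv (subLie (nbar_le K 1))) : uact rhoN (uincl (b + c)) vN =
    uact rhoN (uincl b) vN + uact rhoN (uincl c) vN.
  by rewrite /uincl (uliftD (incl_lie_to_alg _)) uactD.
have actZ e (b : Uenv (subLie (nbar_le K 1))) : uact rhoN (uincl (e *: b)) vN =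
    e *: uact rhoN (uincl b) vN.
  rewrite -[b in LHS]mul1r scalerAl /uincl (uliftM (incl_lie_to_alg _)).
  by rewrite (uliftA (incl_lie_to_alg _)) uactM uactA.
elim/Uenv_ind: a => [X|c|a a' IH IH'|a a' IH IH'] b.
- rewrite /uincl (ulift_gen (incl_lie_to_alg _)) uact_gen -/(uincl b).
  have /asboolP[X2 Xa] := valP X.
  rewrite (affineE (subLie_val X)) X2 scale0r addr0.
  have /asboolP Xf := valP (subLie_val X).1; rewrite fsbig_finite //=.
  have lin0 w : rhoN 0 w = 0.
    by have := rep_linearl rhoN (-1) 0 0 w; rewrite scaler0 addr0 scaleN1r addNr.
  elim: (enum_fset _) => [|m s [b' bE]].
    by exists 0; rewrite big_nil act0; exact: lin0.
  set w := uact rhoN (uincl b) vN in bE *.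
  have [c cE _] := Xa m; have {}cE : (subLie_val X).1 m = c *: xa K := cE.
  rewrite big_cons cE.
  have -> : tmono (c *: xa K) m = c *: tmono (xa K) m.
    by rewrite -[c *: xa K]addr0 tmono_linear tmono0 addr0.
  have sE := etrans (rep_linearl rhoN c (tmono (xa K) m) _ w)
    (congr1 (fun z => c *: rhoN (tmono (xa K) m) w + z) bE).
  have [m0|m0] := leP 0 m.
    exists b'; apply: etrans sE _; suff -> : rhoN (tmono (xa K) m) w = 0 by rewrite scaler0 add0r.
    rewrite /w -uact_gen -uactM ugen_xa_comm uactM uact_gen verma_xa_ge0 //.
    have h := uact_linear rhoN (uincl b) (-1) 0 0.
    by rewrite scaler0 addr0 scaleN1r addNr in h.
  exists (c *: (ugen (xneg K 1 (absz (m + 1))) * b) + b').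
  apply: etrans sE _; rewrite actD actZ; congr (_ *: _ + _); rewrite /uincl (uliftM (incl_lie_to_alg _)).
  rewrite (ulift_gen (incl_lie_to_alg _)) uactM uact_gen /=.
  by congr (rhoN (tmono _ _) _); lia.
- exists (c *: b); rewrite actZ /uincl (uliftA (incl_lie_to_alg _)) uactA.
  by [].
- have [c cE] := IH b; have [c' cE'] := IH' b; exists (c + c').
  by rewrite actD -cE -cE' /uincl (uliftD (incl_lie_to_alg _)) uactD.
- have [c' cE'] := IH' b; have [c cE] := IH c'; exists c.
  by rewrite -cE -cE' /uincl (uliftM (incl_lie_to_alg _)) uactM.
Qed.

Lemma neg_principal r (b : Uenv (subLie (nbar_le K r))) :
  exists a : Uenv (subLie (nbar K)), uincl a = uincl b.
Proof.
elim/Uenv_ind: b => [X|c|b b' [a aE] [a' aE']|b b' [a aE] [a' aE']].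
- have hX : in_subalg (nbar K) (subLie_val X).
    have /asboolP[X2 Xa] := valP X; apply/asboolP; split=> // n.
    by have [c cE _] := Xa n; exists c.
  by exists (ugen (SubLie hX)); rewrite /uincl !(ulift_gen (incl_lie_to_alg _)).
- by exists (c%:A); rewrite /uincl !(uliftA (incl_lie_to_alg _)).
- exists (a + a'); rewrite /uincl !(uliftD (incl_lie_to_alg _)).
  by congr (_ + _).
- exists (a * a'); rewrite /uincl !(uliftM (incl_lie_to_alg _)).
  by congr (_ * _).
Qed.

End VermaVector.

(** The projection takes b . vN to b . vL, and every vector of the principal
    subspace is of the form b . vN with b in U(nbar_-); so the kernel consists of
    the b . vN for which b annihilates vL. *)
Theorem kernel_presentation (K : numClosedFieldType) (k i : nat) (hi : (i <= k)%N)
  (U : vectType K) (rhoU : lieRep (sl2 K) U) (u : U) (hu : rhoU (xa K) u = 0)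
  (L : lmodType K) (rhoL : lieRep (affine K) L) (vL : L)
  (hirr : irreducible_rep rhoL) (hw : highest_weight_vector k i rhoL vL)
  (Pi : {linear gverma k rhoU -> L})
  (hPi : canonical_projection (gvermaRep k rhoU) rhoL (gverma_vector k rhoU u)
           vL Pi) :
  let rhoN := gvermaRep k rhoU in
  let vN := gverma_vector k rhoU u in
  let N1 := [set w | Pi w = 0] in
  (lker_on Pi (principal_subspace rhoN vN) = act_set rhoN (I_ideal k i) vN /\
   act_set rhoN (I_ideal k i) vN `<=` N1) /\
  (i = k ->
   lker_on Pi (principal_subspace' rhoN vN) = act_set rhoN (I'_ideal k) vN /\
   act_set rhoN (I'_ideal k) vN `<=` N1).
Proof.
move=> rhoN vN N1.
have PiE r (b : Uenv (subLie (nbar_le K r))) :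
    Pi (uact rhoN (uincl b) vN) = nbact (lfam hirr hw) b vL.
  exact: etrans (proj2 hPi _) (uact_uincl (level_scalar hirr hw) b vL).
have sub1 : act_set rhoN (I_ideal k i) vN `<=` N1.
  by move=> _ [b bI <-]; rewrite /N1 /= PiE; exact: annih_L_ideal.
split.
  split=> //; apply/seteqP; split=> [x [[a _ <-] Px]|x xI].
    have [b bE] := principal_neg k hu a.
    exists b; last by rewrite -bE.
    apply: (@ideal_annih_L K k i hi L rhoL vL hirr hw b).
    by rewrite -PiE /rhoN /vN -bE.
  split; last exact: sub1.
  by case: xI => b _ <-; have [a aE] := neg_principal b; exists a; rewrite // aE.
move=> ik; have sub2 : act_set rhoN (I'_ideal k) vN `<=` N1.
  by move=> _ [b bI <-]; rewrite /N1 /= PiE; exact: annih_L_ideal'.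
split=> //; apply/seteqP; split=> [x [[a _ <-] Px]|x xI].
  exists a => //; apply: (@ideal'_annih_L K k i hi L rhoL vL hirr hw ik a).
  by rewrite -PiE.
split; last exact: sub2.
by case: xI => b _ <-; exists b.
Qed.

Theorem theorem3p2 (R : realType) (k i : nat) (hk : (1 <= k)%N) (hi : (i <= k)%N)
  (* U_i and its highest weight vector *)
  (U : vectType (complex R)) (rhoU : lieRep (sl2 (complex R)) U) (u : U)
  (hU : irreducible_sl2 i rhoU u)
  (* L(Lambda_{k,i}) and its highest weight vector *)
  (L : lmodType (complex R)) (rhoL : lieRep (affine (complex R)) L) (vL : L)
  (hL : standard_module k i rhoL vL)
  (Pi : {linear gverma k rhoU -> L})
  (hPi : canonical_projection (gvermaRep k rhoU) rhoL (gverma_vector k rhoU u)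
           vL Pi) :
  let rhoN := gvermaRep k rhoU in
  let vN := gverma_vector k rhoU u in
  let N1 := [set w | Pi w = 0] in
  (lker_on Pi (principal_subspace rhoN vN) = act_set rhoN (I_ideal k i) vN /\
   act_set rhoN (I_ideal k i) vN `<=` N1) /\
  (i = k ->
   lker_on Pi (principal_subspace' rhoN vN) = act_set rhoN (I'_ideal k) vN /\
   act_set rhoN (I'_ideal k) vN `<=` N1).
Proof.
have [_ _ _ hu _] := hU; have [hirr _ hw] := hL.
exact: (@kernel_presentation (complex R) k i hi U rhoU u hu L rhoL vL hirr hw Pi hPi).
Qed.
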